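(* Let $\{i_1,\dots,i_s\}$ and $\{j_1,\dots,j_{s_1}\}$ be types with $i_1+\dots+i_s=j_1+\dots+j_{s_1}=n$ and $\{i_1,\dots,i_s\}\ge\{j_1,\dots,j_{s_1}\}$. Then there exists a $G$-equivariant surjective homomorphism (morphism of varieties) $\mathrm{sh}_{\{i_1,\dots,i_s\}}\to\mathrm{sh}_{\{j_1,\dots,j_{s_1}\}}$. In particular, for any type $\{i_1,\dots,i_s\}$ with $i_1+\dots+i_s=n$ there exists such a homomorphism $h_{\{i_1,\dots,i_s\}}:\mathrm{sh}^{(n)}\to\mathrm{sh}_{\{i_1,\dots,i_s\}}$, where $\mathrm{sh}^{(n)}=\mathrm{sh}_{\{1,\dots,1\}}$ ($n$ ones).
   Context: Everything is over $\mathbb{C}$. Fusion product: for positive integers $A=(a_1,\dots,a_n)$ choose pairwise distinct $z_1,\dots,z_n\in\mathbb{C}$ and let $\mathbb{C}^{a_i}(z_i)$ be the evaluation module of $\mathfrak{sl}_2\otimes\mathbb{C}[t]$, i.e. the irreducible $a_i$-dimensional $\mathfrak{sl}_2$-module on which $x_k:=x\otimes t^k$ acts as $z_i^k x$. The tensor product $V=\bigotimes_i\mathbb{C}^{a_i}(z_i)$ is cyclic, generated by the tensor product $v$ of lowest weight vectors. Filter $V$ by the subspaces $V^{(m)}$ spanned by $x^{(1)}_{k_1}\cdots x^{(r)}_{k_r}v$ with $x^{(l)}\in\mathfrak{sl}_2$ and $k_1+\dots+k_r\le m$. The fusion product $M^A$ is the associated graded $\mathfrak{sl}_2\otimes\mathbb{C}[t]$-module;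 it is (known to be) independent of the $z_i$ and is an $\mathfrak{sl}_2\otimes(\mathbb{C}[t]/t^n)$-module. Let $v_A\in M^A$ be the image of $v$. Schubert variety: $G=\mathrm{SL}_2(\mathbb{C}[t]/t^n)$ acts on $\mathbb{P}(M^A)$; for $2\le a_1\le\dots\le a_n$ put $\mathrm{sh}_A=\overline{G\cdot[v_A]}\subset\mathbb{P}(M^A)$, where $[v_A]=\mathbb{C}v_A$. A type is an ordered tuple $\{i_1,\dots,i_s\}$ of positive integers with sum $n$. An $n$-tuple $A$ is of this type if $a_1=\dots=a_{i_1}\ne a_{i_1+1}=\dots=a_{i_1+i_2}\ne\dots\ne a_{n-i_s+1}=\dots=a_n$. Put $\mathrm{sh}_{\{i_1,\dots,i_s\}}=\mathrm{sh}_A$ for $A=(2^{i_1}3^{i_2}\cdots(s+1)^{i_s})$, i.e. $i_1$ entries equal to $2$, then $i_2$ entries equal to $3$, etc. (up to $G$-equivariant isomorphism any $A$ of this type with entries $2\le a_1\le\dots\le a_n$ can be used). Order on types of the same size $n$: $\{i_1,\dots,i_s\}\ge\{j_1,\dots,j_{s_1}\}$ if for any $A$ of type $\{i_1,\dots,i_s\}$ and $B$ of type $\{j_1,\dots,j_{s_1}\}$ one has $a_l=a_{l+1}\Rightarrow b_l=b_{l+1}$ for all $l$; i.e. the second is obtained from the first by summing consecutive entries. *)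

(* Defs.v *)
From HB Require Import structures.
From mathcomp Require Import all_boot all_order all_algebra ring.
From mathcomp Require Import reals complex boolp.
From mathcomp Require Import mpoly.

Set Implicit Arguments.
Unset Strict Implicit.
Unset Printing Implicit Defensive.

Import GRing.Theory.
Local Open Scope ring_scope.

Section Span.
Context {K : fieldType} {V : vectType K}.

Definition is_vspan (S : V -> Prop) (U : {vspace V}) : Prop :=
  (forall u, S u -> u \in U) /\
  (forall W : {vspace V}, (forall u, S u -> u \in W) -> (U <= W)%VS).

Lemma vspan_exists (S : V -> Prop) : exists U, is_vspan S U.
Proof.
pose P d := `[< exists2 X : seq V, (forall u, u \in X -> S u) &
                 \dim <<X>>%VS = d >].
have exP : exists d, P d.
  by exists (\dim (<<[::] : seq V>>)%VS); apply/asboolP; exists [::].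
have ubP d : P d -> (d <= \dim {:V})%N.
  by move/asboolP=> [X _ <-]; apply: dimvS; apply: subvf.
have [d /asboolP[X XS dX] dmax] := ex_maxnP exP ubP.
exists <<X>>%VS; split=> [u Su|W SW]; last first.
  by apply/span_subvP => u /XS /SW.
have sX : (<<X>> <= <<u :: X>>)%VS.
  by rewrite span_cons addvSr.
suff /eqP-> : (<<X>> == <<u :: X>>)%VS by rewrite memv_span ?mem_head.
rewrite eqEdim sX dX dmax//; apply/asboolP; exists (u :: X) => // w.
by rewrite inE => /predU1P[->//|/XS].
Qed.

(* The linear span of an arbitrary (possibly infinite) set of vectors. *)
Definition vspan (S : V -> Prop) : {vspace V} := projT1 (cid (vspan_exists S)).

Lemma vspanP (S : V -> Prop) : is_vspan S (vspan S).
Proof. by rewrite /vspan; case: cid. Qed.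

End Span.

Section Sl2Module.
Context {K : fieldType}.

(* The irreducible sl2-module C^a with basis w_0, ..., w_(a-1), acting on
   column vectors: w_0 is a lowest weight vector and
   e w_l = w_(l+1), h w_l = (2l+1-a) w_l, f w_l = l(a-l) w_(l-1). *)
Definition sl2E a : 'M[K]_a := \matrix_(k, l) (k == l.+1 :> nat)%:R.
Definition sl2H a : 'M[K]_a :=
  \matrix_(k, l) ((k == l :> nat)%:R * ((l.*2.+1)%:R - a%:R)).
Definition sl2F a : 'M[K]_a :=
  \matrix_(k, l) ((k.+1 == l :> nat)%:R * (l * (a - l))%:R).

(* [[p, q], [r, -p]] = p h + q e + r f; only meaningful for \tr x = 0. *)
Definition sl2_rep a (x : 'M[K]_2) : 'M[K]_a :=
  x 0 0 *: sl2H a + x 0 1 *: sl2E a + x 1 0 *: sl2F a.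

End Sl2Module.

Section Evaluation.
Context {K : fieldType} {n : nat} (a : 'I_n -> nat) (z : 'I_n -> K).

(* The tensor product of the C^(a i): coordinates in the basis of pure tensors
   of basis vectors, which is indexed by multi-indices. *)
Definition multi_index := {dffun forall i : 'I_n, 'I_(a i)}.
Definition tensor := {ffun multi_index -> K^o}.

Definition set_index (m : multi_index) i (l : 'I_(a i)) : multi_index :=
  [ffun j : 'I_n => dfwith m l j].

(* 1 (x) ... (x) x (x) ... (x) 1, with x in position i. *)
Definition slot_act (x : 'M[K]_2) (i : 'I_n) (u : tensor) : tensor :=
  [ffun m : multi_index => \sum_(l < a i) sl2_rep (a i) x (m i) l * u (set_index m l)].

(* The action of x (x) t^k on the tensor product of the C^(a i)(z i). *)
Definition eval_act (x : 'M[K]_2) (k : nat) (u : tensor) : tensor :=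
  \sum_(i < n) z i ^+ k *: slot_act x i u.

Definition lowest : tensor := [ffun m : multi_index => [forall i, m i == 0 :> nat]%:R].

Definition word_act (w : seq ('M[K]_2 * nat)) : tensor :=
  foldr (fun p => eval_act p.1 p.2) lowest w.

Definition fusion_filtration (m : nat) : {vspace tensor} :=
  vspan (fun u => exists w : seq ('M[K]_2 * nat),
    [/\ all (fun p => \tr p.1 == 0) w, (sumn (map snd w) <= m)%N
      & u = word_act w]).

Definition fusion_filtration_pred (m : nat) : {vspace tensor} :=
  if m is m'.+1 then fusion_filtration m' else 0%VS.

(* The associated graded sl2 (x) C[t]-module of the filtration: fp_symb m
   restricted to V^(m) is V^(m) -> V^(m)/V^(m-1), followed by the inclusion of
   this quotient in the direct sum of all of them. Up to the values of
   fp_act at matrices x with \tr x <> 0 and of fp_symb m outside V^(m), which are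
   never used, this data is determined up to unique isomorphism;
   fusion_product_exists below provides an instance. *)
Record fusion_product := FusionProduct {
  fp_space :> vectType K;
  fp_act : 'M[K]_2 -> nat -> 'End(fp_space);
  fp_symb : nat -> 'Hom(tensor, fp_space);
  fp_ker : forall m,
    (lker (fp_symb m) :&: fusion_filtration m)%VS = fusion_filtration_pred m;
  fp_direct : forall N (u : nat -> tensor),
    (forall m, u m \in fusion_filtration m) ->
    \sum_(m < N) fp_symb m (u m) = 0 ->
    forall m, (m < N)%N -> fp_symb m (u m) = 0;
  fp_span : forall y : fp_space, exists N (u : nat -> tensor),
    (forall m, u m \in fusion_filtration m) /\
    y = \sum_(m < N) fp_symb m (u m);
  fp_actE : forall x k m u, \tr x = 0 -> u \in fusion_filtration m ->
    fp_act x k (fp_symb m u) = fp_symb (m + k)%N (eval_act x k u)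
}.

Definition fp_vec (M : fusion_product) : M := fp_symb M 0%N lowest.

Fact eval_act_linear x k : linear (eval_act x k).
Proof.
move=> c u v; rewrite /eval_act scaler_sumr -big_split; apply: eq_bigr => i _ /=.
rewrite scalerA mulrC -scalerA -scalerDr; congr (_ *: _).
apply/ffunP=> m; rewrite !ffunE scaler_sumr -big_split; apply: eq_bigr => l _ /=.
by rewrite !ffunE mulrDr; congr (_ + _); rewrite /GRing.scale /= mulrCA.
Qed.
HB.instance Definition _ x k :=
  GRing.isLinear.Build K tensor tensor _ (eval_act x k) (eval_act_linear x k).

Lemma fusion_filtrationS m m' :
  (m <= m')%N -> (fusion_filtration m <= fusion_filtration m')%VS.
Proof.
move=> le_m; apply: (vspanP _).2 => u [w [w1 w2 ->]].
by apply: (vspanP _).1; exists w; split=> //; apply: leq_trans le_m.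
Qed.

Lemma fusion_filtration_act x k m u : \tr x = 0 ->
  u \in fusion_filtration m -> eval_act x k u \in fusion_filtration (m + k).
Proof.
move=> x0; pose f : 'End(tensor) := linfun (eval_act x k).
suff /subvP h : (fusion_filtration m <= f @^-1: fusion_filtration (m + k))%VS.
  by move/h; rewrite -memv_preim lfunE.
apply: (vspanP _).2 => _ [w [w1 w2 ->]]; rewrite -memv_preim lfunE /=.
apply: (vspanP _).1; exists ((x, k) :: w); split=> //=; first by rewrite x0 eqxx.
by rewrite addnC leq_add2r.
Qed.

Lemma fusion_filtration_stable : exists N, forall m, (N <= m)%N ->
  fusion_filtration m = fusion_filtration N.
Proof.
pose P d := `[< exists m, \dim (fusion_filtration m) = d >].
have exP : exists d, P d.
  by exists (\dim (fusion_filtration 0)); apply/asboolP; exists 0%N.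
have ubP d : P d -> (d <= \dim {:tensor})%N.
  by move/asboolP=> [m <-]; apply: dimvS; apply: subvf.
have [d /asboolP[N dN] dmax] := ex_maxnP exP ubP.
exists N => m le_Nm; apply/esym/eqP; rewrite eqEdim fusion_filtrationS//=.
by rewrite dN; apply: dmax; apply/asboolP; exists m.
Qed.

Lemma fusion_filtration_predS m :
  (fusion_filtration_pred m <= fusion_filtration m)%VS.
Proof. by case: m => [|m]; rewrite ?sub0v ?fusion_filtrationS. Qed.

Lemma fusion_product_exists : inhabited fusion_product.
Proof.
have [N stab] := fusion_filtration_stable.
pose Fp := fusion_filtration_pred; pose FF := fusion_filtration.
pose C m := (FF m :\: Fp m)%VS; pose pi m := addv_pi1 (FF m) (Fp m).
have piC m u : pi m u \in C m by apply: memv_pi.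
have pi_sub m u : u \in FF m -> u - pi m u \in Fp m.
  move=> uF; rewrite -{1}[u](@addv_pi1_pi2 _ _ (FF m) (Fp m)).
    by rewrite addrC addKr memv_pi2.
  by rewrite (subvP (addvSl _ _)).
have pi0 m u : u \in Fp m -> pi m u = 0.
  move=> uF; have := @addv_pi1_pi2 _ _ (FF m) (Fp m) u.
  rewrite (subvP (addvSr _ _)) // addv_pi2_id // => /(_ isT) /eqP.
  by rewrite -subr_eq0 addrK => /eqP.
pose B : vectType K := {ffun 'I_N.+1 -> tensor}.
pose ev i (f : B) : tensor := f i.
have ev_lin i : linear (ev i) by move=> c f g; rewrite /ev !ffunE.
pose evL i := GRing.isLinear.Build K B tensor _ (ev i) (ev_lin i).
pose evl i : {linear B -> tensor} := HB.pack (ev i) (evL i).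
pose W : {vspace B} := (\bigcap_(i < N.+1) (linfun (evl i) @^-1: C i))%VS.
have WP (f : B) : f \in W <-> forall i, f i \in C i.
  rewrite -[f \in W]/(<[f]> <= W)%VS; split=> [/subv_bigcapP h i|h].
    by have := h i isT; rewrite -memvE -memv_preim lfunE.
  by apply/subv_bigcapP => i _; rewrite -memvE -memv_preim lfunE; apply: h.
pose single m (u : tensor) : B :=
  [ffun i : 'I_N.+1 => if i == m :> nat then pi m u else 0].
have singleW m u : single m u \in W.
  by apply/WP => i; rewrite ffunE; case: eqP => [->|_]; rewrite ?piC ?mem0v.
pose sy m (u : tensor) : subvs_of W := vsproj W (single m u).
have sy_lin m : linear (sy m).
  move=> c u v; rewrite /sy -linearP; congr vsproj; apply/ffunP=> i.
  by rewrite !ffunE; case: eqP => _; rewrite ?linearP // scaler0 addr0.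
pose syL m := GRing.isLinear.Build K tensor (subvs_of W) _ (sy m) (sy_lin m).
pose syl m : {linear tensor -> subvs_of W} := HB.pack (sy m) (syL m).
have syE m u : vsval (linfun (syl m) u) = single m u by rewrite lfunE vsprojK.
have sy0 m u : u \in Fp m -> linfun (syl m) u = 0.
  move=> uF; apply: val_inj; rewrite /= syE; apply/ffunP=> i.
  by rewrite !ffunE pi0 // if_same.
have sy_pi m u : u \in FF m -> linfun (syl m) u = linfun (syl m) (pi m u).
  move=> uF; have := sy0 _ _ (pi_sub _ _ uF).
  by rewrite linearB => /eqP; rewrite subr_eq0 => /eqP.
have Fbig m : (N < m)%N -> FF m = Fp m.
  by case: m => // m ltm; rewrite /FF /= !stab // ltnW.
have valsum (n0 : nat) (u : 'I_n0 -> subvs_of W) (i : 'I_N.+1) :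
  vsval (\sum_(m < n0) u m) i = \sum_(m < n0) vsval (u m) i.
  by rewrite linear_sum sum_ffunE.
pose ac x k (y : subvs_of W) : subvs_of W :=
  \sum_(i < N.+1) linfun (syl (i + k)%N) (eval_act x k (vsval y i)).
have ac_lin x k : linear (ac x k).
  move=> c u v; rewrite /ac scaler_sumr -big_split; apply: eq_bigr => i _ /=.
  have -> : vsval (c *: u + v) i = c *: vsval u i + vsval v i.
    by rewrite linearP !ffunE.
  by rewrite !linearP.
pose acL x k :=
  GRing.isLinear.Build K (subvs_of W) (subvs_of W) _ (ac x k) (ac_lin x k).
pose acl x k : {linear subvs_of W -> subvs_of W} := HB.pack (ac x k) (acL x k).
constructor; exists (subvs_of W) (fun x k => linfun (acl x k))
  (fun m => linfun (syl m)).
- move=> m; apply/vspaceP => u; rewrite memv_cap memv_ker.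
  apply/andP/idP => [[/eqP u0 uF]|uF]; last first.
    by rewrite sy0 // (subvP (fusion_filtration_predS m)).
  have [ltm|gem] := ltnP m N.+1; last by rewrite -[_ m]/(Fp m) -Fbig.
  have := congr1 (fun y : subvs_of W => (vsval y : B) (Ordinal ltm)) u0.
  rewrite syE ffunE eqxx linear0 ffunE => pi_u0.
  by have := pi_sub _ _ uF; rewrite pi_u0 subr0.
- move=> n0 u uF sum0 m ltm; apply: val_inj; rewrite /= syE.
  apply/ffunP=> i; rewrite !ffunE; case: eqP => // im.
  have := congr1 (fun y : subvs_of W => (vsval y : B) i) sum0; rewrite valsum linear0 ffunE.
  rewrite (bigD1 (Ordinal ltm)) //= syE ffunE im eqxx big1 ?addr0 // => j.
  by rewrite -val_eqE /= syE ffunE im eq_sym => /negPf->.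
- move=> y; have yC := (WP _).1 (subvsP y).
  exists N.+1, (fun m => if insub m is Some i then vsval y i else 0); split.
    move=> m; case: insubP => [i _ <-|_]; last exact: mem0v.
    exact: (subvP (diffvSl _ _)) (yC i).
  apply: val_inj; apply/ffunP=> i; rewrite /= valsum.
  rewrite (bigD1 i) //= big1 ?addr0; last first.
    move=> j; rewrite -val_eqE => /negPf ji.
    by rewrite valK syE ffunE eq_sym ji.
  rewrite valK syE ffunE eqxx; apply/eqP; rewrite -subr_eq0.
  suff: vsval y i - pi i (vsval y i) \in (C i :&: Fp i)%VS.
    by rewrite capv_diff memv0.
  rewrite memv_cap memvB ?piC ?yC //= pi_sub //.
  exact: (subvP (diffvSl _ _)) (yC i).
- move=> x k m u x0 uF; rewrite lfunE /= /ac.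
  have [ltm|gem] := ltnP m N.+1; last first.
    have um: u \in Fp m by rewrite -Fbig.
    rewrite sy0 // linear0 big1 => [|i _]; last by rewrite ffunE !linear0.
    apply/esym/sy0; case: m gem uF um => // m gem uF um.
    by rewrite addSn; apply: fusion_filtration_act.
  rewrite (bigD1 (Ordinal ltm)) //= big1 ?addr0 => [|j].
    rewrite syE ffunE eqxx; apply/esym/eqP; rewrite -subr_eq0.
    have : eval_act x k (u - pi m u) \in Fp (m + k)%N.
      have := pi_sub _ _ uF; case: {ltm} m uF => [|m] uF /=.
        by rewrite memv0 => /eqP->; rewrite linear0 mem0v.
      by move=> h; apply: fusion_filtration_act.
    by move/sy0; rewrite !linearB /= => ->.
  by rewrite -val_eqE /= syE ffunE => /negPf->; rewrite !linear0.
Qed.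

End Evaluation.

Section GroupAction.
Context {K : fieldType} {n : nat}.

(* C[t]/t^n; for n = 0 the library quotient is by 'X instead. *)
Definition trunc_poly := {poly %/ ('X^n : {poly K})}.

Definition lfun_exp (M : vectType K) (T : 'End(M)) : 'End(M) :=
  \sum_(j < (\dim {:M}).+1)
    (j`!%:R)^-1 *: iter j (fun S : 'End(M) => (T \o S)%VF) \1%VF.

Context {a : 'I_n -> nat} {z : 'I_n -> K} (M : fusion_product a z).

(* The action of X = \sum_k X_k t^k in sl2 (x) C[t]/t^n; t^n acts by zero. *)
Definition current_act (X : 'M[trunc_poly]_2) : 'End(M) :=
  \sum_(k < n) fp_act M (map_mx (fun p : trunc_poly => (p : {poly K})`_k) X) k.

(* The graph of the action of SL2(C[t]/t^n) integrating that of its Lie algebra: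
   the multiplicative relation generated by exp X |-> exp (current_act X) for X
   in sl2(C[t]/t^n) with X^2 = 0 (so that exp X = 1 + X; such an X acts
   nilpotently, so that lfun_exp is the full exponential series). The elements
   1 + X include the elementary matrices, hence generate the group:
   see SL2_acts_total. *)
Inductive SL2_acts : 'M[trunc_poly]_2 -> 'End(M) -> Prop :=
| SL2_acts_exp X : \tr X = 0 -> X *m X = 0 ->
    SL2_acts (1%:M + X) (lfun_exp (current_act X))
| SL2_acts_mul g h S T : SL2_acts g S -> SL2_acts h T ->
    SL2_acts (g *m h) (S \o T)%VF.

End GroupAction.

Section Mx2.
Context {R : comUnitRingType}.

Definition mx2 (p q r s : R) : 'M[R]_2 := \matrix_(i, j)
  (if i == 0 then if j == 0 then p else q else if j == 0 then r else s).

Lemma mx2E (X : 'M[R]_2) : X = mx2 (X 0 0) (X 0 1) (X 1 0) (X 1 1).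
Proof.
apply/matrixP=> i j; rewrite mxE.
by case: i j => [[|[|//]] ?] [[|[|//]] ?]; rewrite /=; congr (X _ _); apply: val_inj.
Qed.

Lemma mx2M p q r s p' q' r' s' : mx2 p q r s *m mx2 p' q' r' s' =
  mx2 (p * p' + q * r') (p * q' + q * s') (r * p' + s * r') (r * q' + s * s').
Proof.
apply/matrixP=> i j; rewrite !mxE !big_ord_recl big_ord0 !mxE /= addr0.
by case: ifP => _; case: ifP.
Qed.

Lemma mx2D p q r s p' q' r' s' : mx2 p q r s + mx2 p' q' r' s' =
  mx2 (p + p') (q + q') (r + r') (s + s').
Proof. by apply/matrixP=> i j; rewrite !mxE; do 2!case: ifP => _. Qed.

Lemma mx2_1 : 1%:M = mx2 1 0 0 1.
Proof.
by apply/matrixP=> i j; rewrite !mxE; case: i j => [[|[|//]] ?] [[|[|//]] ?].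
Qed.

Lemma mx2_0 : 0 = mx2 0 0 0 0.
Proof. by apply/matrixP=> i j; rewrite !mxE; do 2!case: ifP => _. Qed.

Lemma tr_mx2 p q r s : \tr (mx2 p q r s) = p + s.
Proof. by rewrite /mxtrace !big_ord_recl big_ord0 !mxE /= addr0. Qed.

Lemma det_mx2 p q r s : \det (mx2 p q r s) = p * s - q * r.
Proof.
rewrite (expand_det_row _ 0) !big_ord_recl big_ord0 /cofactor !det_mx11 !mxE /=.
by rewrite addr0 expr0 expr1 mul1r mulN1r mulrN.
Qed.

Lemma det_1D_mx2 (X : 'M[R]_2) : \tr X = 0 -> X *m X = 0 -> \det (1%:M + X) = 1.
Proof.
rewrite (mx2E X); move: (X 0 0) (X 0 1) (X 1 0) (X 1 1) => p q r s.
rewrite tr_mx2 mx2M mx2_1 mx2D det_mx2 => /eqP.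
rewrite addrC addr_eq0 => /eqP-> /matrixP/(_ 0 0); rewrite !mxE /= => sq0.
rewrite !add0r; transitivity (1 - (p * p + q * r)); first by ring.
by rewrite sq0 subr0.
Qed.

Lemma mx2_elementary p q r s : p * s - q * r = 1 -> r \is a GRing.unit ->
  mx2 p q r s =
    mx2 1 ((p - 1) / r) 0 1 *m mx2 1 0 r 1 *m mx2 1 ((s - 1) / r) 0 1.
Proof.
move=> dt ru; rewrite !mx2M ![_ * 0]mulr0 ![0 * _]mul0r !mul1r !mulr1.
rewrite !addr0 !add0r divrK // [r * _]mulrC divrK //; congr mx2; try by ring.
transitivity ((p * s - 1) / r); first by rewrite -dt subKr mulrK.
by ring.
Qed.

End Mx2.

Section Generation.
Context {K : fieldType} {n : nat}.
Local Notation A := (@trunc_poly K n).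

Lemma trunc_unit (p : A) : (p \is a GRing.unit) = ((p : {poly K})`_0 != 0).
Proof.
have E (q : {poly K}) : coprimep (mk_monic 'X^n) q = (q`_0 != 0).
  by rewrite mk_monic_Xn coprimep_pexpl // coprimep_sym coprimepX rootE horner_coef0.
exact: E.
Qed.

Lemma trunc_coef0M (p q : A) :
  ((p * q : A) : {poly K})`_0 = (p : {poly K})`_0 * (q : {poly K})`_0.
Proof.
have E (u : {poly K}) : (Pdiv.CommonRing.rmodp u (mk_monic 'X^n))`_0 = u`_0.
  rewrite [in RHS](Pdiv.RingMonic.rdivp_eq (monic_mk_monic 'X^n) u).
  by rewrite coefD [in X in X + _]mk_monic_Xn coefMXn add0r.
rewrite -coef0M; exact: E.
Qed.

Context {a : 'I_n -> nat} {z : 'I_n -> K} (M : fusion_product a z).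

Lemma SL2_acts_det g (T : 'End(M)) : SL2_acts g T -> \det g = 1.
Proof.
elim=> [X trX X2|g' h S T' _ dg _ dh]; last by rewrite det_mulmx dg dh mulr1.
exact: det_1D_mx2.
Qed.

Lemma SL2_acts_total (g : 'M[A]_2) : \det g = 1 -> exists T : 'End(M), SL2_acts g T.
Proof.
pose P (g : 'M[A]_2) := exists T : 'End(M), SL2_acts g T.
have PM g1 g2 : P g1 -> P g2 -> P (g1 *m g2).
  by move=> [S gS] [T gT]; exists (S \o T)%VF; apply: SL2_acts_mul.
have Pexp q r : q * r = 0 -> P (mx2 1 q r 1).
  move=> qr; pose X := mx2 0 q r 0; exists (lfun_exp (current_act M X)).
  have -> : mx2 1 q r 1 = 1%:M + X by rewrite mx2_1 mx2D !add0r !addr0.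
  apply: SL2_acts_exp; first by rewrite tr_mx2 addr0.
  by rewrite mx2M !mul0r !mulr0 !addr0 !add0r [r * q]mulrC qr -mx2_0.
have Pup q : P (mx2 1 q 0 1) by apply: Pexp; rewrite mulr0.
have Plo r : P (mx2 1 0 r 1) by apply: Pexp; rewrite mul0r.
have key p q r s : p * s - q * r = 1 -> r \is a GRing.unit -> P (mx2 p q r s).
  by move=> dt ru; rewrite (mx2_elementary dt ru); apply: (PM); first apply: (PM).
rewrite (mx2E g); move: (g 0 0) (g 0 1) (g 1 0) (g 1 1) => p q r s.
rewrite det_mx2 => dt; have [|ru] := boolP (r \is a GRing.unit); first exact: key.
have -> : mx2 p q r s = mx2 1 0 (-1) 1 *m mx2 p q (p + r) (q + s).
  by rewrite mx2M !mul1r !mul0r !addr0 !mulN1r !addKr.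
apply: (PM _ _ (Plo _)); apply: key.
  by rewrite -[RHS]dt !mulrDr [q * p]mulrC opprD addrACA subrr add0r.
move: ru; rewrite !trunc_unit negbK coefD => /eqP r0; rewrite r0 addr0.
apply/eqP=> p0; have /(congr1 (fun u : A => (u : {poly K})`_0)) := dt.
rewrite coefB !trunc_coef0M r0 p0 mul0r mulr0 subr0 coef1 eqxx => /eqP.
by rewrite eq_sym oner_eq0.
Qed.

End Generation.

Section Projective.
Context {K : fieldType}.

(* Subsets of the projective space P(M), whose points are the lines
   L : {vspace M} with \dim L = 1. *)
Definition proj_set (M : vectType K) := {vspace M} -> Prop.

(* Polynomial functions on M, in the coordinates of a basis of M. *)
Definition poly_on (M : vectType K) := {mpoly K[\dim {:M}]}.

Definition poly_eval (M : vectType K) (p : poly_on M) (u : M) : K :=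
  p.@[fun i => coord (vbasis {:M}) i u].

Definition poly_map (M M' : vectType K)
    (F : 'I_(\dim {:M'}) -> poly_on M) (u : M) : M' :=
  \sum_j poly_eval (F j) u *: (vbasis {:M'})`_j.

Definition vanishes_at (M : vectType K) (p : poly_on M) (L : {vspace M}) :=
  forall u, u \in L -> poly_eval p u = 0.

Definition zariski_closure (M : vectType K) (S : proj_set M) : proj_set M :=
  fun L => \dim L = 1%N /\
    forall d (p : poly_on M), p \is d.-homog ->
      (forall L', S L' -> vanishes_at p L') -> vanishes_at p L.

(* Near every point of X (on the trace on X of a basic open set g <> 0), h is
   given by forms of the same degree without common zero. *)
Definition regular_on (M M' : vectType K) (X : proj_set M)
    (h : {vspace M} -> {vspace M'}) : Prop :=
  forall L, X L -> exists d e (F : 'I_(\dim {:M'}) -> poly_on M) (g : poly_on M),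
    [/\ forall j, F j \is d.-homog,
        g \is e.-homog,
        ~ vanishes_at g L
      & forall L' u, X L' -> u \in L' -> u != 0 -> poly_eval g u != 0 ->
          poly_map F u != 0 /\ h L' = <[poly_map F u]>%VS].

Definition is_morphism (M M' : vectType K) (X : proj_set M) (Y : proj_set M')
    (h : {vspace M} -> {vspace M'}) : Prop :=
  (forall L, X L -> Y (h L)) /\ regular_on X h.

Definition is_surjective (M M' : vectType K) (X : proj_set M) (Y : proj_set M')
    (h : {vspace M} -> {vspace M'}) : Prop :=
  forall L', Y L' -> exists2 L, X L & h L = L'.

End Projective.

Section Schubert.
Context {K : fieldType} {n : nat}.

Definition SL2_orbit (a : 'I_n -> nat) (z : 'I_n -> K) (M : fusion_product a z) :
    proj_set M :=
  fun L => exists g T,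
    [/\ \det g = 1, SL2_acts g T & L = (T @: <[fp_vec M]>)%VS].
Global Arguments SL2_orbit {a z} M.

Definition schubert (a : 'I_n -> nat) (z : 'I_n -> K) (M : fusion_product a z) :
    proj_set M :=
  zariski_closure (SL2_orbit M).
Global Arguments schubert {a z} M.

Definition equivariant (a b : 'I_n -> nat) (z w : 'I_n -> K)
    (M : fusion_product a z) (M' : fusion_product b w) (X : proj_set M)
    (h : {vspace M} -> {vspace M'}) : Prop :=
  forall g (T : 'End(M)) (T' : 'End(M')) L,
    \det g = 1 -> SL2_acts g T -> SL2_acts g T' -> X L ->
    h (T @: L)%VS = (T' @: h L)%VS.

End Schubert.

Section Types.

Definition is_type (n : nat) (I : seq nat) : Prop :=
  all (leq 1) I /\ sumn I = n.

(* i_1 copies of c_1, then i_2 copies of c_2, and so on. *)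
Definition blocks (I c : seq nat) : seq nat :=
  flatten [seq nseq p.1 p.2 | p <- zip I c].

Definition has_type (A I : seq nat) : Prop :=
  all (leq 1) A /\
  exists c, [/\ size c = size I, sorted (fun x y => x != y) c & A = blocks I c].

Definition type_ge (n : nat) (I J : seq nat) : Prop :=
  forall A B, has_type A I -> has_type B J ->
    forall l, (l.+1 < n)%N ->
      nth 0%N A l = nth 0%N A l.+1 -> nth 0%N B l = nth 0%N B l.+1.

(* The tuple (2^i_1 3^i_2 ... (s+1)^i_s), of length n when I is a type of n. *)
Definition type_dims (n : nat) (I : seq nat) : 'I_n -> nat :=
  fun l => nth 0%N (blocks I (iota 2 (size I))) l.

(* sh_I maps onto sh_J by a G-equivariant morphism, whatever the evaluation
   points and the models of the fusion products that are used to define them. *)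
Definition equivariant_surjection (K : fieldType) (n : nat) (I J : seq nat) :
    Prop :=
  forall z w : 'I_n -> K, injective z -> injective w ->
  forall (M : fusion_product (type_dims I) z)
         (M' : fusion_product (type_dims J) w),
  exists h : {vspace M} -> {vspace M'},
    [/\ is_morphism (schubert M) (schubert M') h,
        is_surjective (schubert M) (schubert M') h
      & equivariant (schubert M) h].

End Types.

(* Main.v *)
(** Write W = K^2 (x) K[t]/t^n, with f in K^2 the lowest weight vector, and let
    U_d be spanned by f t^(n-1-d), ..., f t^(n-1), so that dim U_d = d + 1. If D is
    the set of the d such that position n - 1 - d starts a block of A, the fusion
    product M^A embeds equivariantly in the tensor product over d in D of the
    exterior powers of W, and v_A goes to the tensor product of the top powers of
    the U_d. The map exists because the evaluation module itself embeds in the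
    same space, with t acting on W as on K[t]/prod (t - z_i); passing to the
    associated graded turns this action into the nilpotent one. It is injective
    because its image has dimension at least prod a_i = dim M^A: the coordinates of
    exp (sum x_k e_k) v_A are products of minors of Toeplitz matrices, and enough
    of those are linearly independent.

    In this model sh_A consists of all partial flags (U_d), d in D, of t-stable
    subspaces of W with dim U_d = d + 1. These are defined by homogeneous equations.
    Conversely every such flag refines to a complete one; a basis u adapted to it
    has coordinates u(e,l) = C^l u(e,0) for a strictly lower triangular matrix C,
    and adding to C s times the standard shift moves the flag into the orbit for
    almost all s. When J is coarser than I one has D_J included in D_I, and the map
    sh_I -> sh_J forgets some of the U_d. It is onto since partial flags can be
    refined. *)

From HB Require Import structures.
Require Import Defs.
From mathcomp Require Import all_boot all_order all_algebra perm ring zify.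
From mathcomp Require Import reals complex boolp.
From mathcomp Require Import mpoly.

Set Implicit Arguments.
Unset Strict Implicit.
Unset Printing Implicit Defensive.

Import Order.TTheory GRing.Theory Num.Theory.
Local Open Scope ring_scope.

(** * Operators on tensor powers *)

(** A flag is encoded by a pair [(C, b)]: the matrix of t in a basis of the flag, and the
    coordinates of that basis along t^(n-1). The group commutes with t, so it moves [b] and leaves
    [C] alone; this makes its action computable on all of the closure and not only on the orbit. The
    levels match the entries because the spectral projections of t give n commuting copies of sl2,
    and the i-th one has weight -1 on the top power of U_d when n - 1 - i <= d and weight 0
    otherwise; hence a_i is one more than the number of such d. For (2^i_1 3^i_2 ...) each block
    start therefore contributes exactly one level. Limits are taken algebraically: a polynomial in s
    that vanishes off a finite set vanishes at s = 0. This puts every flag in the closure, and also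
    in the image of the fusion product. The latter is indispensable, since sh_I -> sh_J is defined
    by inverting the embedding of the second fusion product. The equations of the closure express
    decomposability (Cramer's rule) and incidence; they are cleared of denominators so as to be
    homogeneous and to hold where the chosen coordinate is zero. *)

Section TruncatedExponential.
Context {K : numFieldType} {V : lmodType K}.
Implicit Types (D A : V -> V).

Lemma linear_fun0 D : linear D -> D 0 = 0.
Proof. by move=> linD; have := linD (-1) 0 0; rewrite scaler0 addr0 scaleN1r addNr. Qed.

Lemma linear_funD D : linear D -> {morph D : u v / u + v}.
Proof. by move=> linD u v; have := linD 1 u v; rewrite !scale1r. Qed.

Lemma linear_funZ D c : linear D -> {morph D : u / c *: u}.
Proof. by move=> linD u; have := linD c u 0; rewrite (linear_fun0 linD) !addr0. Qed.

Definition trunc_exp (N : nat) D (y : V) : V :=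
  \sum_(j < N) j`!%:R^-1 *: iter j D y.

Lemma trunc_exp_nil N k D y : iter N D y = 0 -> linear D -> (N <= k)%N ->
  trunc_exp k D y = trunc_exp N D y.
Proof.
move=> y0 linD leNk; rewrite /trunc_exp -!(big_mkord xpredT (fun j => j`!%:R^-1 *: iter j D y)).
rewrite (big_cat_nat (leq0n N) leNk) //= [X in _ + X]big_nat_cond [X in _ + X]big1 ?addr0 // => j.
rewrite andbT => /andP[leNj _].
have -> : j = (j - N + N)%N by rewrite subnK.
have D0 := linear_fun0 linD.
rewrite iterD y0; set i := (j - N)%N; suff -> : iter i D 0 = 0 by rewrite scaler0.
by elim: i => //= i ->.
Qed.

Lemma iter_linear j D : linear D -> linear (iter j D).
Proof. by move=> linD; elim: j => [|j IH] c u v //=; rewrite IH linD. Qed.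

(** This is the binomial formula, cut after the linear term because [A] has square zero. *)
Lemma iter_add_sq0 j D A y : linear D -> linear A ->
    (forall u, D (A u) = A (D u)) -> (forall u, A (A u) = 0) ->
  iter j.+1 (D \+ A) y = iter j.+1 D y + j.+1%:R *: iter j D (A y).
Proof.
move=> linD linA comDA sqA.
have itA i u : iter i D (A u) = A (iter i D u) by elim: i => //= i ->.
elim: j => [|j IH]; first by rewrite /= scale1r.
rewrite iterS IH /= (linear_funD linD) (linear_funD linA).
rewrite (linear_funZ _ linD) (linear_funZ _ linA) !itA sqA scaler0 addr0.
rewrite -comDA -!addrA; congr (_ + _); rewrite -[in RHS]natr1 scalerDl scale1r.
by rewrite addrC.
Qed.

(** Here exp (D + A) = exp D (1 + A). The right-hand side has one extra term, with the N-th power of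
    [D] applied to [A y], and nilpotence kills it. *)
Lemma trunc_exp_add_sq0 N D A y : linear D -> linear A ->
    (forall u, D (A u) = A (D u)) -> (forall u, A (A u) = 0) ->
    (forall u, iter N D u = 0) ->
  trunc_exp N.+1 (D \+ A) y = trunc_exp N.+1 D (y + A y).
Proof.
move=> linD linA comDA sqA nilD.
have linE : trunc_exp N.+1 D (y + A y) = trunc_exp N.+1 D y + trunc_exp N.+1 D (A y).
  rewrite /trunc_exp -big_split; apply: eq_bigr => j _ /=.
  by rewrite (linear_funD (iter_linear j linD)) scalerDr.
rewrite linE [trunc_exp _ D (A y)](@trunc_exp_nil N) //.
rewrite /trunc_exp !big_ord_recl -addrA; congr (_ + _).
rewrite -big_split; apply: eq_bigr => j _; rewrite lift0.
rewrite iter_add_sq0 // scalerDr; congr (_ + _); rewrite scalerA factS natrM.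
by rewrite invfM mulrC mulrA divff ?mul1r // pnatr_eq0.
Qed.

(* A sum of commuting operators of square zero exponentiates to the product of
   the 1 + A. *)
Lemma trunc_exp_sum (S : eqType) (A : S -> V -> V) (l : seq S) y :
    uniq l -> (forall s, linear (A s)) -> (forall s u, A s (A s u) = 0) ->
    (forall s s' u, s != s' -> A s (A s' u) = A s' (A s u)) ->
  (forall u, iter (size l).+1 (fun v => \sum_(s <- l) A s v) u = 0) /\
  forall N, (size l < N)%N ->
    trunc_exp N (fun v => \sum_(s <- l) A s v) y = foldl (fun u s => u + A s u) y l.
Proof.
move=> ul linA sqA comA; elim: l ul y => [_ y|s l IH]; last first.
  rewrite cons_uniq => /andP[sl ul] y; move: IH => /(_ ul) IH.
  pose D v := \sum_(s <- l) A s v.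
  have linD : linear D.
    move=> c u v; rewrite /D scaler_sumr -big_split; apply: eq_bigr => i _.
    exact: linA.
  have nilD u : iter (size l).+1 D u = 0 by case: (IH u) => ->.
  have comDA u : D (A s u) = A s (D u).
    rewrite /D; elim: (l) sl {ul IH linD nilD} => [|i l' IHl].
      by rewrite !big_nil (linear_fun0 (linA s)).
    rewrite inE negb_or => /andP[si sl]; rewrite !big_cons (linear_funD (linA s)).
    by rewrite IHl // comA 1?eq_sym.
  have -> : (fun v => \sum_(s <- s :: l) A s v) = D \+ A s.
    by apply/funext => v; rewrite big_cons /= addrC.
  split=> [u|[//|N] ltN].
    rewrite -[LHS]/(iter (size l).+2 (D \+ A s) u).
    by rewrite iter_add_sq0 // nilD iterS nilD (linear_fun0 linD) scaler0 addr0.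
  rewrite trunc_exp_add_sq0 //; first by have [_ ->] := IH (y + A s y); rewrite 1?ltnW.
  move=> u; have -> : N = (N - (size l).+1 + (size l).+1)%N by rewrite subnK.
  by rewrite iterD nilD (linear_fun0 (iter_linear _ linD)).
split=> [u|[//|N] _]; first by rewrite /= big_nil.
rewrite /trunc_exp big_ord_recl /= invr1 scale1r big1 ?addr0 // => j _.
by rewrite big_nil scaler0.
Qed.

End TruncatedExponential.

Section SlotOperators.
Context {K : numFieldType} {S B : finType}.

Definition place := {ffun S -> B}.
Definition tensors := {ffun place -> K^o}.
Implicit Types (r : place) (Y : tensors) (X Z : B -> B -> K) (s : S).

Definition upd r s b : place := [ffun s' => if s' == s then b else r s'].

Lemma upd_same r s b : upd r s b s = b. Proof. by rewrite ffunE eqxx. Qed.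

Lemma upd_other r s b s' : s' != s -> upd r s b s' = r s'.
Proof. by rewrite ffunE => /negPf->. Qed.

Lemma upd_upd r s b b' : upd (upd r s b) s b' = upd r s b'.
Proof. by apply/ffunP=> s'; rewrite !ffunE; case: eqP. Qed.

Lemma updC r s s' b b' : s != s' -> upd (upd r s b) s' b' = upd (upd r s' b') s b.
Proof.
move=> ss; apply/ffunP=> i; rewrite !ffunE.
by case: (eqVneq i s) => // ->; rewrite (negPf ss).
Qed.

Lemma upd_id r s : upd r s (r s) = r.
Proof. by apply/ffunP=> i; rewrite ffunE; case: eqP => // ->. Qed.

Definition slot_op X s Y : tensors := [ffun r : place => \sum_b X (r s) b * Y (upd r s b)].

Definition op_comp X Z b c := \sum_d X b d * Z d c.

Lemma slot_op_linear X s : linear (slot_op X s).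
Proof.
move=> c Y Z; apply/ffunP=> r; rewrite !ffunE scaler_sumr -big_split.
by apply: eq_bigr => b _; rewrite !ffunE mulrDr; congr (_ + _); rewrite mulrCA.
Qed.

HB.instance Definition _ X s :=
  GRing.isLinear.Build K tensors tensors _ (slot_op X s) (slot_op_linear X s).

Lemma slot_op_comp X Z s Y : slot_op X s (slot_op Z s Y) = slot_op (op_comp X Z) s Y.
Proof.
apply/ffunP=> r; rewrite !ffunE.
under eq_bigr => b _ do rewrite ffunE upd_same mulr_sumr.
rewrite exchange_big; apply: eq_bigr => b _; rewrite mulr_suml.
by apply: eq_bigr => c _; rewrite upd_upd mulrA.
Qed.

Lemma slot_opC X Z s s' Y : s != s' ->
  slot_op X s (slot_op Z s' Y) = slot_op Z s' (slot_op X s Y).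
Proof.
move=> ss; apply/ffunP=> r; rewrite !ffunE.
under eq_bigr => b _ do rewrite ffunE upd_other 1?eq_sym // mulr_sumr.
under [RHS]eq_bigr => b _ do rewrite ffunE upd_other // mulr_sumr.
rewrite exchange_big; apply: eq_bigr => b _; apply: eq_bigr => c _.
by rewrite mulrCA updC.
Qed.

Lemma eq_slot_op X Z s Y : X =2 Z -> slot_op X s Y = slot_op Z s Y.
Proof. by move=> XZ; apply/ffunP=> r; rewrite !ffunE; under eq_bigr do rewrite XZ. Qed.

Variable P : pred S.

Definition der X Y : tensors := \sum_(s | P s) slot_op X s Y.

Lemma der_linear X : linear (der X).
Proof.
move=> c Y Z; rewrite /der scaler_sumr -big_split.
by apply: eq_bigr => s _; rewrite slot_op_linear.
Qed.

HB.instance Definition _ X :=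
  GRing.isLinear.Build K tensors tensors _ (der X) (der_linear X).

Lemma eq_der X Z Y : X =2 Z -> der X Y = der Z Y.
Proof. by move=> XZ; apply: eq_bigr => s _; apply: eq_slot_op. Qed.

Lemma derE X Y r : der X Y r = \sum_(s | P s) \sum_b X (r s) b * Y (upd r s b).
Proof. by rewrite sum_ffunE; apply: eq_bigr => s _; rewrite ffunE. Qed.

Lemma der_sum (I : Type) (l : seq I) (Q : pred I) (X : I -> B -> B -> K) Y :
  der (fun b c => \sum_(i <- l | Q i) X i b c) Y = \sum_(i <- l | Q i) der (X i) Y.
Proof.
apply/ffunP=> r; rewrite [RHS]sum_ffunE; under [RHS]eq_bigr do rewrite derE.
rewrite derE [RHS]exchange_big; apply: eq_bigr => s _.
rewrite [RHS]exchange_big; apply: eq_bigr => b _; exact: mulr_suml.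
Qed.

Lemma derZ c X Y : der (fun b d => c * X b d) Y = c *: der X Y.
Proof.
apply/ffunP=> r; rewrite [RHS]ffunE !derE /=.
by rewrite scaler_sumr; apply: eq_bigr => s _; rewrite scaler_sumr;
  apply: eq_bigr => b _; rewrite -mulrA.
Qed.

(** Operators in distinct slots commute, so only the commutators within one slot survive: [der] is a
    Lie algebra action. *)
Lemma der_bracket X Z Y : der X (der Z Y) =
  der Z (der X Y) + der (fun b c => op_comp X Z b c - op_comp Z X b c) Y.
Proof.
have E X' Z' : der X' (der Z' Y) =
    \sum_(s | P s) slot_op (op_comp X' Z') s Y +
    \sum_(s | P s) \sum_(s' | P s' && (s' != s)) slot_op X' s (slot_op Z' s' Y).
  rewrite /der -big_split; apply: eq_bigr => s Ps /=.
  by rewrite -slot_op_comp -linear_sum -linearD [in LHS](bigD1 s).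
rewrite !E -addrA.
have -> : \sum_(s | P s) \sum_(s' | P s' && (s' != s)) slot_op X s (slot_op Z s' Y) =
    \sum_(s | P s) \sum_(s' | P s' && (s' != s)) slot_op Z s (slot_op X s' Y).
  rewrite (exchange_big_dep P) => [|i j _ /andP[]//]; apply: eq_bigr => s Ps.
  apply: eq_big => [s'|s' ss']; first by rewrite Ps eq_sym.
  by case/and3P: ss' => _ _ ss'; rewrite slot_opC // eq_sym.
rewrite [LHS]addrC; set R := \sum_(s | P s) \sum_(s' | _) _.
suff -> : \sum_(s | P s) slot_op (op_comp X Z) s Y = \sum_(s | P s) slot_op (op_comp Z X) s Y
    + der (fun b c => op_comp X Z b c - op_comp Z X b c) Y by rewrite addrCA.
rewrite -big_split; apply: eq_bigr => s _; apply/ffunP=> r.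
rewrite !ffunE -big_split; apply: eq_bigr => b _; by rewrite mulrBl /= addrC subrK.
Qed.

(** The single-slot operators commute and have square zero, so a product of more of them than there
    are slots vanishes, and the exponential applies 1 + X slot by slot. *)
Lemma der_exp X Y N : (forall b c, op_comp X X b c = 0) -> (#|S| < N)%N ->
  (forall Y', iter N (der X) Y' = 0) /\
  trunc_exp N (der X) Y =
    foldl (fun Y s => Y + slot_op X s Y) Y [seq s <- index_enum S | P s].
Proof.
move=> sqX ltN.
have sq s Y' : slot_op X s (slot_op X s Y') = 0.
  by rewrite slot_op_comp; apply/ffunP=> r; rewrite !ffunE big1 // => b _; rewrite sqX mul0r.
have ul : uniq [seq s <- index_enum S | P s] by rewrite filter_uniq ?index_enum_uniq.
have com s s' Y' : s != s' -> slot_op X s (slot_op X s' Y') = slot_op X s' (slot_op X s Y').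
  exact: slot_opC.
have szl : (size [seq s <- index_enum S | P s] < N)%N.
  apply: leq_ltn_trans ltN; rewrite size_filter; apply: leq_trans (count_size _ _) _.
  by rewrite cardT enumT.
have [nil ex] := trunc_exp_sum Y ul (slot_op_linear X) sq com.
have E : der X = fun v => \sum_(s <- [seq s <- index_enum S | P s]) slot_op X s v.
  by apply/funext => v; rewrite big_filter.
rewrite {}E; split; last exact: ex.
move=> Y'; rewrite -(subnK szl) iterD nil; elim: (_ - _)%N => //= k ->.
apply: big1 => s _; exact: (linear_fun0 (slot_op_linear X s)).
Qed.

End SlotOperators.

(** * The derivative of a determinant along its columns *)

Section DetColumn.
Context {R : comNzRingType} {m : nat}.
Implicit Types (M : 'M[R]_m) (k : 'I_m) (x : 'I_m -> R).

Definition set_col M k x : 'M[R]_m := \matrix_(i, j) if j == k then x i else M i j.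

Lemma det_set_col M k x : \det (set_col M k x) = \sum_i x i * cofactor M i k.
Proof.
rewrite (expand_det_col _ k); apply: eq_bigr => i _; rewrite mxE eqxx.
congr (_ * (_ * \det _)); apply/matrixP=> p q.
by rewrite !mxE eq_sym (negPf (neq_lift _ _)).
Qed.

Lemma det_set_col_adj M k x : \det (set_col M k x) = (\adj M *m \col_i x i) k 0.
Proof.
rewrite det_set_col mxE; apply: eq_bigr => i _.
by rewrite !mxE mulrC.
Qed.

(** By Cramer's rule the k-th summand is the k-th diagonal entry of [\adj M *m (G *m M)], whose
    trace is computed cyclically. *)
Lemma sum_det_set_col_mul (G M : 'M[R]_m) :
  \sum_k \det (set_col M k (fun i => (G *m M) i k)) = \tr G * \det M.
Proof.
have -> : \tr G * \det M = \tr (\adj M *m (G *m M)).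
  by rewrite mxtrace_mulC -mulmxA mul_mx_adj mul_mx_scalar linearZ /= mulrC.
rewrite /mxtrace; apply: eq_bigr => k _; rewrite det_set_col_adj !mxE.
by apply: eq_bigr => i _; congr (_ * _); rewrite [LHS]mxE.
Qed.

End DetColumn.

(** * Wedges and flags *)

Section Plucker.
Context {K : numFieldType} {n' : nat}.
Local Notation n := n'.+1.
Local Notation basis := ('I_2 * 'I_n)%type.
Local Notation slot := ('I_n * 'I_n)%type.
Local Notation place := (@place slot basis).
Local Notation T := (@tensors K slot basis).
Implicit Types (D : {set 'I_n}) (u : 'I_n -> basis -> K)
  (v : slot -> 'I_n -> basis -> K) (X : basis -> basis -> K) (r : place).

(* Slot (d, k) is the k-th factor of the exterior power of degree d + 1, seen in
   the tensor power; the tensors below do not depend on the other slots. *)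
Definition relevant D : pred slot := fun s => (s.1 \in D) && (s.2 <= s.1)%N.

Definition level_mx v r (d : 'I_n) : 'M[K]_d.+1 :=
  \matrix_(i, k) v (d, inord k) (inord i) (r (d, inord k)).

(** These are the coordinates of a tensor product of wedges. The vectors may depend on the slot, so
    that an operator can be applied in one slot at a time. *)
Definition plucker D v : T := [ffun r : place => \prod_(d in D) \det (level_mx v r d)].

Definition op_vec X u : 'I_n -> basis -> K := fun i b => \sum_c X b c * u i c.

Lemma inord_level (d : 'I_n) (k : 'I_d.+1) : (inord k : 'I_n) = k :> nat.
Proof. by rewrite inordK // (leq_trans (ltn_ord k)). Qed.

Lemma inord_inord (d k : 'I_n) : (k <= d)%N -> inord (inord k : 'I_d.+1) = k :> 'I_n.
Proof. by move=> kd; apply: val_inj; rewrite /= inord_level inordK. Qed.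

Lemma sum_inord (d : 'I_n) (F : 'I_n -> K) :
  \sum_(i < d.+1) F (inord i) = \sum_(i : 'I_n | (i <= d)%N) F i.
Proof.
rewrite (eq_bigl (fun i : 'I_n => (i < d.+1)%N)) // (big_ord_narrow (ltn_ord d)).
by apply: eq_bigr => i _; congr F; apply: val_inj; rewrite /= inord_level.
Qed.

Lemma eq_plucker D v v' :
  (forall s (i : 'I_n) b, relevant D s -> (i <= s.1)%N -> v s i b = v' s i b) ->
  plucker D v = plucker D v'.
Proof.
move=> vv; apply/ffunP=> r; rewrite !ffunE; apply: eq_bigr => d dD.
congr (\det _); apply/matrixP=> i k; rewrite !mxE vv ?inord_level -1?ltnS //.
by rewrite /relevant dD /= inord_level -ltnS.
Qed.

Lemma level_mx_upd v r (s : slot) c (d : 'I_n) :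
  ~~ ((d == s.1) && (s.2 <= s.1)%N) -> level_mx v (upd r s c) d = level_mx v r d.
Proof.
move=> ds; apply/matrixP=> i k; rewrite !mxE upd_other //; apply: contraNneq ds => <- /=.
by rewrite eqxx /= inord_level -ltnS.
Qed.

(** A relevant slot is one column of one determinant, and determinants are linear in each column. *)
Lemma slot_op_plucker X s v D : relevant D s ->
  slot_op X s (plucker D v) =
  plucker D (fun s' => if s' == s then op_vec X (v s) else v s').
Proof.
move=> /andP[sD sle]; apply/ffunP=> r; rewrite !ffunE.
transitivity (\sum_c X (r s) c * \det (level_mx v (upd r s c) s.1) *
    \prod_(d in D | d != s.1) \det (level_mx v r d)).
  apply: eq_bigr => c _; rewrite ffunE (bigD1 s.1) //= mulrA; congr (_ * _).
  by apply: eq_bigr => d /andP[_ ds]; rewrite level_mx_upd // (negPf ds).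
rewrite -mulr_suml [in RHS](bigD1 s.1) //=.
congr (_ * _); last first.
  apply: eq_bigr => d /andP[_ ds]; congr (\det _); apply/matrixP=> i k; rewrite !mxE.
  by rewrite -pair_eqE /= (negPf ds).
pose k0 : 'I_s.1.+1 := inord s.2.
have k0E : inord k0 = s.2 :> 'I_n.
  by apply: val_inj; rewrite /= inord_level inordK.
have colE x : forall c, level_mx x (upd r s c) s.1 =
    set_col (level_mx x r s.1) k0 (fun i => x s (inord i) c).
  move=> c; apply/matrixP=> i k; rewrite !mxE.
  case: (eqVneq k k0) => [->|kk0]; first by rewrite k0E -surjective_pairing upd_same.
  rewrite upd_other //; apply: contraNneq kk0 => /(congr1 snd) /= ks.
  by apply/eqP/val_inj; rewrite -[val k]inord_level ks /= inordK.
have -> : level_mx (fun s' => if s' == s then op_vec X (v s) else v s') r s.1 =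
    set_col (level_mx v r s.1) k0 (fun i => op_vec X (v s) (inord i) (r s)).
  rewrite -[r in level_mx _ r](upd_id r s) colE eqxx.
  apply/matrixP=> i k; rewrite !mxE; case: ifP => // /negP kk0; case: ifP => //.
  move=> /eqP /(congr1 snd) /= ks; case: kk0.
  by apply/eqP/val_inj; rewrite -[val k]inord_level ks /= inordK.
rewrite det_set_col; under eq_bigr => c _ do rewrite colE det_set_col mulr_sumr.
rewrite exchange_big; apply: eq_bigr => i _; rewrite mulr_suml.
by apply: eq_bigr => c _; rewrite mulrA.
Qed.

(** Since [G] is lower triangular, [X] preserves the span of the first d + 1 vectors and acts on its
    top exterior power by the trace. *)
Lemma der_plucker X D u (G : 'M[K]_n) :
    (forall i b, op_vec X u i b = \sum_l G i l * u l b) ->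
    (forall i l : 'I_n, (i < l)%N -> G i l = 0) ->
  der (relevant D) X (plucker D (fun _ => u)) =
  (\sum_(d in D) \sum_(i : 'I_n | (i <= d)%N) G i i) *: plucker D (fun _ => u).
Proof.
move=> Xu Gtrig; rewrite /der.
under eq_bigr => s sD do rewrite slot_op_plucker //.
have -> : \sum_(s | relevant D s)
      plucker D (fun s' => if s' == s then op_vec X u else u) =
    \sum_(d in D) \sum_(k : 'I_n | (k <= d)%N)
      plucker D (fun s' => if s' == (d, k) then op_vec X u else u).
  by rewrite pair_big_dep /=; apply: eq_big => [[d k]|[d k] _].
rewrite scaler_suml; apply: eq_bigr => d dD; apply/ffunP=> r.
rewrite sum_ffunE ffunE.
pose Gd : 'M[K]_d.+1 := \matrix_(i, l) G (inord i) (inord l).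
have trG : \tr Gd = \sum_(i : 'I_n | (i <= d)%N) G i i.
  by rewrite -[RHS](sum_inord d); apply: eq_bigr => i _; rewrite mxE.
under eq_bigr => k kd do rewrite ffunE (bigD1 d) //=.
rewrite (eq_bigr (fun k : 'I_n => \det (set_col (level_mx (fun=> u) r d) (inord k)
    (fun i => (Gd *m level_mx (fun=> u) r d) i (inord k))) *
    \prod_(i in D | i != d) \det (level_mx (fun=> u) r i))); last first.
  move=> k kd; congr (_ * _).
    congr (\det _); apply/matrixP=> i l; rewrite !mxE -pair_eqE /= eqxx /=.
    have -> : (inord l == k :> 'I_n) = (l == inord k).
      by rewrite -!val_eqE /= inord_level inordK.
    case: eqP => // ->; rewrite inord_inord //.
    rewrite Xu; under [RHS]eq_bigr do rewrite !mxE.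
    rewrite (sum_inord d (fun l => G (inord i) l * u l (r (d, inord (inord k : 'I_d.+1))))).
    rewrite inord_inord //.
    rewrite [RHS]big_mkcond; apply: eq_bigr => j _; case: leqP => // ltj.
    by rewrite Gtrig ?mul0r // inord_level (leq_ltn_trans _ ltj) // -ltnS.
  apply: eq_bigr => i /andP[_ id]; congr (\det _); apply/matrixP=> p q; rewrite !mxE.
  by rewrite -pair_eqE /= (negPf id).
rewrite -mulr_suml -trG /GRing.scale /= [in RHS]ffunE [in RHS](bigD1 d) //= [RHS]mulrA.
congr (_ * _).
rewrite -sum_det_set_col_mul.
rewrite -(sum_inord d (fun k => \det (set_col (level_mx (fun=> u) r d) (inord k)
    (fun i => (Gd *m level_mx (fun=> u) r d) i (inord k))))).
by apply: eq_bigr => k _; have -> : inord (inord k : 'I_n) = k :> 'I_d.+1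
  by apply: val_inj; rewrite /= inord_level inordK.
Qed.

Lemma add_slot_op_plucker X s v D : relevant D s ->
  plucker D v + slot_op X s (plucker D v) =
  plucker D (fun s' => if s' == s then fun i b => v s i b + op_vec X (v s) i b else v s').
Proof.
move=> sD; pose X1 b c := (b == c)%:R + X b c.
have -> : plucker D v + slot_op X s (plucker D v) = slot_op X1 s (plucker D v).
  apply/ffunP=> r; rewrite [LHS]ffunE [RHS]ffunE [in X in _ + X]ffunE.
  under [RHS]eq_bigr do rewrite mulrDl; rewrite big_split /=; congr (_ + _).
  rewrite (bigD1 (r s)) //= eqxx mul1r upd_id big1 ?addr0 // => b.
  by rewrite eq_sym => /negPf->; rewrite mul0r.
rewrite slot_op_plucker //; apply: eq_plucker => s' i b _ _; case: eqP => // _.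
rewrite /op_vec; under eq_bigr do rewrite mulrDl; rewrite big_split /=; congr (_ + _).
rewrite (bigD1 b) //= eqxx mul1r big1 ?addr0 // => c.
by rewrite eq_sym => /negPf->; rewrite mul0r.
Qed.

Lemma foldl_slot_op_plucker X (l : seq slot) v D : uniq l -> all (relevant D) l ->
  foldl (fun Y s => Y + slot_op X s Y) (plucker D v) l =
  plucker D (fun s => if s \in l then fun i b => v s i b + op_vec X (v s) i b else v s).
Proof.
elim: l v => [|s l IH] v /=; first by move=> _ _; apply: eq_plucker.
case/andP=> sl ul /andP[sD lD]; rewrite add_slot_op_plucker // IH //.
apply: eq_plucker => s' i b _ _; rewrite inE.
by case: (eqVneq s' s) => [->|//]; rewrite (negPf sl).
Qed.

Lemma plucker_exp X D u N : (forall b c, op_comp X X b c = 0) -> (#|{: slot}| < N)%N ->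
  trunc_exp N (der (relevant D) X) (plucker D (fun=> u)) =
  plucker D (fun=> fun i b => u i b + op_vec X u i b).
Proof.
move=> sqX ltN; have [_ ->] := der_exp (relevant D) (plucker D (fun=> u)) sqX ltN.
rewrite foldl_slot_op_plucker ?filter_uniq ?index_enum_uniq ?filter_all //.
by apply: eq_plucker => s i b sD _; rewrite mem_filter sD mem_index_enum.
Qed.

End Plucker.

(** * Flags stable under t, and the action of the group on them *)

Section Flags.
Context {K : numFieldType} {n' : nat}.
Local Notation n := n'.+1.
Local Notation basis := ('I_2 * 'I_n)%type.
Local Notation A := (@trunc_poly K n).
Implicit Types (C : 'M[K]_n) (a : 'I_2 -> 'cV[K]_n) (g h X : 'M[A]_2).

(* Multiplication by t on K[t]/t^n, in the basis t^(n-1), ..., t, 1. *)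
Definition shift_mx : 'M[K]_n := \matrix_(i, j) (j == i.+1 :> nat)%:R.

Definition strict_lower C := forall i j : 'I_n, (i <= j)%N -> C i j = 0.

(* If C is strictly lower triangular then t u_i = sum_(j < i) C_ij u_j, and all
   bases u with this property have this form. *)
Definition flag C a : 'I_n -> basis -> K := fun i b => (C ^+ b.2 *m a b.1) i 0.

Lemma shift_mxX k : shift_mx ^+ k = \matrix_(i, j) (j == i + k :> nat)%N%:R.
Proof.
elim: k => [|k IH].
  by apply/matrixP=> i j; rewrite expr0 !mxE addn0 eq_sym.
apply/matrixP=> i j; rewrite exprSr IH !mxE.
under eq_bigr do rewrite !mxE.
have [ltn|gen] := ltnP (i + k)%N n; last first.
  rewrite big1 => [|l _]; first by case: eqP => // jE; have := ltn_ord j; lia.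
  by case: eqP => [lE|_]; rewrite ?mul0r //; have := ltn_ord l; lia.
rewrite (bigD1 (Ordinal ltn)) //= eqxx mul1r addnS big1 ?addr0 // => l.
by rewrite -val_eqE /= => /negPf->; rewrite mul0r.
Qed.

Lemma strict_lowerX C k (i j : 'I_n) : strict_lower C -> (i < j + k)%N -> (C ^+ k) i j = 0.
Proof.
move=> Clow; elim: k i j => [|k IH] i j lt.
  by rewrite expr0 mxE; case: eqP => // ij; move: lt; rewrite ij; lia.
rewrite exprS mxE big1 // => l _; have [il|li] := leqP i l.
  by rewrite Clow // mul0r.
by rewrite IH ?mulr0 //; move: lt li; rewrite addnS; lia.
Qed.

Lemma strict_lower_nil C k : strict_lower C -> (n <= k)%N -> C ^+ k = 0.
Proof.
move=> Clow nk; apply/matrixP=> i j; rewrite strict_lowerX ?mxE //.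
by rewrite (leq_trans (ltn_ord i)) // (leq_trans nk) // leq_addl.
Qed.

Lemma shift_mx_nil : shift_mx ^+ n = 0.
Proof.
apply/matrixP=> i j; rewrite shift_mxX !mxE; case: eqP => // jE.
by have := ltn_ord j; lia.
Qed.

Lemma tr_exp C k : (C ^+ k)^T = C^T ^+ k.
Proof.
elim: k => [|k IH]; first by rewrite !expr0 trmx1.
by rewrite exprS exprSr -IH; exact: trmx_mul.
Qed.

Lemma strict_lower_shift : strict_lower shift_mx^T.
Proof. by move=> i j ij; rewrite !mxE; case: eqP => // E; move: ij; rewrite E; lia. Qed.

Section Nilpotent.
Variable C : 'M[K]_n.
Hypothesis Cn : C ^+ n = 0.

Lemma horner_mx_trunc (p : {poly K}) : horner_mx C p = \sum_(k < n) p`_k *: C ^+ k.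
Proof.
rewrite -{1}(poly_take_drop n p) rmorphD rmorphM /= rmorphXn /= horner_mx_X Cn mulr0.
rewrite addr0 -[take_poly n p]/(\poly_(i < n) p`_i) poly_def rmorph_sum.
by apply: eq_bigr => k _; rewrite /= linearZ /= rmorphXn /= horner_mx_X.
Qed.

Lemma horner_mx_truncM (p q : A) : horner_mx C (p * q : A) = horner_mx C p *m horner_mx C q.
Proof.
have E (u : {poly K}) : horner_mx C (Pdiv.CommonRing.rmodp u (mk_monic 'X^n)) = horner_mx C u.
  rewrite [in RHS](Pdiv.RingMonic.rdivp_eq (monic_mk_monic 'X^n) u).
  have mk0 : horner_mx C (mk_monic 'X^n) = 0.
    by rewrite mk_monic_Xn rmorphXn /= horner_mx_X Cn.
  by rewrite rmorphD rmorphM /= mk0 mulr0 add0r.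
transitivity (horner_mx C ((p : {poly K}) * q)); first exact: E.
by rewrite rmorphM.
Qed.

(** A group element is K[t]-linear, so in terms of a flag it acts on the coordinates [a] with t
    replaced by [C]; this respects t^n = 0 as soon as [C ^+ n = 0]. *)
Definition group_act (g : 'M[A]_2) a : 'I_2 -> 'cV[K]_n :=
  fun e => \sum_e' horner_mx C (g e e') *m a e'.

Lemma group_actM g h a : group_act (g *m h) a = group_act g (group_act h a).
Proof.
apply/funext => e; rewrite /group_act.
under [RHS]eq_bigr do rewrite mulmx_sumr; rewrite exchange_big.
apply: eq_bigr => e' _; under [RHS]eq_bigr do rewrite mulmxA.
rewrite -mulmx_suml; congr (_ *m _).
rewrite !mxE (raddf_sum (val : A -> {poly K})) /= linear_sum; apply: eq_bigr => k _.
exact: horner_mx_truncM.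
Qed.

Lemma group_act1D X a : group_act (1%:M + X) a = (fun e => a e + group_act X a e).
Proof.
apply/funext => e; rewrite /group_act.
transitivity (\sum_e' ((1%:M : 'M[K]_2) e e' *: a e' + horner_mx C (X e e') *m a e')).
  apply: eq_bigr => e' _; rewrite !mxE (raddfD (val : A -> {poly K})) /= rmorphD mulmxDl.
  congr (_ + _); case: (e == e'); first by rewrite scale1r /= rmorph1 mul1mx.
  by rewrite scale0r /= rmorph0 mul0mx.
rewrite big_split; congr (_ + _); rewrite (bigD1 e) //= mxE eqxx scale1r big1 ?addr0 // => e'.
by rewrite eq_sym mxE => /negPf->; rewrite scale0r.
Qed.

End Nilpotent.

Definition current_op (X : 'M[A]_2) (b c : basis) : K :=
  horner_mx shift_mx (X b.1 c.1) b.2 c.2.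

(** Multiplication by t^k reads the coordinate l + k in place of l, which amounts to one more factor
    [C ^+ k]. For l + k >= n there is nothing to read, in agreement with [C ^+ n = 0]. *)
Lemma op_vec_current_op C a X : C ^+ n = 0 ->
  op_vec (current_op X) (flag C a) = flag C (group_act C X a).
Proof.
move=> Cn; apply/funext => i; apply/funext => -[e l].
rewrite /op_vec /flag /group_act /= mulmx_sumr summxE.
rewrite -(pair_bigA _ (fun e' l' => current_op X (e, l) (e', l') * (C ^+ l' *m a e') i 0)) /=.
apply: eq_bigr => e' _; rewrite mulmxA.
transitivity ((\sum_l' horner_mx shift_mx (X e e') l l' *: C ^+ (l' : 'I_n) *m a e') i 0).
  by rewrite summxE; apply: eq_bigr => l' _; rewrite -scalemxAl [RHS]mxE.
rewrite -mulmx_suml; congr ((_ *m _) _ _).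
rewrite horner_mx_trunc ?shift_mx_nil // horner_mx_trunc // mulmx_sumr.
under eq_bigr => l' _ do rewrite summxE scaler_suml.
rewrite exchange_big; apply: eq_bigr => k _ /=.
under eq_bigr => l' _ do rewrite mxE shift_mxX mxE -scalerA.
rewrite -scaler_sumr -scalemxAr -[_ *m _]/(C ^+ l * C ^+ k) -exprD; congr (_ *: _).
have [ltn|gen] := ltnP (l + k)%N n; last first.
  rewrite big1 => [|l' _]; first by rewrite -(subnK gen) exprD Cn mulr0.
  by case: eqP => [lE|_]; rewrite ?scale0r //; have := ltn_ord l'; lia.
rewrite (bigD1 (Ordinal ltn)) //= eqxx scale1r big1 ?addr0 // => l'.
by rewrite -val_eqE /= => /negPf->; rewrite scale0r.
Qed.

Lemma current_op_comp X Z b c :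
  op_comp (current_op X) (current_op Z) b c = current_op (X *m Z) b c.
Proof.
rewrite /op_comp /current_op mxE (raddf_sum (val : A -> {poly K})) /= linear_sum summxE.
rewrite -(pair_bigA _ (fun e l => horner_mx shift_mx (X b.1 e) b.2 l *
  horner_mx shift_mx (Z e c.1) l c.2)) /=.
by apply: eq_bigr => e _; rewrite horner_mx_truncM ?shift_mx_nil // mxE.
Qed.

Lemma current_op0 b c : current_op 0 b c = 0.
Proof. by rewrite /current_op mxE /= linear0 mxE. Qed.

Lemma flagD C a a' i b : flag C (fun e => a e + a' e) i b = flag C a i b + flag C a' i b.
Proof. by rewrite /flag mulmxDr mxE. Qed.

Definition omega (D : {set 'I_n}) C a := plucker D (fun=> flag C a).

Lemma omega_exp D C a X N : C ^+ n = 0 -> X *m X = 0 -> (#|{: 'I_n * 'I_n}| < N)%N ->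
  trunc_exp N (der (relevant D) (current_op X)) (omega D C a) =
  omega D C (group_act C (1%:M + X) a).
Proof.
move=> Cn sqX ltN; rewrite /omega plucker_exp // => [|b c]; last first.
  by rewrite current_op_comp sqX current_op0.
apply: eq_plucker => s i b _ _.
by rewrite op_vec_current_op // group_act1D flagD.
Qed.

End Flags.

(** * Embedding of the evaluation module *)

Section LowestWeight.
Context {K : numFieldType} {V : lmodType K} (E F H : V -> V) (a : nat) (w : V).
Hypotheses (linE : linear E) (linF : linear F) (linH : linear H).
Hypothesis EF : forall y, E (F y) = F (E y) + H y.
Hypothesis HE : forall y, H (E y) = E (H y) + 2 *: E y.
Hypotheses (Fw : F w = 0) (Hw : H w = (1 - a%:R) *: w).
Hypothesis nilE : exists N, iter N E w = 0.
Hypothesis a_gt0 : (0 < a)%N.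

Lemma weight_iter l : H (iter l E w) = ((l.*2.+1)%:R - a%:R) *: iter l E w.
Proof.
elim: l => [|l IH]; first by rewrite /= Hw.
rewrite iterS HE IH (linear_funZ _ linE) -scalerDl; congr (_ *: _).
by rewrite doubleS -!natr1 -muln2 natrM; ring.
Qed.

Lemma lower_iter l : F (iter l.+1 E w) = (l.+1%:R * (a%:R - l.+1%:R)) *: iter l E w.
Proof.
elim: l => [|l IH].
  have := EF w; rewrite Fw (linear_fun0 linE) Hw => /eqP.
  by rewrite eq_sym addr_eq0 => /eqP -> /=; rewrite -scaleNr; congr (_ *: _); ring.
have := EF (iter l.+1 E w); rewrite IH (linear_funZ _ linE) weight_iter -!iterS.
move/eqP; rewrite -subr_eq => /eqP <-; rewrite -scalerBl; congr (_ *: _).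
by rewrite doubleS -!natr1 -muln2 natrM; ring.
Qed.

(** Let m be the first exponent with E^m w = 0. If m > 0, applying [F] gives m (a - m) E^(m-1) w =
    0, and minimality forces m = a. If m = 0 then w = 0. *)
Lemma iter_eq0 : iter a E w = 0.
Proof.
have [N w0] := nilE; pose P N := iter N E w == 0.
have exP : exists N, P N by exists N; apply/eqP.
case: (ex_minnP exP) => m /eqP wm mmin.
have [<-//|] := eqVneq m a.
case: m wm mmin => [w00|m wm mmin ma].
  by move=> _ _; rewrite /= in w00; rewrite w00; elim: (a) => //= k ->; rewrite (linear_fun0 linE).
have := lower_iter m; rewrite wm (linear_fun0 linF) => /esym/eqP.
rewrite scaler_eq0 mulf_eq0 pnatr_eq0 /= subr_eq0 eqr_nat eq_sym (negPf ma) /=.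
by move=> /mmin; rewrite ltnn.
Qed.

Lemma sl2_rep_iter (x : 'M[K]_2) (m : 'I_a) :
  x 0 0 *: H (iter m E w) + x 0 1 *: E (iter m E w) + x 1 0 *: F (iter m E w) =
  \sum_(k < a) sl2_rep a x k m *: iter k E w.
Proof.
under eq_bigr do rewrite !mxE !scalerDl.
rewrite !big_split; congr (_ + _ + _).
- rewrite weight_iter (bigD1 m) //= eqxx mul1r scalerA big1 ?addr0 // => k.
  by rewrite -val_eqE /= => /negPf->; rewrite mul0r mulr0 scale0r.
- have [lt|ge] := ltnP m.+1 a.
    rewrite (bigD1 (Ordinal lt)) //= eqxx mulr1 big1 ?addr0 // => k.
    by rewrite -val_eqE /= => /negPf->; rewrite mulr0 scale0r.
  have -> : E (iter m E w) = 0.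
    rewrite -iterS; have -> : m.+1 = a by apply/eqP; rewrite eqn_leq ge ltn_ord.
    exact: iter_eq0.
  rewrite scaler0 big1 // => k _; case: eqP => [kE|]; last by rewrite mulr0 scale0r.
  by have := ltn_ord k; rewrite kE ltnNge ge.
- case: m => -[|m] lt /=.
    by rewrite Fw scaler0 big1 // => k _; rewrite mul0r mulr0 scale0r.
  rewrite lower_iter (bigD1 (Ordinal (ltnW lt))) //= eqxx mul1r big1 ?addr0.
    by rewrite scalerA natrM natrB // ltnW.
  move=> k; rewrite -val_eqE /= => ne; rewrite eqSS (negPf ne) mul0r mulr0.
  by rewrite scale0r.
Qed.

End LowestWeight.

(** * Spectral projections of multiplication by t at distinct points *)

Section SpectralProjections.
Context {K : numFieldType} {n' : nat}.
Local Notation n := n'.+1.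
Variable z : 'I_n -> K.
Hypothesis z_inj : injective z.

Definition upper (A : 'M[K]_n) := forall p q : 'I_n, (q < p)%N -> A p q = 0.

Lemma upper_horner (A : 'M[K]_n) (p : {poly K}) : upper A ->
  upper (horner_mx A p) /\ forall l, horner_mx A p l l = p.[A l l].
Proof.
move=> Au; elim/poly_ind: p => [|p c [IHu IHd]].
  by split=> [i j _|l]; rewrite rmorph0 !mxE ?horner0.
rewrite rmorphD rmorphM /= horner_mx_X horner_mx_C; split=> [i j ij|l].
  rewrite !mxE -val_eqE /= gtn_eqF // addr0 big1 // => k _.
  have [ki|ik] := ltnP k i; first by rewrite IHu // mul0r.
  by rewrite Au ?mulr0 // (leq_trans ij).
rewrite !mxE eqxx mulr1n hornerMXaddC -IHd; congr (_ + _).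
rewrite (bigD1 l) //= big1 ?addr0 // => k; rewrite -val_eqE /= neq_ltn => /orP[kl|lk].
  by rewrite IHu // mul0r.
by rewrite Au // mulr0.
Qed.

(* Multiplication by t on K[t]/prod (t - z_i), in the basis of the
   prod_(i < n-1-j) (t - z_i); it degenerates to shift_mx as z tends to 0. *)
Definition eval_mx : 'M[K]_n := shift_mx + diag_mx (\row_j z (rev_ord j)).

Lemma eval_mx_upper : upper eval_mx.
Proof.
move=> p q qp; rewrite !mxE -[p == q]val_eqE /= [(p == q :> nat)]gtn_eqF // mulr0n addr0.
by case: eqP => // E; move: qp; rewrite E; lia.
Qed.

Lemma eval_mx_diag l : eval_mx l l = z (rev_ord l).
Proof. by rewrite !mxE eqxx mulr1n; case: eqP => [|_]; [lia|rewrite add0r]. Qed.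

(** The z_i are distinct and are the roots of the characteristic polynomial, which thus divides [p];
    Cayley-Hamilton concludes. *)
Lemma horner_eval_mx0 (p : {poly K}) : (forall i, p.[z i] = 0) -> horner_mx eval_mx p = 0.
Proof.
move=> pz; pose rs := [seq z (rev_ord i) | i <- enum 'I_n].
have charE : char_poly eval_mx = \prod_(x <- rs) ('X - x%:P).
  rewrite /char_poly -det_tr det_trig => [|].
    rewrite big_map big_enum; apply: eq_bigr => i _; rewrite mxE -eval_mx_diag.
    by rewrite !mxE eqxx.
  apply/is_trig_mxP => i j ij; have := eval_mx_upper ij; rewrite !mxE => ->.
  by rewrite subr0 -[j == i]val_eqE /= gtn_eqF.
have /dvdpP[q ->] : char_poly eval_mx %| p.
  rewrite charE uniq_roots_dvdp //.
    by apply/allP => _ /mapP[i _ ->]; rewrite rootE pz.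
  rewrite uniq_rootsE map_inj_uniq ?enum_uniq // => i j /z_inj; exact: rev_ord_inj.
by rewrite rmorphM /= Cayley_Hamilton mulr0.
Qed.

Definition lagrange i : {poly K} :=
  \prod_(l | l != i) ((z i - z l)^-1 *: ('X - (z l)%:P)).

Lemma lagrangeE i j : (lagrange i).[z j] = (i == j)%:R.
Proof.
rewrite /lagrange horner_prod; case: eqP => [<-|/eqP ij].
  apply: big1 => l li; rewrite hornerZ hornerXsubC mulVf // subr_eq0.
  by rewrite (inj_eq z_inj) eq_sym.
rewrite (bigD1 j) //=; last by rewrite eq_sym.
by rewrite hornerZ hornerXsubC subrr mulr0 mul0r.
Qed.

Definition eval_proj i : 'M[K]_n := horner_mx eval_mx (lagrange i).

Lemma eval_projM i j : eval_proj i *m eval_proj j = if i == j then eval_proj i else 0.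
Proof.
rewrite -[LHS]/(eval_proj i * eval_proj j) /eval_proj -rmorphM.
apply/eqP; rewrite -subr_eq0; apply/eqP; case: eqP => [<-|/eqP ij].
  rewrite -rmorphB; apply: horner_eval_mx0 => l.
  by rewrite hornerD hornerN hornerM lagrangeE; case: eqP; rewrite ?mulr1 ?mulr0 subrr.
rewrite subr0; apply: horner_eval_mx0 => l; rewrite hornerM !lagrangeE.
case: (eqVneq i l) => [E|_]; last by rewrite mul0r.
by rewrite -E eq_sym (negPf ij) mulr0.
Qed.

Lemma eval_mxX k : eval_mx ^+ k = \sum_i z i ^+ k *: eval_proj i.
Proof.
apply/eqP; rewrite -subr_eq0; apply/eqP.
have -> : eval_mx ^+ k - \sum_i z i ^+ k *: eval_proj i =
    horner_mx eval_mx ('X^k - \sum_i z i ^+ k *: lagrange i).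
  rewrite [RHS]rmorphB rmorphXn /= horner_mx_X; congr (_ - _); rewrite linear_sum.
  by apply: eq_bigr => i _; rewrite linearZ.
apply: horner_eval_mx0 => l; rewrite hornerD hornerN hornerXn horner_sum.
rewrite (bigD1 l) //= hornerZ lagrangeE eqxx mulr1 big1 ?addr0 ?subrr // => i il.
by rewrite hornerZ lagrangeE (negPf il) mulr0.
Qed.

Lemma eval_proj_upper i : upper (eval_proj i).
Proof. by have [] := upper_horner (lagrange i) eval_mx_upper. Qed.

Lemma eval_proj_diag i l : eval_proj i l l = (rev_ord i == l)%:R.
Proof.
have [_ ->] := upper_horner (lagrange i) eval_mx_upper.
by rewrite eval_mx_diag lagrangeE; congr (_ : bool)%:R; rewrite -(inj_eq rev_ord_inj) rev_ordK.
Qed.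

End SpectralProjections.

Section Kronecker.
Context {K : numFieldType} {n' : nat}.
Local Notation n := n'.+1.
Local Notation basis := ('I_2 * 'I_n)%type.
Local Notation slot := ('I_n * 'I_n)%type.

Definition kron (x : 'M[K]_2) (P : 'M[K]_n) (b c : basis) := x b.1 c.1 * P b.2 c.2.

Lemma kron_comp x y P Q b c : op_comp (kron x P) (kron y Q) b c = kron (x *m y) (P *m Q) b c.
Proof.
rewrite /op_comp /kron !mxE mulr_suml.
rewrite -(pair_bigA _ (fun e l => x b.1 e * P b.2 l * (y e c.1 * Q l c.2))) /=.
apply: eq_bigr => e _; rewrite mulr_sumr; apply: eq_bigr => l _; ring.
Qed.

(* The i-th vector of the flag is f t^(n-1-i), with f the lowest weight vector. *)
Definition base_vec : 'I_2 -> 'cV[K]_n := fun e => if e == 1 then delta_mx 0 0 else 0.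

Lemma base_flag i (b : basis) :
  flag shift_mx^T base_vec i b = ((b.1 == 1) && (i == b.2))%:R.
Proof.
rewrite /flag /base_vec; case: (b.1 == 1); last by rewrite mulmx0 mxE.
rewrite mxE (bigD1 0) //= big1 ?addr0 => [|j]; last first.
  by move=> /negPf j0; rewrite [delta_mx _ _ _ _]mxE j0 mulr0.
by rewrite [delta_mx _ _ _ _]mxE !eqxx mulr1 -tr_exp mxE shift_mxX mxE.
Qed.

Definition base_point (D : {set 'I_n}) : {ffun {ffun slot -> basis} -> K^o} :=
  omega D shift_mx^T base_vec.

Lemma op_vec_base x P i b :
  op_vec (kron x P) (flag shift_mx^T base_vec) i b = x b.1 1 * P b.2 i.
Proof.
rewrite /op_vec (bigD1 (1, i)) //= base_flag /= !eqxx mulr1 big1 ?addr0 // => -[e l] ne.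
rewrite base_flag; case: (e =P 1) ne => [->|_ _]; last by rewrite mulr0.
by rewrite xpair_eqE eqxx /= eq_sym => /negPf->; rewrite mulr0.
Qed.

(** A nonzero minor has a nonzero permutation term, so in level d the second indices are 0, ..., d
    in some order. Hence the base point is homogeneous for the grading by powers of t. *)
Lemma base_point_supp D r : base_point D r != 0 ->
  \sum_(s | relevant D s) ((r s).2 : nat) = \sum_(s : slot | relevant D s) (s.2 : nat).
Proof.
rewrite ffunE => /prodf_neq0 nz.
have E (F : slot -> nat) : \sum_(s | relevant D s) F s =
    \sum_(d in D) \sum_(k : 'I_n | (k <= d)%N) F (d, k).
  by rewrite pair_big_dep /=; apply: eq_big => [[d k]|[d k] _].
rewrite !E; apply: eq_bigr => d dD.
have sumE (F : 'I_n -> nat) : \sum_(k : 'I_n | (k <= d)%N) F k = \sum_(k < d.+1) F (inord k).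
  rewrite (eq_bigl (fun i : 'I_n => (i < d.+1)%N)) // (big_ord_narrow (ltn_ord d)).
  by apply: eq_bigr => i _; congr F; apply: val_inj; rewrite /= inord_level.
rewrite !sumE.
have [s _ snz] : exists2 s : 'S_d.+1, true &
    \prod_i level_mx (fun=> flag shift_mx^T base_vec) r d i (s i) != 0.
  apply/exists_inP; apply: contraNT (nz d dD) => /exists_inPn H.
  rewrite /determinant big1 // => s _; have := H s isT; rewrite negbK => /eqP ->.
  by rewrite mulr0.
rewrite [LHS](reindex_inj (@perm_inj _ s)) /=; apply: eq_bigr => i _.
move/prodf_neq0: snz => /(_ i isT); rewrite !mxE base_flag.
by case: andP => [[_ /eqP <-]|]; rewrite ?eqxx.
Qed.

End Kronecker.

(** * Commuting copies of sl2 and their lowest weight vector *)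

Section EvaluationToTensors.
Context {K : numFieldType} {n' : nat}.
Local Notation n := n'.+1.
Local Notation basis := ('I_2 * 'I_n)%type.
Local Notation slot := ('I_n * 'I_n)%type.
Local Notation T := (@tensors K slot basis).
Variables (a : 'I_n -> nat) (z : 'I_n -> K) (D : {set 'I_n}).
Hypothesis z_inj : injective z.
Hypothesis aD : forall i, a i = (\sum_(d in D) ((rev_ord i : 'I_n) <= d)%N).+1.

Local Notation v0 := (base_point D).

(** The projections are orthogonal idempotents, so these are commuting copies of sl2, one for each
    factor of the evaluation module. *)
Definition sl2_at i x : T -> T := der (relevant D) (kron x (eval_proj z i)).

Lemma sl2_at_linear i x : linear (sl2_at i x).
Proof. exact: der_linear. Qed.

Lemma sl2_at0 i Y : sl2_at i 0 Y = 0.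
Proof.
apply/ffunP=> r; rewrite derE ffunE big1 // => s _; rewrite big1 // => b _.
by rewrite /kron mxE !mul0r.
Qed.

Lemma sl2_atC i j x y Y : i != j -> sl2_at i x (sl2_at j y Y) = sl2_at j y (sl2_at i x Y).
Proof.
move=> ij; rewrite /sl2_at der_bracket; set W := (W in _ + W).
suff -> : W = 0 by rewrite addr0.
apply/ffunP=> r; rewrite derE ffunE big1 // => s _; rewrite big1 // => b _.
have ji : j != i by rewrite eq_sym.
rewrite !kron_comp !eval_projM // (negPf ij) (negPf ji) /kron.
by rewrite [(0 : 'M_n) _ _]mxE !mulr0 subrr mul0r.
Qed.

Lemma sl2_atB i x y Y :
  sl2_at i x (sl2_at i y Y) = sl2_at i y (sl2_at i x Y) + sl2_at i (x *m y - y *m x) Y.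
Proof.
rewrite /sl2_at der_bracket; congr (_ + _); apply: eq_der => b c.
by rewrite !kron_comp !eval_projM // eqxx /kron !mxE mulrBl.
Qed.

Lemma sl2_atD i c x y Y : sl2_at i (c *: x + y) Y = c *: sl2_at i x Y + sl2_at i y Y.
Proof.
apply/ffunP=> r; rewrite [RHS]ffunE [in X in _ = X + _]ffunE /sl2_at !derE.
rewrite scaler_sumr -big_split; apply: eq_bigr => s _; rewrite scaler_sumr -big_split.
apply: eq_bigr => b _ /=; rewrite /kron !mxE /GRing.scale /=; ring.
Qed.

Definition e_mx : 'M[K]_2 := delta_mx 0 1.
Definition f_mx : 'M[K]_2 := delta_mx 1 0.
Definition h_mx : 'M[K]_2 := delta_mx 0 0 - delta_mx 1 1.

Lemma sl2_mxE (x : 'M[K]_2) : \tr x = 0 ->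
  x = x 0 0 *: h_mx + (x 0 1 *: e_mx + (x 1 0 *: f_mx + 0)).
Proof.
rewrite /mxtrace !big_ord_recl big_ord0 addr0 => /eqP; rewrite addr_eq0 => /eqP x0.
apply/matrixP=> p q; rewrite !mxE.
have x0' : x 0 0 = - x 1 1 by rewrite x0; congr (- x _ _); apply: val_inj.
case: p q => [[|[|//]] p] [[|[|//]] q]; rewrite -!val_eqE /= ?subr0 ?mulr0 ?mulr1 ?addr0 ?add0r;
  rewrite ?sub0r ?mulrN1; try (congr (x _ _); exact: val_inj).
by rewrite x0' opprK; congr (x _ _); apply: val_inj.
Qed.

Lemma sl2_at_f_base i : sl2_at i f_mx v0 = 0.
Proof.
rewrite /sl2_at /base_point /omega (@der_plucker _ _ _ _ _ 0).
- by rewrite big1 ?scale0r // => d _; rewrite big1 // => j _; rewrite mxE.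
- move=> j b; rewrite op_vec_base big1 => [|l _]; last by rewrite mxE mul0r.
  by rewrite mxE andbF mul0r.
by move=> j l _; rewrite mxE.
Qed.

(** The i-th projection has trace 1 on U_d when n - 1 - i <= d and trace 0 otherwise, while h is -1
    on f; [aD] counts these levels. *)
Lemma sl2_at_h_base i : sl2_at i h_mx v0 = (1 - (a i)%:R) *: v0.
Proof.
rewrite /sl2_at /base_point /omega (@der_plucker _ _ _ _ _ (- (eval_proj z i)^T)).
- congr (_ *: _); rewrite aD -natr1 opprD addrCA subrr addr0 natr_sum -sumrN.
  apply: eq_bigr => d _.
  under eq_bigr do rewrite !mxE eval_proj_diag //.
  rewrite sumrN; congr (- _); have [le|gt] := leqP (rev_ord i) d.
    rewrite (bigD1 (rev_ord i)) //= eqxx big1 ?addr0 // => j /andP[_].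
    by rewrite eq_sym => /negPf->.
  rewrite big1 // => j jd; case: eqP => // E; move: gt.
  by rewrite E ltnNge jd.
- move=> j b; rewrite op_vec_base.
  rewrite (bigD1 b.2) //= base_flag eqxx andbT big1 ?addr0 => [|l lb]; last first.
    by rewrite base_flag (negPf lb) andbF mulr0.
  rewrite !mxE /=; case: (b.1 =P 1) => [->|b1] /=; first by rewrite sub0r mulN1r mulr1.
  by rewrite andbF subrr mul0r mulr0.
by move=> j l jl; rewrite !mxE eval_proj_upper ?oppr0.
Qed.

Lemma sl2_at_e_nil i Y : iter (#|{: slot}|.+1) (sl2_at i e_mx) Y = 0.
Proof.
have [||nil _] := @der_exp K _ _ (relevant D) (kron e_mx (eval_proj z i)) 0 (#|{: slot}|.+1) => //.
move=> b c; rewrite kron_comp /kron; have -> : e_mx *m e_mx = 0; last by rewrite mxE mul0r.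
by rewrite mul_delta_mx_0.
Qed.

Definition e_word (l : seq 'I_n) (m : 'I_n -> nat) (Y : T) : T :=
  foldr (fun i Y => iter (m i) (sl2_at i e_mx) Y) Y l.

Lemma e_word_linear l m : linear (e_word l m).
Proof.
elim: l => //= i l IH c u v.
rewrite -(iter_linear (m i) (@sl2_at_linear i e_mx)); congr iter; exact: IH.
Qed.

Lemma iter_comm (V : Type) (f g : V -> V) k y : (forall u, f (g u) = g (f u)) ->
  f (iter k g y) = iter k g (f y).
Proof. by move=> fg; elim: k => //= k IH; rewrite fg IH. Qed.

Lemma sl2_at_e_word i x l m Y : i \notin l ->
  sl2_at i x (e_word l m Y) = e_word l m (sl2_at i x Y).
Proof.
elim: l => //= j l IH; rewrite inE negb_or => /andP[ij il].
by rewrite iter_comm ?IH // => u; apply: sl2_atC.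
Qed.

Lemma e_word_rem i l m Y : uniq l -> i \in l ->
  e_word l m Y = iter (m i) (sl2_at i e_mx) (e_word (rem i l) m Y).
Proof.
elim: l => //= j l IH /andP[jl ul]; rewrite inE => /predU1P[->|il]; first by rewrite eqxx.
have ji : j != i by apply: contraNneq jl => ->.
rewrite eq_sym in ji; rewrite eq_sym (negPf ji) IH //=.
elim: (m i) => //= k IHk; rewrite -IHk [RHS]iter_comm // => u; exact: sl2_atC.
Qed.

Lemma eq_e_word l m m' Y : {in l, m =1 m'} -> e_word l m Y = e_word l m' Y.
Proof.
elim: l => //= j l IH mm; rewrite mm ?mem_head // IH // => i il.
by rewrite mm // inE il orbT.
Qed.

Definition pure_image (m : multi_index a) : T := e_word (enum 'I_n) (fun i => m i) v0.

Lemma a_gt0 i : (0 < a i)%N. Proof. by rewrite aD. Qed.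

(** The other factors commute with the i-th copy of sl2 and can be moved inside. What remains is a
    string of powers of e on a lowest weight vector of weight 1 - a_i, that is, a quotient of
    C^(a_i). *)
Lemma sl2_at_pure i x (m : multi_index a) : \tr x = 0 ->
  sl2_at i x (pure_image m) =
  \sum_(k < a i) sl2_rep (a i) x k (m i) *: pure_image (set_index m k).
Proof.
move=> x0; pose w := e_word (rem i (enum 'I_n)) (fun i => m i) v0.
have ue := enum_uniq 'I_n; have ie := mem_enum 'I_n i.
have irem : i \notin rem i (enum 'I_n) by rewrite mem_rem_uniq // !inE eqxx.
have pureE (m' : multi_index a) : (forall j, j != i -> m' j = m j) ->
    pure_image m' = iter (m' i) (sl2_at i e_mx) w.
  move=> mm; rewrite /pure_image (e_word_rem _ _ ue ie); congr iter.
  apply: eq_e_word => j; rewrite mem_rem_uniq // inE => /andP[ji _].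
  by rewrite mm.
have set_same (k : 'I_(a i)) : set_index m k i = k by rewrite ffunE dfwith_in.
have set_out (k : 'I_(a i)) j : j != i -> set_index m k j = m j.
  by move=> ji; rewrite ffunE dfwith_out // eq_sym.
rewrite pureE //; under eq_bigr => k _ do
  (rewrite pureE; last exact: set_out); under eq_bigr => k _ do rewrite set_same.
rewrite {1}(sl2_mxE x0) !sl2_atD.
rewrite sl2_at0 addr0 addrA.
have mxs : (e_mx *m f_mx - f_mx *m e_mx = h_mx) /\ (h_mx *m e_mx - e_mx *m h_mx = 2 *: e_mx).
  split; apply/matrixP=> p q; rewrite !mxE !big_ord_recl !big_ord0 !mxE;
  case: p q => [[|[|//]] p] [[|[|//]] q]; rewrite -!val_eqE /=; ring.
apply: sl2_rep_iter; rewrite ?a_gt0 //; try exact: sl2_at_linear.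
- by move=> y; rewrite sl2_atB mxs.1.
- move=> y; rewrite sl2_atB mxs.2; congr (_ + _).
  by have := sl2_atD i 2 e_mx 0 y; rewrite addr0 sl2_at0 addr0.
- by rewrite /w sl2_at_e_word // sl2_at_f_base (linear_fun0 (e_word_linear _ _)).
- by rewrite /w sl2_at_e_word // sl2_at_h_base (linear_funZ _ (e_word_linear _ _)).
- by exists #|{: slot}|.+1; exact: sl2_at_e_nil.
Qed.

End EvaluationToTensors.

Section TensorMap.
Context {K : numFieldType} {n' : nat}.
Local Notation n := n'.+1.
Local Notation basis := ('I_2 * 'I_n)%type.
Local Notation slot := ('I_n * 'I_n)%type.
Local Notation T := (@tensors K slot basis).
Variables (a : 'I_n -> nat) (z : 'I_n -> K) (D : {set 'I_n}).
Hypothesis z_inj : injective z.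
Hypothesis aD : forall i, a i = (\sum_(d in D) ((rev_ord i : 'I_n) <= d)%N).+1.

(* The basis vector w_m goes to the product of the E_i^(m i) applied to v0, where
   E_i is the action of e (x) (spectral projection of t at z_i). *)
Definition tensor_map (u : tensor a) : T :=
  \sum_(m : multi_index a) u m *: pure_image z D m.

Lemma tensor_map_linear : linear tensor_map.
Proof.
move=> c u v; rewrite /tensor_map scaler_sumr -big_split; apply: eq_bigr => m _ /=.
by rewrite scalerA -scalerDl !ffunE.
Qed.
HB.instance Definition _ :=
  GRing.isLinear.Build K (tensor a) T _ tensor_map tensor_map_linear.

Lemma set_index_same (m : multi_index a) i (k : 'I_(a i)) : set_index m k i = k.
Proof. by rewrite ffunE dfwith_in. Qed.

Lemma set_index_out (m : multi_index a) i (k : 'I_(a i)) j : j != i -> set_index m k j = m j.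
Proof. by move=> ji; rewrite ffunE dfwith_out // eq_sym. Qed.

Lemma set_indexK (m : multi_index a) i (k : 'I_(a i)) : set_index (set_index m k) (m i) = m.
Proof.
apply/ffunP=> j; have [->|ji] := eqVneq j i; first by rewrite set_index_same.
by rewrite !set_index_out.
Qed.

Lemma tensor_map_slot x i u : \tr x = 0 ->
  tensor_map (slot_act x i u) = sl2_at z D i x (tensor_map u).
Proof.
move=> x0; rewrite /tensor_map.
have lin := @sl2_at_linear K n' z D i x.
pose sl : {linear T -> T} := HB.pack (sl2_at z D i x) (GRing.isLinear.Build K T T _ _ lin).
rewrite -[sl2_at _ _ _ _]/(sl : T -> T) linear_sum /=.
under [RHS]eq_bigr => m _ do
  rewrite (linear_funZ _ lin) (sl2_at_pure z_inj aD) // scaler_sumr.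
under [LHS]eq_bigr => m _ do rewrite ffunE scaler_suml.
rewrite !pair_big /=.
(* The involution exchanges the i-th index of the tensor with the summation index of the matrix
   product. *)
rewrite (reindex (fun p : multi_index a * 'I_(a i) => (set_index p.1 p.2, p.1 i))) /=.
  apply: eq_bigr => -[m k] _ /=.
  by rewrite set_indexK set_index_same scalerA mulrC.
exists (fun p : multi_index a * 'I_(a i) => (set_index p.1 p.2, p.1 i)) => -[m k] _ /=;
  by rewrite set_indexK set_index_same.
Qed.

Lemma tensor_map_act x k u : \tr x = 0 ->
  tensor_map (eval_act z x k u) =
  der (relevant D) (kron x (eval_mx z ^+ k)) (tensor_map u).
Proof.
move=> x0; rewrite /eval_act linear_sum.
under eq_bigr => i _ do rewrite linearZ /= tensor_map_slot // /sl2_at -derZ.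
rewrite -der_sum; apply: eq_der => b c; rewrite /kron eval_mxX // summxE mulr_sumr.
by apply: eq_bigr => i _; rewrite [in RHS]mxE; ring.
Qed.

Lemma tensor_map_lowest : tensor_map (lowest a) = base_point D.
Proof.
have zero_lt i : (0 < a i)%N by rewrite aD.
pose m0 : multi_index a := [ffun i => Ordinal (zero_lt i)].
rewrite /tensor_map (bigD1 m0) //= ffunE big1 ?addr0 => [|m mm0].
  have -> : [forall i, m0 i == 0 :> nat] by apply/forallP => i; rewrite ffunE.
  rewrite scale1r /pure_image; elim: (enum _) => //= i l ->.
  by rewrite ffunE.
rewrite ffunE; case: forallP => [m0E|_]; last by rewrite scale0r.
case/eqP: mm0; apply/ffunP => i; apply: val_inj; rewrite ffunE /=; exact/eqP.
Qed.

End TensorMap.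

Lemma vspan_ind {K : fieldType} {V V' : vectType K} (S : V -> Prop) (g : {linear V -> V'}) :
  (forall u, S u -> g u = 0) -> forall u, u \in vspan S -> g u = 0.
Proof.
move=> S0 u uS; have /subvP/(_ u uS) : (vspan S <= lker (linfun g))%VS.
  by apply: (vspanP S).2 => w Sw; rewrite memv_ker lfunE /= S0.
by rewrite memv_ker lfunE /= => /eqP.
Qed.

(** * The map on the associated graded module *)

Section Grading.
Context {K : numFieldType} {n' : nat}.
Local Notation n := n'.+1.
Local Notation basis := ('I_2 * 'I_n)%type.
Local Notation slot := ('I_n * 'I_n)%type.
Local Notation place := (@place slot basis).
Local Notation T := (@tensors K slot basis).
Variables (z : 'I_n -> K) (D : {set 'I_n}).
Implicit Types (Y : T) (r : place).

(** [eval_mx z] is the shift plus a diagonal matrix: in its k-th power only k shifts reach the k-th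
    superdiagonal, and nothing reaches beyond it. *)
Lemma eval_mxX_entry k (p q : 'I_n) : (p + k <= q)%N ->
  (eval_mx z ^+ k) p q = (shift_mx ^+ k) p q.
Proof.
elim: k p q => [|k IH] p q pq; first by rewrite !expr0.
have lt : (p.+1 < n)%N by have := ltn_ord q; lia.
have step (M : 'M[K]_n) : (eval_mx z * M) p q = M (Ordinal lt) q + z (rev_ord p) * M p q.
  rewrite mulrDl !mxE; congr (_ + _).
    rewrite (bigD1 (Ordinal lt)) //= mxE eqxx mul1r big1 ?addr0 // => l.
    by rewrite -val_eqE /= mxE => /negPf->; rewrite mul0r.
  rewrite (bigD1 p) //= !mxE eqxx mulr1n big1 ?addr0 // => l lp.
  by rewrite !mxE eq_sym (negPf lp) mulr0n mul0r.
rewrite exprS step !IH /=; [|lia|lia].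
rewrite !shift_mxX !mxE /= addSnnS [(q == (p + k)%N :> nat)]gtn_eqF ?mulr0 ?addr0 //; lia.
Qed.

Definition place_deg r := \sum_(s | relevant D s) ((r s).2 : nat).
Definition base_deg := \sum_(s : slot | relevant D s) (s.2 : nat).

(** The index l stands for a polynomial of degree n - 1 - l in t, so t lowers [place_deg]; degrees
    are counted downwards from the base point, which has degree 0. *)
Definition in_degree m Y := forall r, Y r != 0 -> (base_deg <= place_deg r + m)%N.

(* The component of degree m; coordinates are graded by minus place_deg. *)
Definition component (m : nat) Y : T :=
  [ffun r : place => if (place_deg r + m == base_deg)%N then Y r else 0].

(** This expresses a degree bound as the vanishing of a linear map, so that it can be checked on the
    words spanning the filtration. *)
Definition high_part (m : nat) Y : T :=
  [ffun r : place => if (base_deg <= place_deg r + m)%N then 0 else Y r].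

Lemma component_linear m : linear (component m).
Proof.
move=> c u v; apply/ffunP=> r; rewrite !ffunE; case: ifP => // _.
by rewrite scaler0 addr0.
Qed.
HB.instance Definition _ m := GRing.isLinear.Build K T T _ (component m) (component_linear m).

Lemma high_part_linear m : linear (high_part m).
Proof.
move=> c u v; apply/ffunP=> r; rewrite !ffunE; case: ifP => // _.
by rewrite scaler0 addr0.
Qed.
HB.instance Definition _ m := GRing.isLinear.Build K T T _ (high_part m) (high_part_linear m).

Lemma in_degreeP m Y : in_degree m Y <-> high_part m Y = 0.
Proof.
split=> [Ym|/ffunP Y0 r].
  apply/ffunP => r; rewrite !ffunE; case: ifP => // /negbT.
  by case: (eqVneq (Y r) 0) => // /Ym ->.
by have := Y0 r; rewrite !ffunE; case: ifP => // _ ->; rewrite eqxx.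
Qed.

Lemma in_degree_le m m' Y : (m <= m')%N -> in_degree m Y -> in_degree m' Y.
Proof. by move=> mm Ym r /Ym h; rewrite (leq_trans h) // leq_add2l. Qed.

Lemma component_lower m Y : in_degree m Y -> component m.+1 Y = 0.
Proof.
move=> Ym; apply/ffunP=> r; rewrite !ffunE; case: eqP => // E.
by apply/eqP; apply: contraT => /Ym; rewrite -E addnS ltnn.
Qed.

Lemma place_deg_upd r s b : relevant D s ->
  (place_deg (upd r s b) + (r s).2 = place_deg r + b.2)%N.
Proof.
move=> sD; rewrite /place_deg (bigD1 s) //= [in RHS](bigD1 s) //= upd_same.
rewrite addnAC [in RHS]addnAC addnC [in RHS]addnC; congr (_ + _)%N; last exact: addnC.
by apply: eq_bigr => s' /andP[_ ss']; rewrite upd_other.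
Qed.

(** A nonzero entry of [eval_mx z ^+ k] raises the degree by at most k. It raises it by exactly k
    only on the k-th superdiagonal, where it equals that of the shift, so leading components see the
    nilpotent action. *)
Lemma der_eval_degree x k m Y : in_degree m Y ->
  in_degree (m + k) (der (relevant D) (kron x (eval_mx z ^+ k)) Y) /\
  component (m + k) (der (relevant D) (kron x (eval_mx z ^+ k)) Y) =
  der (relevant D) (kron x (shift_mx ^+ k)) (component m Y).
Proof.
move=> Ym.
(* In these arithmetic facts [A] and [B] are the values of [place_deg] before and after an update,
   [p] and [q] the second indices of the old and new entries, and [c] is [base_deg]. *)
have ar1 (A B p q c m' k' : nat) : (B + p = A + q -> A + (m' + k') <= c -> c <= B + m' ->
    p + k' <= q)%N by lia.
have ar2 (A B p q c m' k' : nat) : (B + p = A + q -> A + (m' + k') <= c -> c <= B + m' ->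
    q = p + k' -> A + (m' + k') = c)%N by lia.
have ar3 (A B p q c m' k' : nat) : (B + p = A + q -> A + (m' + k') <= c -> c <= B + m' ->
    q = p + k' -> B + m' = c)%N by lia.
have ar4 (A B p q c m' k' : nat) : (B + p = A + q -> q = p + k' -> B + m' = c ->
    A + (m' + k') = c)%N by lia.
have key r s b : relevant D s -> (place_deg r + (m + k) <= base_deg)%N ->
    (eval_mx z ^+ k) (r s).2 b.2 * Y (upd r s b) =
    (shift_mx ^+ k) (r s).2 b.2 *
      (if (place_deg r + (m + k) == base_deg)%N then component m Y (upd r s b) else 0).
  move=> sD le; have dE := place_deg_upd r b sD.
  have [Y0|/Ym Y0] := eqVneq (Y (upd r s b)) 0.
    by rewrite ffunE Y0 !if_same !mulr0.
  have ge : ((r s).2 + k <= b.2)%N := ar1 _ _ _ _ _ _ _ dE le Y0.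
  rewrite eval_mxX_entry // shift_mxX mxE ffunE.
  case: eqP => [E|_]; last by rewrite !mul0r.
  have -> : (place_deg r + (m + k) == base_deg)%N.
    by apply/eqP; apply: (ar2 _ _ _ _ _ _ _ dE le Y0 E).
  have -> // : (place_deg (upd r s b) + m == base_deg)%N.
  by apply/eqP; apply: (ar3 _ _ _ _ _ _ _ dE le Y0 E).
split=> [r|].
  apply: contraR; rewrite -ltnNge => lt; apply/eqP; rewrite derE big1 // => s sD.
  rewrite big1 // => b _; rewrite /kron -mulrA key ?(ltnW lt) // ltn_eqF //.
  by rewrite !mulr0.
apply/ffunP=> r; rewrite ffunE !derE; case: eqP => [E|ne].
  apply: eq_bigr => s sD; apply: eq_bigr => b _.
  by rewrite /kron -!mulrA key ?E // eqxx.
rewrite big1 // => s sD; rewrite big1 // => b _.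
rewrite /kron ffunE -mulrA shift_mxX mxE; case: eqP => [bE|_]; last by rewrite mul0r mulr0.
have dE := place_deg_upd r b sD.
by case: eqP => [E|_]; [case: ne; apply: (ar4 _ _ _ _ _ _ _ dE bE E)|rewrite !mulr0].
Qed.

End Grading.

(** * Descent of the embedding to the fusion product *)

Section FusionMap.
Context {K : numFieldType} {n' : nat}.
Local Notation n := n'.+1.
Local Notation basis := ('I_2 * 'I_n)%type.
Local Notation slot := ('I_n * 'I_n)%type.
Local Notation T := (@tensors K slot basis).
Variables (a : 'I_n -> nat) (z : 'I_n -> K) (D : {set 'I_n}).
Hypothesis z_inj : injective z.
Hypothesis aD : forall i, a i = (\sum_(d in D) ((rev_ord i : 'I_n) <= d)%N).+1.
Variable M : fusion_product a z.

Local Notation V := (@tensor K n a).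
Local Notation FV := (@fusion_filtration K n a z).
Local Notation j := (tensor_map z D).

Lemma filtration_degree m u : u \in FV m -> in_degree D m (j u).
Proof.
move=> uV; apply/in_degreeP.
apply: (vspan_ind (g := high_part D m \o j)) uV => _ [w [w0 wm ->]] /=.
apply/in_degreeP; apply: in_degree_le wm _.
elim: w w0 => [_|[x k] w IH /= /andP[/eqP x0 w0]].
  move=> r; rewrite /word_act /= tensor_map_lowest // addn0 => /base_point_supp E.
  by rewrite /base_deg /place_deg E.
rewrite tensor_map_act // addnC.
by have [] := der_eval_degree z x k (IH w0).
Qed.

(** A vanishing symbol means that [u] lies one step lower in the filtration, so its image has degree
    less than m. *)
Lemma component_symb0 m u : u \in FV m -> fp_symb M m u = 0 -> component D m (j u) = 0.
Proof.
move=> uV u0; have : u \in fusion_filtration_pred a z m.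
  by rewrite -(fp_ker M) memv_cap uV memv_ker u0 eqxx.
case: m {uV u0} => [|m] /=; first by rewrite memv0 => /eqP ->; rewrite !linear0.
by move/filtration_degree/component_lower.
Qed.

Definition fp_map_sum N (u : nat -> V) : T := \sum_(m < N) component D m (j (u m)).

Definition cut N (u : nat -> V) m : V := if (m < N)%N then u m else 0.

Lemma cut_filtration N u : (forall m, u m \in FV m) -> forall m, cut N u m \in FV m.
Proof. by move=> uV m; rewrite /cut; case: ifP => // _; apply: mem0v. Qed.

Lemma sum_cut (U : zmodType) (f : nat -> {additive V -> U}) N N' u : (N <= N')%N ->
  \sum_(m < N') f m (cut N u m) = \sum_(m < N) f m (u m).
Proof.
move=> le; rewrite [RHS](big_ord_widen_cond N' xpredT (fun m => f m (u m))) //=.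
by rewrite [RHS]big_mkcond /=; apply: eq_bigr => m _; rewrite /cut; case: ifP; rewrite ?raddf0.
Qed.

(** Elements of [M] are sums of symbols in many ways. By directness the symbols agree degree by
    degree, which makes the choice in [fp_map] harmless. *)
Lemma fp_map_sum_wd N u N' u' : (forall m, u m \in FV m) -> (forall m, u' m \in FV m) ->
  \sum_(m < N) fp_symb M m (u m) = \sum_(m < N') fp_symb M m (u' m) ->
  fp_map_sum N u = fp_map_sum N' u'.
Proof.
move=> uV u'V E; pose L := maxn N N'.
pose w m := cut N u m - cut N' u' m.
have wV m : w m \in FV m by rewrite memvB ?cut_filtration.
have w0 : \sum_(m < L) fp_symb M m (w m) = 0.
  rewrite /w; under eq_bigr do rewrite linearB; rewrite sumrB.
  rewrite (sum_cut (fp_symb M)) ?leq_maxl // (sum_cut (fp_symb M)) ?leq_maxr //.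
  by rewrite E subrr.
rewrite /fp_map_sum.
rewrite -(sum_cut (fun m => component D m \o j) u (leq_maxl N N')).
rewrite -(sum_cut (fun m => component D m \o j) u' (leq_maxr N N')).
apply: eq_bigr => m _; apply/eqP; rewrite -subr_eq0 -linearB /=; apply/eqP.
by apply: component_symb0 (wV m) _; apply: (fp_direct wV w0).
Qed.

Definition fp_map (y : M) : T :=
  fp_map_sum (projT1 (cid (fp_span y))) (projT1 (cid (projT2 (cid (fp_span y))))).

Lemma fp_mapE N u y : (forall m, u m \in FV m) -> y = \sum_(m < N) fp_symb M m (u m) ->
  fp_map y = fp_map_sum N u.
Proof.
move=> uV yE; rewrite /fp_map; case: cid => N' /= ?; case: cid => u' /= [u'V yE'].
by apply: fp_map_sum_wd => //; rewrite -yE -yE'.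
Qed.

Lemma fp_map_linear : linear fp_map.
Proof.
move=> c x y; have [N [u [uV xE]]] := fp_span x; have [N' [u' [u'V yE]]] := fp_span y.
rewrite (fp_mapE uV xE) (fp_mapE u'V yE).
pose L := maxn N N'; pose w m := c *: cut N u m + cut N' u' m.
have wV m : w m \in FV m by rewrite memvD ?memvZ ?cut_filtration.
have wE : c *: x + y = \sum_(m < L) fp_symb M m (w m).
  rewrite /w; under eq_bigr do rewrite linearP; rewrite big_split -scaler_sumr /=.
  by rewrite (sum_cut (fp_symb M)) ?leq_maxl // (sum_cut (fp_symb M)) ?leq_maxr // -xE -yE.
rewrite (fp_mapE wV wE) /fp_map_sum.
rewrite -(sum_cut (fun m => component D m \o j) u (leq_maxl N N')).
rewrite -(sum_cut (fun m => component D m \o j) u' (leq_maxr N N')).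
rewrite scaler_sumr -big_split; apply: eq_bigr => m _ /=.
by rewrite /w !linearP.
Qed.
HB.instance Definition _ := GRing.isLinear.Build K M T _ fp_map fp_map_linear.

Lemma fp_map_symb m u : u \in FV m -> fp_map (fp_symb M m u) = component D m (j u).
Proof.
move=> uV; pose w k := if k == m then u else 0.
have wV k : w k \in FV k by rewrite /w; case: eqP => [->|_] //; apply: mem0v.
have sumE (U : zmodType) (f : nat -> {additive V -> U}) :
    \sum_(k < m.+1) f k (w k) = f m u.
  rewrite (bigD1 ord_max) //= /w eqxx big1 ?addr0 // => k.
  by rewrite -val_eqE /= => /negPf ->; rewrite raddf0.
rewrite (@fp_mapE m.+1 w) //; last by rewrite (sumE _ (fp_symb M)).
by rewrite /fp_map_sum (sumE _ (fun m => component D m \o j)).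
Qed.

Lemma fp_map_act x k y : \tr x = 0 ->
  fp_map (fp_act M x k y) = der (relevant D) (kron x (shift_mx ^+ k)) (fp_map y).
Proof.
move=> x0; have [N [u [uV ->]]] := fp_span y.
rewrite (linear_sum (fp_act M x k)) !(linear_sum fp_map) (linear_sum (der _ _)).
apply: eq_bigr => m _ /=.
rewrite fp_actE // !fp_map_symb ?fusion_filtration_act //.
by rewrite tensor_map_act //; have [] := der_eval_degree z x k (filtration_degree (uV m)).
Qed.

Lemma fp_map_vec : fp_map (fp_vec M) = base_point D.
Proof.
rewrite fp_map_symb ?tensor_map_lowest //; last first.
  by apply: (vspanP _).1; exists [::].
apply/ffunP=> r; rewrite ffunE addn0; case: eqP => // /eqP ne.
apply/esym/eqP; apply: contraNT ne => /base_point_supp E.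
by rewrite /place_deg E.
Qed.

Lemma fp_map_current X y : \tr X = 0 ->
  fp_map (current_act M X y) = der (relevant D) (current_op X) (fp_map y).
Proof.
move=> X0; rewrite /current_act sum_lfunE linear_sum /=.
transitivity (\sum_(k < n) der (relevant D)
    (kron (map_mx (fun p : trunc_poly => (p : {poly K})`_k) X) (shift_mx ^+ k)) (fp_map y)).
  apply: eq_bigr => k _; rewrite fp_map_act //.
  have := congr1 (fun p : trunc_poly => (p : {poly K})`_k) X0.
  rewrite /mxtrace !(raddf_sum (val : trunc_poly -> {poly K})) /= coef_sum coef0 => E.
  by rewrite -[RHS]E; apply: eq_bigr => i _; rewrite mxE.
rewrite -der_sum; apply: eq_der => b c.
rewrite /current_op horner_mx_trunc ?shift_mx_nil // summxE.
by apply: eq_bigr => k _; rewrite /kron !mxE.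
Qed.

Lemma dim_tensor : \dim {:V} = (\prod_i a i)%N.
Proof.
rewrite dimvf; have -> : dim V = (#|{: multi_index a}| * 1)%N by [].
rewrite muln1 card_dep_ffun foldrE big_image /=.
by apply: eq_bigr => i _; rewrite card_ord.
Qed.

(** A finite basis involves finitely many symbols, and the dimensions of the successive quotients of
    the filtration telescope. *)
Lemma fp_dim_le : (\dim {:M} <= \prod_i a i)%N.
Proof.
pose W N := (\sum_(m < N) fp_symb M m @: FV m)%VS.
have Wle N N' : (N <= N')%N -> (W N <= W N')%VS.
  move=> le; apply/subv_sumP => m _.
  by apply: (sumv_sup (widen_ord le m)).
have [N WN] : exists N, forall y, y \in (vbasis {:M} : seq M) -> y \in W N.
  elim: (vbasis {:M} : seq M) => [|y l [N IH]]; first by exists 0%N.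
  have [N' [u [uV yE]]] := fp_span y; exists (maxn N N') => y'.
  rewrite inE => /predU1P[->|/IH]; last exact: (subvP (Wle _ _ (leq_maxl _ _))).
  apply: (subvP (Wle _ _ (leq_maxr N N'))); rewrite yE; apply: memv_suml => m _.
  by apply: (subvP (sumv_sup m isT (subvv _))); apply: memv_img.
have Wfull : ({:M} <= W N)%VS.
  by rewrite -(span_basis (vbasisP {:M})); apply/span_subvP.
apply: leq_trans (dimvS Wfull) _; rewrite -dim_tensor.
have symb_dim m : (\dim (fp_symb M m @: FV m) +
    \dim (fusion_filtration_pred a z m) = \dim (FV m))%N.
  by rewrite addnC -(limg_ker_dim (fp_symb M m) (FV m)) capvC fp_ker.
have bound k : (\sum_(m < k) \dim (fp_symb M m @: FV m) <= \dim (fusion_filtration_pred a z k))%N.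
  elim: k => [|k IH]; first by rewrite big_ord0.
  by rewrite big_ord_recr /= -(symb_dim k) addnC leq_add2l.
apply: leq_trans (leq_trans (bound N) (dimvS (subvf _))).
exact: (leq_trans (dimv_leq_sum _ _ _) (leqnn _)).
Qed.

Definition fp_lfun : 'Hom(M, T) := linfun fp_map.

Lemma fp_lfun_vec : fp_lfun (fp_vec M) = base_point D.
Proof. by rewrite /fp_lfun lfunE /= fp_map_vec. Qed.

Lemma fp_lfun_current X y : \tr X = 0 ->
  fp_lfun (current_act M X y) = der (relevant D) (current_op X) (fp_lfun y).
Proof. by move=> X0; rewrite /fp_lfun !lfunE; apply: fp_map_current. Qed.

Lemma fp_lfun_inj : (\prod_i a i <= \dim (limg fp_lfun))%N -> lker fp_lfun == 0%VS.
Proof.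
move=> le; rewrite -dimv_eq0 -leqn0 -(leq_add2r (\dim (limg fp_lfun))) add0n.
rewrite -{1}(capfv (lker fp_lfun)) limg_ker_dim.
exact: leq_trans fp_dim_le le.
Qed.

End FusionMap.

(** * Injectivity *)

Section ToeplitzMinors.
Context {K : numFieldType}.
Local Notation fn := ((nat -> K) -> K).
Implicit Types (x y : nat -> K) (r : nat -> 'I_2 * nat) (mu : seq nat) (f g : fn).

(* The maximal minors of the matrix (T | 1), T the lower triangular Toeplitz
   matrix of x; they are the minors of T of all sizes. *)
Definition toeplitz x (i : nat) (b : 'I_2 * nat) : K :=
  if b.1 == 1 then (i == b.2)%:R else if (b.2 <= i)%N then x (i - b.2)%N else 0.

Definition minor m r x : K := \det (\matrix_(i < m, k < m) toeplitz x i (r k)).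

(** The sizes [mu] will be the d + 1 with d in D; the bound on second indices ensures that each
    minor is a coordinate available in the wedge of that size. *)
Fixpoint minor_product mu f : Prop :=
  if mu is m :: mu' then exists r g, [/\ forall k, (k < m)%N -> ((r k).2 < m)%N,
    minor_product mu' g & f = fun x => minor m r x * g x]
  else f = fun=> 1.

Definition cons_fun (c : K) x k := if k is k'.+1 then x k' else c.

(** The added column has a single nonzero entry, x_0 in the last row. *)
Lemma minor_mul_head m r x :
  minor m.+1 (fun k => if k == m then (0, m) else r k) x = x 0%N * minor m r x.
Proof.
rewrite /minor (expand_det_col _ ord_max) (bigD1 ord_max) //= big1 ?addr0 => [|i ne].
  rewrite mxE /= eqxx /toeplitz /= leqnn subnn; congr (_ * _).
  rewrite /cofactor -signr_odd addnn odd_double mul1r; congr (\det _).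
  by apply/matrixP=> i k; rewrite !mxE !lift_max [(k == m :> nat)]ltn_eqF.
rewrite mxE /= eqxx /toeplitz /=; case: ifP => [le|_]; last by rewrite mul0r.
by case/eqP: ne; apply: val_inj => /=; have := ltn_ord i; lia.
Qed.

Definition shift_cols r k : 'I_2 * nat :=
  if k is k'.+1 then (if (r k').1 == 1 then (1, (r k').2.+1) else r k') else (1, 0%N).

(** When x_0 = 0 the Toeplitz columns are those of y pushed down by one row; the added unit column
    removes the empty top row. *)
Lemma minor_shift m r y : minor m.+1 (shift_cols r) (cons_fun 0 y) = minor m r y.
Proof.
rewrite /minor (expand_det_col _ ord0) (bigD1 ord0) //= big1 ?addr0 => [|i ne].
  rewrite mxE /= /toeplitz eqxx mul1r /cofactor expr0 mul1r; congr (\det _).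
  apply/matrixP=> i k; rewrite !mxE !lift0 /= /toeplitz.
  case E1: ((r k).1 == 1); first by rewrite /= eqSS.
  rewrite E1; have [le|] := leqP (r k).2 i; first by rewrite leqW //= subSn.
  move=> gt; case: ifP => // le; have -> : (r k).2 = i.+1 by apply/eqP; rewrite eqn_leq le gt.
  by rewrite subnn.
rewrite mxE /toeplitz eqxx; case: eqP => [E|_]; last by rewrite mul0r.
by case/eqP: ne; apply: val_inj.
Qed.

Lemma minor_product_shift mu f : minor_product mu f ->
  exists2 f', minor_product (map succn mu) f' & forall y, f' (cons_fun 0 y) = f y.
Proof.
elim: mu f => [|m mu IH] f /=; first by move->; exists (fun=> 1).
move=> [r [g [rm /IH [g' g'P g'E] ->]]].
exists (fun x => minor m.+1 (shift_cols r) x * g' x) => [|y]; last by rewrite minor_shift g'E.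
exists (shift_cols r), g'; split=> // -[|k] //= km; case: ifP => _ /=; rewrite ltnS.
  exact: rm.
exact/ltnW/rm.
Qed.

Lemma minor_product_poly mu f x : minor_product mu f ->
  exists p : {poly K}, forall c, f (cons_fun c x) = p.[c].
Proof.
elim: mu f => [|m mu IH] f /=; first by move->; exists 1 => c; rewrite hornerC.
move=> [r [g [_ /IH[q qE] ->]]].
pose P : 'M[{poly K}]_m := \matrix_(i, k)
  if (r k).1 == 1 then (i == (r k).2 :> nat)%:R
  else if ((r k).2 <= i)%N then (if (i - (r k).2)%N is j.+1 then (x j)%:P else 'X) else 0.
exists (\det P * q) => c; rewrite hornerM qE; congr (_ * _).
rewrite -[RHS]/(horner_eval c (\det P)) -det_map_mx; congr (\det _).
apply/matrixP=> i k; rewrite !mxE /toeplitz /= /horner_eval.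
case: ifP => _; first by case: eqP => _ /=; rewrite !hornerE.
case: ifP => _; last by rewrite horner0.
by case: (i - (r k).2)%N => [|j] /=; rewrite ?hornerX ?hornerC.
Qed.

Definition independent N (f : 'I_N -> fn) :=
  forall c : 'I_N -> K, (forall x, \sum_i c i * f i x = 0) -> forall i, c i = 0.

(** The counts are the parts of the conjugate partition. For the sizes d + 1 with d in D the factors
    are the a_i in reverse order. *)
Definition conj_prod n mu : nat := \prod_(j < n) (count (fun m => j < m)%N mu).+1.

Lemma poly_eq0_on_nz (p : {poly K}) : (forall c, c != 0 -> p.[c] = 0) -> p = 0.
Proof.
move=> p0; apply/eqP/negPn/negP => nz.
have := max_poly_roots nz (rs := [seq i.+1%:R | i <- iota 0 (size p)]).
rewrite size_map size_iota ltnn => H; suff: false by []; apply: H.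
  by apply/allP => _ /mapP[i _ ->]; rewrite rootE p0 // pnatr_eq0.
by rewrite map_inj_uniq ?iota_uniq // => i j /eqP; rewrite eqr_nat eqSS => /eqP.
Qed.

(** With s = [size mu], the factors 0 to m on the right are all s + 2. Lowering every size by one
    deletes one of them, and lowering the smallest size turns one into s + 1; the identity is
    1/(s+2) + (s+1)/(s+2) = 1. *)
Lemma conj_prod_rec n m mu : all (fun k => m.+1 <= k)%N mu -> (m < n.+1)%N ->
  (conj_prod n (map predn (m.+1 :: mu)) + conj_prod n.+1 (m :: mu) =
   conj_prod n.+1 (m.+1 :: mu))%N.
Proof.
move=> mum mn; set s := size mu.
have cnt j : (j <= m)%N -> count (fun k => j < k)%N mu = s.
  move=> jm; apply/eqP; rewrite -all_count; apply: sub_all mum => k; exact: leq_trans.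
have -> : conj_prod n.+1 (m.+1 :: mu) =
    (s.+2 * conj_prod n (map predn (m.+1 :: mu)))%N.
  rewrite /conj_prod big_ord_recl [count _ _]/= cnt // add1n; congr (_ * _)%N.
  apply: eq_bigr => j _; congr S; rewrite count_map; apply: eq_count => k /=.
  by rewrite /bump /= add1n; case: k.
suff E : (conj_prod n.+1 (m :: mu) * s.+2 =
   s.+1 * (s.+2 * conj_prod n (map predn (m.+1 :: mu))))%N.
  have -> : conj_prod n.+1 (m :: mu) = (s.+1 * conj_prod n (map predn (m.+1 :: mu)))%N.
    by apply/eqP; rewrite -(eqn_pmul2r (ltn0Sn s.+1)) E; apply/eqP; lia.
  by rewrite -mulSn.
have <- : conj_prod n.+1 (m.+1 :: mu) =
    (s.+2 * conj_prod n (map predn (m.+1 :: mu)))%N.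
  rewrite /conj_prod big_ord_recl [count _ _]/= cnt // add1n; congr (_ * _)%N.
  apply: eq_bigr => j _; congr S; rewrite count_map; apply: eq_count => k /=.
  by rewrite /bump /= add1n; case: k.
pose j0 := Ordinal mn.
rewrite /conj_prod (bigD1 j0) //= [in RHS](bigD1 j0) //= ltnn ltnSn cnt // add0n add1n.
rewrite mulnAC [RHS]mulnA; congr (_ * _)%N; apply: eq_bigr => j jj0; congr (_ + _).+1.
have : (j != m :> nat) by move: jj0; rewrite -val_eqE.
by rewrite [in RHS]ltnS [in RHS]leq_eqVlt => /negPf ->.
Qed.

(* Restricting to x_0 = 0 lowers all levels by one, while the products with the
   smallest level lowered by one become multiples of x_0. *)
Lemma minor_products_indep n mu : sorted leq mu -> all (fun m => m <= n)%N mu ->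
  exists N (f : 'I_N -> fn),
    [/\ N = conj_prod n mu, forall i, minor_product mu (f i) & independent f].
Proof.
(* The measure drops in all three recursive calls: an empty minor is removed, all sizes and n are
   lowered, or the smallest size is lowered. *)
have [k] := ubnP (sumn mu + n + size mu)%N; elim: k n mu => // k IH n [|[|m] mu] lt srt ale.
- exists 1%N, (fun _ _ => 1); split=> [|//|c c0 i]; first by rewrite /conj_prod big1.
  have := c0 (fun=> 0); rewrite big_ord_recl big_ord0 mulr1 addr0 => <-.
  by congr c; apply/val_inj; case: i => -[].
- have [|||N [f [NE fP find]]] := IH n mu.
  + by move: lt => /=; lia.
  + exact: path_sorted srt.
  + by case/andP: ale.
  exists N, f; split=> //.
  by move=> i /=; exists (fun=> (0, 0%N)), (f i); split=> //; apply/funext => x;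
    rewrite /minor det_mx00 mul1r.
case: n lt ale => [|n] lt ale; first by case/andP: ale.
have mu_ge : all (fun k => m.+1 <= k)%N mu by exact: order_path_min leq_trans srt.
have muE : map succn (map predn (m.+1 :: mu)) = m.+1 :: mu.
  rewrite -map_comp /=; congr cons; apply: map_id_in => i /(allP mu_ge) /=.
  by case: i.
have [|||N1 [f1 [N1E f1P f1ind]]] := IH n (map predn (m.+1 :: mu)).
- move: lt; rewrite size_map /=; have : (sumn (map predn mu) <= sumn mu)%N.
    elim: (mu) => //= i l; case: i => [|i] /=; lia.
  lia.
- rewrite sorted_map; apply: sub_sorted srt => i j /=; lia.
- rewrite all_map; apply: sub_all ale => i /=; lia.
have [|||N2 [f2 [N2E f2P f2ind]]] := IH n.+1 (m :: mu).
- by move: lt => /=; lia.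
- move: srt => /=; case: (mu) => //= i l /andP[mi ->]; rewrite andbT; lia.
- by case/andP: ale => mn al; apply/andP; split=> //; apply: ltnW.
pose lft i := projT1 (cid2 (minor_product_shift (f1P i))).
have lftP i : minor_product (m.+1 :: mu) (lft i).
  by rewrite -muE /lft; case: cid2.
have lftE i y : lft i (cons_fun 0 y) = f1 i y by rewrite /lft; case: cid2.
pose f i := match split i with inl i1 => lft i1 | inr i2 => fun x => x 0%N * f2 i2 x end.
exists (N1 + N2)%N, f; split.
- by rewrite N1E N2E conj_prod_rec //; case/andP: ale.
- move=> i; rewrite /f; case: (split i) => i'; first exact: lftP.
  have [r [g [rm gP ->]]] := f2P i'.
  exists (fun k => if k == m then (0, m) else r k), g; split=> //.
    by move=> j jm; case: eqP => //= ne; apply: ltnW; rewrite ltnS rm //; lia.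
  by apply/funext => x; rewrite minor_mul_head mulrA.
move=> c c0.
have sumE x : \sum_i c i * f i x = \sum_i c (lshift N2 i) * lft i x
    + x 0%N * \sum_i c (rshift N1 i) * f2 i x.
  rewrite big_split_ord mulr_sumr /=; congr (_ + _); apply: eq_bigr => i _; rewrite /f.
    by rewrite (unsplitK (inl i)).
  by rewrite (unsplitK (inr i)) mulrCA.
have c1 : forall i, c (lshift N2 i) = 0.
  apply: f1ind => y; rewrite -[RHS](c0 (cons_fun 0 y)) sumE mul0r addr0.
  by apply: eq_bigr => i _; rewrite lftE.
(* The remaining relation carries a factor x_0. It can be divided out where x_0 is nonzero, and the
   quotient, a polynomial in x_0, then vanishes identically. *)
have c2 : forall i, c (rshift N1 i) = 0.
  apply: f2ind => x.
  have /choice[p pE] i := minor_product_poly (fun k => x k.+1) (f2P i).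
  have xE : cons_fun (x 0%N) (fun k => x k.+1) = x by apply/funext => -[].
  pose q := \sum_i c (rshift N1 i) *: p i.
  have qE s : q.[s] = \sum_i c (rshift N1 i) * f2 i (cons_fun s (fun k => x k.+1)).
    by rewrite horner_sum; apply: eq_bigr => i _; rewrite hornerZ pE.
  rewrite -[in LHS]xE -qE (_ : q = 0) ?horner0 //; apply: poly_eq0_on_nz => s s0.
  apply: (mulfI s0); rewrite mulr0 qE.
  have := c0 (cons_fun s (fun k => x k.+1)); rewrite sumE big1 ?add0r // => i _.
  by rewrite c1 mul0r.
by move=> i; rewrite -(splitK i); case: (split i) => i' /=.
Qed.

End ToeplitzMinors.

Section TruncPolyColumns.
Context {K : numFieldType} {n' : nat}.
Local Notation n := n'.+1.
Local Notation A := (@trunc_poly K n).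

Definition col_poly (x : 'cV[K]_n) : A := in_qpoly 'X^n (\poly_(i < n) x (inord i) 0).

Lemma coef_col_poly x (i : 'I_n) : (col_poly x : {poly K})`_i = x i 0.
Proof.
rewrite in_qpoly_small ?coef_poly ?ltn_ord ?inord_val //.
by rewrite mk_monic_Xn size_polyXn ltnS size_poly.
Qed.

Lemma horner_col_poly x : horner_mx (shift_mx^T) (col_poly x) *m delta_mx 0 0 = x.
Proof.
have Jn : (shift_mx^T : 'M[K]_n) ^+ n = 0 by rewrite -tr_exp shift_mx_nil trmx0.
rewrite horner_mx_trunc // mulmx_suml; apply/matrixP=> i j; rewrite summxE ord1.
rewrite (bigD1 i) //= big1 ?addr0 => [|k ki];
  rewrite -scalemxAl -colE !mxE -tr_exp shift_mxX !mxE add0n.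
  by rewrite eqxx mulr1 coef_col_poly.
by rewrite eq_sym [(k == i :> nat)]negbTE // mulr0.
Qed.

End TruncPolyColumns.

(** If dim U < N, the values at the [r i] of a basis of U form a matrix with a nontrivial relation
    among its N columns. *)
Lemma dim_ge_independent {K : fieldType} {I : finType} (U : {vspace {ffun I -> K^o}}) N
    (r : 'I_N -> I) :
  (forall c : 'I_N -> K, (forall Y, Y \in U -> \sum_i c i * Y (r i) = 0) -> forall i, c i = 0) ->
  (N <= \dim U)%N.
Proof.
move=> ind; rewrite leqNgt; apply/negP => lt.
pose A : 'M[K]_(\dim U, N) := \matrix_(p, i) (vbasis U)`_p (r i).
have : kermx A^T != 0.
  rewrite -mxrank_eq0 mxrank_ker mxrank_tr -lt0n subn_gt0.
  exact: leq_ltn_trans (rank_leq_row A) lt.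
case/matrix0Pn => i0 [j0]; suff -> : kermx A^T i0 j0 = 0 by rewrite eqxx.
pose c j := kermx A^T i0 j.
apply: (ind c) => Y YU; rewrite (coord_vbasis YU).
have c0 (p : 'I_(\dim U)) : \sum_i c i * (vbasis U)`_p (r i) = 0.
  have /matrixP/(_ i0 p) := mulmx_ker A^T; rewrite [LHS]mxE [RHS]mxE => E; rewrite -[RHS]E.
  by apply: eq_bigr => i _; rewrite [A^T _ _]mxE [A _ _]mxE.
under eq_bigr => i _ do rewrite sum_ffunE mulr_sumr.
rewrite exchange_big big1 //= => p _.
transitivity (coord (vbasis U) p Y * \sum_i c i * (vbasis U)`_p (r i)).
  by rewrite mulr_sumr; apply: eq_bigr => i _; rewrite ffunE mulrCA.
by rewrite c0 mulr0.
Qed.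

(** * Toeplitz minors as coordinates of the unipotent orbit *)

Section Injectivity.
Context {K : numFieldType} {n' : nat}.
Local Notation n := n'.+1.
Local Notation basis := ('I_2 * 'I_n)%type.
Local Notation slot := ('I_n * 'I_n)%type.
Local Notation place := (@place slot basis).
Local Notation T := (@tensors K slot basis).

Definition unipotent (x : nat -> K) : 'I_2 -> 'cV[K]_n :=
  fun e => if e == 1 then delta_mx 0 0 else \col_i x i.

Lemma flag_unipotent x i (b : basis) :
  flag shift_mx^T (unipotent x) i b = toeplitz x i (b.1, b.2 : nat).
Proof.
have [b1|b1] := eqVneq b.1 1.
  have := base_flag (K := K) i b; rewrite /flag /unipotent /base_vec b1 eqxx => ->.
  by rewrite /toeplitz eqxx.
rewrite /flag /unipotent /toeplitz /= (negPf b1) -tr_exp mxE shift_mxX.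
have [le|gt] := leqP b.2 i; last first.
  rewrite big1 // => k _; rewrite !mxE; case: eqP => [E|]; last by rewrite mul0r.
  by move: gt; rewrite E; lia.
have lt : (i - b.2 < n)%N by rewrite (leq_ltn_trans (leq_subr _ _)).
rewrite (bigD1 (Ordinal lt)) //= !mxE /= subnK // eqxx mul1r big1 ?addr0 // => k.
rewrite -val_eqE /= !mxE => ne; case: eqP => [E|]; last by rewrite mul0r.
by case/eqP: ne; rewrite E addnK.
Qed.

Lemma minor_product_place (l : seq 'I_n) f : uniq l ->
  minor_product [seq d.+1 | d : 'I_n <- l] f ->
  exists r : place, forall x,
    f x = \prod_(d <- l) \det (level_mx (fun=> flag shift_mx^T (unipotent x)) r d).
Proof.
elim: l f => [f _ /= ->|d l IH f /= /andP[dl ul] [r [g [rm /(IH _ ul)[r' gE] ->]]]].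
  by exists [ffun=> (0, 0)] => x; rewrite big_nil.
exists [ffun s : slot => if s.1 == d then ((r s.2).1, inord (r s.2).2) else r' s] => x.
rewrite big_cons gE; congr (_ * _).
  congr (\det _); apply/matrixP=> i k; rewrite !mxE flag_unipotent ffunE /= eqxx /=.
  rewrite !inord_level inordK ?(leq_trans (rm _ (ltn_ord k))) //.
rewrite big_seq [RHS]big_seq; apply: eq_bigr => d' d'l; congr (\det _).
apply/matrixP=> i k; rewrite !mxE ffunE /=; case: eqP => // E.
by rewrite -E d'l in dl.
Qed.

Variables (a : 'I_n -> nat) (z : 'I_n -> K) (D : {set 'I_n}).
Hypothesis z_inj : injective z.
Hypothesis aD : forall i, a i = (\sum_(d in D) ((rev_ord i : 'I_n) <= d)%N).+1.
Variable M : fusion_product a z.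
Local Notation phi := (fp_lfun D M).

Lemma limg_der X Y : \tr X = 0 -> Y \in limg phi -> der (relevant D) (current_op X) Y \in limg phi.
Proof.
move=> X0 /memv_imgP[y _ ->]; rewrite -(fp_lfun_current z_inj aD) //.
by rewrite memv_img ?memvf.
Qed.

(** The vector is the exponential of a square-zero current applied to the base point: a combination
    of iterated derivations, under which the image is stable. *)
Lemma unipotent_in_limg x : omega D shift_mx^T (unipotent x) \in limg phi.
Proof.
pose X : 'M[@trunc_poly K n]_2 := mx2 0 (col_poly (\col_i x i)) 0 0.
have X0 : \tr X = 0 by rewrite tr_mx2 addr0.
have sqX : X *m X = 0 by rewrite mx2M !mul0r !mulr0 !addr0 -mx2_0.
have Jn : (shift_mx^T : 'M[K]_n) ^+ n = 0 by rewrite -tr_exp shift_mx_nil trmx0.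
have -> : unipotent x = group_act shift_mx^T (1%:M + X) base_vec.
  apply/funext => e; rewrite group_act1D // /group_act.
  rewrite (bigD1 1) //= big1 ?addr0 => [|e']; last first.
    by rewrite /base_vec => /negPf ->; rewrite mulmx0.
  rewrite /base_vec eqxx /unipotent mxE; case: (eqVneq e 1) => [->|e1] /=.
    by rewrite rmorph0 mul0mx addr0.
  by have -> : e == 0; [case: e e1 => -[|[|//]]|rewrite horner_col_poly add0r].
rewrite -(omega_exp D base_vec Jn sqX (ltnSn _)) /trunc_exp.
apply: memv_suml => k _; apply: memvZ; elim: (k : nat) => [|j IH]; last exact: limg_der.
rewrite /= -[omega _ _ _]/(base_point D) -(fp_lfun_vec z_inj aD M).
exact: memv_img (memvf _).
Qed.

Lemma fp_injective : lker phi == 0%VS.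
Proof.
apply: fp_lfun_inj; pose mu := [seq d.+1 | d : 'I_n <- enum D].
have srt : sorted leq mu.
  have -> : mu = map succn (map val (enum D)) by rewrite -map_comp.
  rewrite sorted_map (eq_sorted (e' := leq)) //.
  have -> : enum D = [seq d <- enum 'I_n | d \in D] by rewrite {1}/enum_mem -enumT.
  rewrite sorted_map.
  rewrite sorted_filter; first by [].
    by move=> i j k /=; apply: leq_trans.
  by have := iota_sorted 0 n; rewrite -val_enum_ord sorted_map.
have ale : all (fun m => m <= n)%N mu.
  by apply/allP => _ /mapP[d _ ->].
have [N [f [NE fP find]]] := @minor_products_indep K n mu srt ale.
have -> : (\prod_i a i)%N = N.
  rewrite NE /conj_prod (reindex_inj rev_ord_inj) /=; apply: eq_bigr => j _.
  rewrite aD rev_ordK /mu count_map -sum1_count [in RHS]big_mkcond big_enum /=.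
  by congr S; apply: eq_bigr => d _; rewrite ltnS; case: leqP.
have /choice[r rE] i := minor_product_place (enum_uniq D) (fP i).
apply: (dim_ge_independent (r := r)) => c cU; apply: find => x.
rewrite -[RHS](cU _ (unipotent_in_limg x)); apply: eq_bigr => i _; rewrite rE ffunE.
by rewrite big_enum.
Qed.

End Injectivity.

Section Nilpotent.
Context {K : numFieldType} {M : vectType K} (S : 'End(M)).

(** The images of the powers shrink strictly until they stabilise, and the stable image is zero.
    Hence [lfun_exp] truncates nothing. *)
Lemma nilpotent_dim N : (forall y, iter N S y = 0) -> forall y, iter (\dim {:M}).+1 S y = 0.
Proof.
move=> SN; pose W m : {vspace M} := iter m (fun U => (S @: U)%VS) fullv.
have WE m : W m.+1 = (S @: W m)%VS by [].
have memW m y : iter m S y \in W m.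
  by elim: m => [|m IH] /=; rewrite ?memvf // memv_img.
have WS m : (W m.+1 <= W m)%VS by elim: m => [|m IH]; rewrite ?subvf // limgS.
have WN : W N = 0%VS.
  apply/eqP; rewrite -subv0; apply/subvP => y.
  suff : forall m y, y \in W m -> exists x, y = iter m S x.
    by move=> H /H[x ->]; rewrite SN mem0v.
  elim=> [|m IH] {}y /=; first by exists y.
  by case/memv_imgP => u /IH[x ->] ->; exists x.
have stab m : W m.+1 = W m -> W m = 0%VS.
  move=> E; have const k : W (m + k)%N = W m.
    by elim: k => [|k IH]; rewrite ?addn0 // addnS WE IH -WE.
  have [le|gt] := leqP m N; first by rewrite -(const (N - m)%N) subnKC.
  have zero k : W (N + k)%N = 0%VS.
    by elim: k => [|k IH]; rewrite ?addn0 // addnS WE IH limg0.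
  by rewrite -(subnKC (ltnW gt)).
have dimW m : W m = 0%VS \/ (\dim (W m) + m <= \dim {:M})%N.
  elim: m => [|m [W0|IH]]; first by right; rewrite addn0.
    by left; rewrite WE W0 limg0.
  have [/eqP E|ne] := boolP (\dim (W m.+1) == \dim (W m)).
    have E' : W m.+1 = W m by apply/eqP; rewrite eqEdim WS E /=.
    by left; rewrite E' stab.
  right; apply: leq_trans IH; rewrite addnS -addSn leq_add2r ltn_neqAle ne.
  exact: dimvS.
move=> y; have := memW (\dim {:M}).+1 y.
by case: (dimW (\dim {:M}).+1) => [->|]; [rewrite memv0 => /eqP|lia].
Qed.

Lemma lfun_expE y : lfun_exp S y = trunc_exp (\dim {:M}).+1 S y.
Proof.
rewrite /lfun_exp /trunc_exp sum_lfunE; apply: eq_bigr => j _; rewrite scale_lfunE.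
congr (_ *: _); elim: (j : nat) => [|k IH] /=; first by rewrite id_lfunE.
by rewrite comp_lfunE IH.
Qed.

Lemma lfun_exp_nilpotent N y : (forall y, iter N S y = 0) ->
  lfun_exp S y = trunc_exp N S y.
Proof.
move=> SN; have linS : linear S by move=> c u v; exact: linearP.
rewrite lfun_expE -(trunc_exp_nil (SN y) linS (leq_maxl N (\dim {:M}).+1)).
by rewrite (trunc_exp_nil (nilpotent_dim SN y) linS) // leq_maxr.
Qed.

End Nilpotent.

(** * Orbits and flags *)

Section PolynomialFunctions.
Context {K : numFieldType}.

Definition polyfun (f : K -> K) := exists p : {poly K}, forall s, f s = p.[s].

Lemma polyfun_cst c : polyfun (fun=> c).
Proof. by exists c%:P => s; rewrite hornerC. Qed.

Lemma polyfun_id : polyfun id.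
Proof. by exists 'X => s; rewrite hornerX. Qed.

Lemma polyfunD f g : polyfun f -> polyfun g -> polyfun (fun s => f s + g s).
Proof. by move=> [p pE] [q qE]; exists (p + q) => s; rewrite hornerD pE qE. Qed.

Lemma polyfunM f g : polyfun f -> polyfun g -> polyfun (fun s => f s * g s).
Proof. by move=> [p pE] [q qE]; exists (p * q) => s; rewrite hornerM pE qE. Qed.

Lemma polyfun_sum (I : Type) (l : seq I) (P : pred I) (f : I -> K -> K) :
  (forall i, polyfun (f i)) -> polyfun (fun s => \sum_(i <- l | P i) f i s).
Proof.
move=> /choice[p pE]; exists (\sum_(i <- l | P i) p i) => s.
by rewrite horner_sum; apply: eq_bigr => i _.
Qed.

Lemma polyfun_prod (I : Type) (l : seq I) (P : pred I) (f : I -> K -> K) :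
  (forall i, polyfun (f i)) -> polyfun (fun s => \prod_(i <- l | P i) f i s).
Proof.
move=> /choice[p pE]; exists (\prod_(i <- l | P i) p i) => s.
by rewrite horner_prod; apply: eq_bigr => i _.
Qed.

Lemma polyfun_det m (A : K -> 'M[K]_m) :
  (forall i j, polyfun (fun s => A s i j)) -> polyfun (fun s => \det (A s)).
Proof.
move=> Apoly; apply: polyfun_sum => t; apply: polyfunM; first exact: polyfun_cst.
by apply: polyfun_prod => i.
Qed.

Lemma polyfun_linear (I : finType) (Y : K -> {ffun I -> K^o})
    (g : {linear {ffun I -> K^o} -> K^o}) :
  (forall r, polyfun (fun s => Y s r)) -> polyfun (fun s => g (Y s)).
Proof.
move=> Ypoly; have E s : g (Y s) = \sum_r Y s r * g [ffun r' => (r' == r)%:R].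
  have {1}-> : Y s = \sum_r Y s r *: [ffun r' => (r' == r)%:R : K^o].
    apply/ffunP => r; rewrite sum_ffunE (bigD1 r) //= !ffunE eqxx big1 ?addr0.
      by rewrite /GRing.scale /= mulr1.
    by move=> r' ne; rewrite !ffunE eq_sym (negPf ne) scaler0.
  by rewrite linear_sum; apply: eq_bigr => r _; rewrite linearZ.
have [p pE] : polyfun (fun s => \sum_r Y s r * g [ffun r' => (r' == r)%:R]).
  by apply: polyfun_sum => r; apply: polyfunM => //; apply: polyfun_cst.
by exists p => s; rewrite E pE.
Qed.

Lemma polyfun_meval k (p : {mpoly K[k]}) (v : K -> 'I_k -> K) :
  (forall i, polyfun (fun s => v s i)) -> polyfun (fun s => p.@[v s]).
Proof.
move=> vpoly; have [q qE] : polyfun (fun s =>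
    \sum_(m <- msupp p) p@_m * \prod_i v s i ^+ m i).
  apply: polyfun_sum => m; apply: polyfunM; first exact: polyfun_cst.
  apply: polyfun_prod => i; elim: (m i) => [|e IH]; first exact: polyfun_cst.
  have [q qE] := polyfunM (vpoly i) IH.
  by exists q => s; rewrite exprS qE.
by exists q => s; rewrite mevalE qE.
Qed.

(** Multiplied by the X - b over the bad values, the polynomial vanishes at all natural numbers,
    which are infinitely many in characteristic zero. *)
Lemma polyfun_eq0 f (bad : seq K) : polyfun f -> (forall s, s \notin bad -> f s = 0) ->
  forall s, f s = 0.
Proof.
move=> [p pE] f0; suff p0 : p = 0 by move=> s; rewrite pE p0 horner0.
pose q := \prod_(b <- bad) ('X - b%:P).
have qnz : q != 0 by rewrite monic_neq0 // monic_prod_XsubC.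
suff /eqP : q * p = 0 by rewrite mulf_eq0 (negPf qnz) => /eqP.
apply/eqP/negPn/negP => nz.
have := max_poly_roots nz (rs := [seq i%:R | i <- iota 0 (size (q * p))]).
rewrite size_map size_iota ltnn => H; suff: false by []; apply: H.
  apply/allP => _ /mapP[i _ ->]; rewrite rootE hornerM.
  have [ib|inb] := boolP (i%:R \in bad); last by rewrite -pE f0 // mulr0.
  have /eqP -> : root q i%:R by rewrite root_prod_XsubC.
  by rewrite mul0r.
by rewrite map_inj_uniq ?iota_uniq // => i j /eqP; rewrite eqr_nat => /eqP.
Qed.

End PolynomialFunctions.

Section GroupEquivariance.
Context {K : numFieldType} {n' : nat}.
Local Notation n := n'.+1.
Local Notation basis := ('I_2 * 'I_n)%type.
Local Notation slot := ('I_n * 'I_n)%type.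
Local Notation T := (@tensors K slot basis).
Local Notation A := (@trunc_poly K n).
Variables (a : 'I_n -> nat) (z : 'I_n -> K) (D : {set 'I_n}).
Hypothesis z_inj : injective z.
Hypothesis aD : forall i, a i = (\sum_(d in D) ((rev_ord i : 'I_n) <= d)%N).+1.
Variable M : fusion_product a z.
Local Notation phi := (fp_lfun D M).

Lemma phi_inj : injective phi.
Proof. exact/lker0P/(fp_injective z_inj aD). Qed.

Lemma fp_lfun_trunc_exp N X y : \tr X = 0 ->
  phi (trunc_exp N (current_act M X) y) = trunc_exp N (der (relevant D) (current_op X)) (phi y).
Proof.
move=> X0; rewrite /trunc_exp linear_sum; apply: eq_bigr => j _; rewrite linearZ /=.
by congr (_ *: _); elim: (j : nat) => //= k <-; rewrite (fp_lfun_current z_inj aD).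
Qed.

(** The statement covers every [C] with [C ^+ n = 0], since equivariance is also needed at limit
    points; [c] and [b] stay general so that the induction passes through products. *)
Lemma fp_lfun_SL2_acts g (S : 'End(M)) : SL2_acts g S ->
  forall y c C b, C ^+ n = 0 -> phi y = c *: omega D C b ->
  phi (S y) = c *: omega D C (group_act C g b).
Proof.
elim=> [X trX X2|g1 h S1 S2 _ IH1 _ IH2] y c C b Cn yE; last first.
  by rewrite comp_lfunE (IH1 _ c C (group_act C h b)) ?group_actM //; apply: IH2.
pose N := #|{: slot}|.+1.
have sqX b1 b2 : op_comp (current_op X) (current_op X) b1 b2 = 0 :> K.
  by rewrite current_op_comp X2 current_op0.
have [nil _] := der_exp (relevant D) 0 sqX (ltnSn _ : (#|{: slot}| < N)%N).
have Snil u : iter N (current_act M X) u = 0.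
  have E k : phi (iter k (current_act M X) u) = iter k (der (relevant D) (current_op X)) (phi u).
    by elim: k => //= k <-; rewrite (fp_lfun_current z_inj aD).
  by apply: phi_inj; rewrite linear0 E nil.
rewrite (lfun_exp_nilpotent y Snil) fp_lfun_trunc_exp // yE.
rewrite -(omega_exp D b Cn X2 (ltnSn _ : (_ < N)%N)).
rewrite /trunc_exp scaler_sumr; apply: eq_bigr => j _.
by rewrite (linear_funZ c (iter_linear j (@der_linear _ _ _ _ _))) !scalerA mulrC.
Qed.

End GroupEquivariance.

(** * Every flag is a limit of points of the orbit *)

Section OrbitClosure.
Context {K : numFieldType} {n' : nat}.
Local Notation n := n'.+1.
Local Notation basis := ('I_2 * 'I_n)%type.
Local Notation slot := ('I_n * 'I_n)%type.
Local Notation T := (@tensors K slot basis).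
Local Notation A := (@trunc_poly K n).
Local Notation J := (@shift_mx K n')^T.

Lemma level_mx_lower (u u' : 'I_n -> basis -> K) (L : 'M[K]_n) r (d : 'I_n) :
    (forall i b, u' i b = \sum_k L i k * u k b) ->
    (forall i k : 'I_n, (i < k)%N -> L i k = 0) ->
  \det (level_mx (fun=> u') r d) =
  (\prod_(i < d.+1) L (inord i) (inord i)) * \det (level_mx (fun=> u) r d).
Proof.
move=> u'E Llow; pose Ld : 'M[K]_d.+1 := \matrix_(i, k) L (inord i) (inord k).
have -> : level_mx (fun=> u') r d = Ld *m level_mx (fun=> u) r d.
  apply/matrixP=> i k; rewrite !mxE u'E; under [RHS]eq_bigr do rewrite !mxE.
  rewrite (sum_inord d (fun l => L (inord i) l * u l (r (d, inord k)))).
  rewrite [RHS]big_mkcond; apply: eq_bigr => j _; case: leqP => // ltj.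
  by rewrite Llow ?mul0r // inord_level (leq_ltn_trans _ ltj) // -ltnS.
rewrite det_mulmx det_trig; first by congr (_ * _); apply: eq_bigr => i _; rewrite mxE.
by apply/is_trig_mxP => i k ik; rewrite mxE Llow // !inord_level.
Qed.

Lemma plucker_lower D (u u' : 'I_n -> basis -> K) (L : 'M[K]_n) :
    (forall i b, u' i b = \sum_k L i k * u k b) ->
    (forall i k : 'I_n, (i < k)%N -> L i k = 0) ->
  plucker D (fun=> u') =
  (\prod_(d in D) \prod_(i < d.+1) L (inord i) (inord i)) *: plucker D (fun=> u).
Proof.
move=> u'E Llow; apply/ffunP => r; rewrite !ffunE /GRing.scale /= -big_split.
by apply: eq_bigr => d _; rewrite (level_mx_lower _ _ u'E Llow).
Qed.

Lemma shift_tr_nil : J ^+ n = 0.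
Proof. by rewrite -tr_exp shift_mx_nil trmx0. Qed.

Lemma col_poly_unit (x : 'cV[K]_n) : x 0 0 != 0 -> col_poly x \is a GRing.unit.
Proof. by rewrite trunc_unit (coef_col_poly x (0 : 'I_n)). Qed.

(** One of the two entries of [b] is a unit of the local ring K[t]/t^n, so [b] is the second column
    of a matrix of determinant 1; [base_vec] selects that column. *)
Lemma group_transitive (b : 'I_2 -> 'cV[K]_n) : b 0 0 0 != 0 \/ b 1 0 0 != 0 ->
  exists2 g : 'M[A]_2, \det g = 1 & group_act J g base_vec = b.
Proof.
move=> b0; pose p := col_poly (b 0); pose q := col_poly (b 1).
have actE (g : 'M[A]_2) : g 0 1 = p -> g 1 1 = q -> group_act J g base_vec = b.
  move=> gp gq; apply/funext => e; rewrite /group_act.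
  rewrite (bigD1 1) //= big1 ?addr0 => [|e']; last first.
    by rewrite /base_vec => /negPf ->; rewrite mulmx0.
  rewrite /base_vec eqxx; have [->|e1] := eqVneq e 1; first by rewrite gq horner_col_poly.
  by have -> : e = 0; [case: e e1 => -[|[|//]] //= ? _; apply: val_inj|rewrite gp horner_col_poly].
case: b0 => [/col_poly_unit pu|/col_poly_unit qu].
  exists (mx2 0 p (- p^-1) q); last by apply: actE; rewrite mxE.
  by rewrite det_mx2 mul0r sub0r mulrN opprK divrr.
exists (mx2 q^-1 p 0 q); last by apply: actE; rewrite mxE.
by rewrite det_mx2 mulr0 subr0 mulVr.
Qed.

(* A flag whose top space is cyclic as a K[t]-module is a translate of the base
   flag: the matrix L with columns C^j e_0 conjugates C to the standard shift. *)
Lemma cyclic_flag D C (b : 'I_2 -> 'cV[K]_n) : strict_lower C ->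
    (forall i j : 'I_n, i = j.+1 :> nat -> C i j != 0) ->
    b 0 0 0 != 0 \/ b 1 0 0 != 0 ->
  exists c (g : 'M[A]_2), [/\ c != 0, \det g = 1 &
    omega D C b = c *: omega D J (group_act J g base_vec)].
Proof.
move=> Clow Csub b0; pose L : 'M[K]_n := \matrix_(i, j) (C ^+ j) i 0.
have Llow (i k : 'I_n) : (i < k)%N -> L i k = 0.
  by move=> ik; rewrite mxE strict_lowerX.
have CL : C *m L = L *m J.
  apply/matrixP=> i j; have -> : (C *m L) i j = (C ^+ j.+1) i 0.
    by rewrite exprS !mxE; apply: eq_bigr => k _; rewrite mxE.
  rewrite mxE; have [lt|ge] := ltnP j.+1 n.
    rewrite (bigD1 (Ordinal lt)) //= !mxE eqxx mulr1 big1 ?addr0 // => k.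
    by rewrite -val_eqE /= !mxE => /negPf->; rewrite mulr0.
  rewrite strict_lower_nil // mxE big1 // => k _; rewrite !mxE.
  by case: eqP => [kE|]; rewrite ?mulr0 //; have := ltn_ord k; lia.
have Ldiag i : L i i != 0.
  rewrite mxE; case: i => m; elim: m => [|m IH] lt; first by rewrite expr0 mxE oner_eq0.
  pose m0 := Ordinal (ltnW lt).
  rewrite exprS mxE (bigD1 m0) //= big1 ?addr0 => [|k km].
    by rewrite mulf_neq0 ?Csub ?IH.
  have [le|gt] := leqP m.+1 k; first by rewrite Clow ?mul0r.
  rewrite strict_lowerX ?mulr0 // add0n ltn_neqAle -ltnS gt andbT.
  by move: km; rewrite -val_eqE.
have Lunit : L \in unitmx.
  rewrite unitmxE det_trig ?unitfE; first by apply/prodf_neq0 => i _.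
  exact/is_trig_mxP.
have CLX k : C ^+ k *m L = L *m J ^+ k.
  elim: k => [|k IH]; first by rewrite !expr0 mul1mx mulmx1.
  rewrite exprSr -[_ * C]/(_ *m C) -mulmxA CL mulmxA IH -mulmxA.
  by rewrite exprSr.
pose b1 e := invmx L *m b e.
have bE e : b e = L *m b1 e by rewrite mulKVmx.
have b1_0 e : b e 0 0 = b1 e 0 0.
  rewrite bE mxE (bigD1 0) //= mxE expr0 mxE mul1r big1 ?addr0 // => k k0.
  by rewrite Llow ?mul0r // lt0n; move: k0; rewrite -val_eqE.
have [|g dg gE] := @group_transitive b1; first by rewrite -!b1_0.
exists (\prod_(d in D) \prod_(i < d.+1) L (inord i) (inord i)), g; split=> //.
  by apply/prodf_neq0 => d _; apply/prodf_neq0 => i _.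
rewrite gE; apply: plucker_lower => // i [e l].
by rewrite /flag /= bE mulmxA CLX -mulmxA mxE.
Qed.

(** As [C] is strictly lower triangular, the first vector has coordinates at l = 0 only. If these
    vanish, every minor has a zero top row. *)
Lemma omega_bottom (D : {set 'I_n}) C (b : 'I_2 -> 'cV[K]_n) : (0 < #|D|)%N -> strict_lower C ->
  omega D C b != 0 -> b 0 0 0 != 0 \/ b 1 0 0 != 0.
Proof.
move=> /card_gt0P[d dD] Clow nz.
have [b0|b0] := eqVneq (b 0 0 0) 0; last by left.
have [b1|b1] := eqVneq (b 1 0 0) 0; last by right.
case/eqP: nz; apply/ffunP => r; rewrite !ffunE (bigD1 d) //=.
rewrite (expand_det_row _ ord0) big1 ?mul0r // => k _; rewrite mxE.
have -> : inord (ord0 : 'I_d.+1) = 0 :> 'I_n by apply: val_inj; rewrite /= inordK.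
have be e : b e 0 0 = 0 by case: e => -[|[|//]] ?; [rewrite -[RHS]b0|rewrite -[RHS]b1];
  congr (b _ _ _); apply: val_inj.
rewrite /flag mxE big1 ?mul0r // => j _.
have [->|j0] := eqVneq j 0; first by rewrite be mulr0.
by rewrite strict_lowerX ?mul0r // ltn_addr // lt0n; move: j0; rewrite -val_eqE.
Qed.

(** Nonvanishing at all levels encodes the linear independence of the n vectors. *)
Definition full_flag C (b : 'I_2 -> 'cV[K]_n) := omega [set: 'I_n] C b != 0.

Lemma full_flag_bottom C b : strict_lower C -> full_flag C b ->
  b 0 0 0 != 0 \/ b 1 0 0 != 0.
Proof. by move=> Clow; apply: omega_bottom; rewrite ?cardsT ?card_ord. Qed.

Lemma full_flag_omega D C b : full_flag C b -> omega D C b != 0.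
Proof.
apply: contraNneq => /ffunP Y0; apply/eqP/ffunP => r; have := Y0 r.
rewrite !ffunE => /eqP; rewrite prodf_seq_eq0 => /hasP[d _ /andP[_ /eqP d0]].
by rewrite (bigD1 d) ?inE //= d0 mul0r.
Qed.

Definition deform C s : 'M[K]_n := C + s *: J.

Lemma deform_lower C s : strict_lower C -> strict_lower (deform C s).
Proof. by move=> Clow i j ij; rewrite mxE Clow // mxE strict_lower_shift // mulr0 addr0. Qed.

Lemma polyfun_deform C k i j : polyfun (fun s => (deform C s ^+ k) i j).
Proof.
elim: k i j => [|k IH] i j.
  have [p pE] := polyfun_cst ((1 : 'M[K]_n) i j).
  by exists p => s; rewrite expr0; apply: (pE s).
have [p pE] : polyfun (fun s => \sum_l deform C s i l * (deform C s ^+ k) l j).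
  apply: polyfun_sum => l; apply: polyfunM => //.
  have [p pE] := polyfunD (polyfun_cst (C i l)) (polyfunM polyfun_id (polyfun_cst (J i l))).
  by exists p => s; rewrite -pE 2!mxE.
by exists p => s; rewrite exprS -pE mxE.
Qed.

Lemma polyfun_omega D C b r : polyfun (fun s => omega D (deform C s) b r).
Proof.
have [p pE] : polyfun (fun s => \prod_(d in D) \det (level_mx (fun=> flag (deform C s) b) r d)).
  apply: polyfun_prod => d; apply: polyfun_det => i k.
  have [p pE] : polyfun (fun s => \sum_l (deform C s ^+ (r (d, inord k)).2) (inord i) l *
      b (r (d, inord k)).1 l 0).
    apply: polyfun_sum => l; apply: polyfunM; last exact: polyfun_cst.
    exact: polyfun_deform.
  by exists p => s; rewrite -pE mxE /flag mxE.
by exists p => s; rewrite -pE ffunE.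
Qed.

Variables (a : 'I_n -> nat) (z : 'I_n -> K) (D : {set 'I_n}).
Hypothesis z_inj : injective z.
Hypothesis aD : forall i, a i = (\sum_(d in D) ((rev_ord i : 'I_n) <= d)%N).+1.
Variable M : fusion_product a z.
Local Notation phi := (fp_lfun D M).

(** Away from these s the subdiagonal entries of [deform C s] are nonzero, as a cyclic flag
    requires. *)
Definition bad_values C : seq K :=
  [seq - C p.1 p.2 | p <- enum {: 'I_n * 'I_n}].

Lemma deform_orbit C (b : 'I_2 -> 'cV[K]_n) s : strict_lower C -> b 0 0 0 != 0 \/ b 1 0 0 != 0 ->
  s \notin bad_values C ->
  exists y : M, phi y = omega D (deform C s) b /\ exists2 L, SL2_orbit M L & y \in L.
Proof.
move=> Clow b0 sbad; have := @cyclic_flag D (deform C s) b.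
case=> [|i j ij|//|c [g [c0 dg E]]]; first exact: deform_lower.
  rewrite 3!mxE [shift_mx _ _]mxE ij eqxx mulr1.
  apply: contraNneq sbad => /eqP; rewrite addrC addr_eq0 => /eqP ->.
  by apply/mapP; exists (i, j); rewrite ?mem_enum.
have [S gS] := SL2_acts_total M dg.
exists (c *: S (fp_vec M)); split.
  have vE : phi (fp_vec M) = 1 *: omega D J base_vec.
    by rewrite scale1r (fp_lfun_vec z_inj aD).
  by rewrite linearZ E /= (fp_lfun_SL2_acts z_inj aD gS shift_tr_nil vE) scale1r.
exists (S @: <[fp_vec M]>)%VS; first by exists g, S.
by rewrite memvZ // memv_img // memv_line.
Qed.

(** The operator [psi] vanishes on the image of [phi], hence on the deformed flags for almost all s.
    Its coordinates there are polynomial in s, so it also vanishes at s = 0. *)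
Lemma omega_in_limg C (b : 'I_2 -> 'cV[K]_n) : strict_lower C -> b 0 0 0 != 0 \/ b 1 0 0 != 0 ->
  phi ((phi^-1)%VF (omega D C b)) = omega D C b.
Proof.
move=> Clow b0; have phiK := lker0_lfunK (fp_injective z_inj aD M).
pose psi : 'End(T) := (\1 - (phi \o phi^-1))%VF.
have C0 : C = deform C 0 by rewrite /deform scale0r addr0.
suff psi0 : forall s, psi (omega D (deform C s) b) = 0.
  have /eqP := psi0 0; rewrite -C0 /psi add_lfunE opp_lfunE id_lfunE comp_lfunE subr_eq0.
  by move/eqP => <-.
move=> s; apply/ffunP => r; rewrite [RHS]ffunE.
have coordL : linear (fun Y : T => (psi Y : T) r : K^o).
  by move=> c Y Z; rewrite linearP !ffunE.
pose g : {linear T -> K^o} := HB.pack (fun Y : T => (psi Y : T) r : K^o)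
  (GRing.isLinear.Build K T K^o _ _ coordL).
apply: (@polyfun_eq0 _ (fun s => g (omega D (deform C s) b)) (bad_values C)).
  by apply: polyfun_linear => r'; apply: polyfun_omega.
move=> {}s sbad; have [y [yE _]] := deform_orbit Clow b0 sbad.
by rewrite /= /psi -yE add_lfunE opp_lfunE id_lfunE comp_lfunE phiK subrr ffunE.
Qed.

(** A form that vanishes on the orbit vanishes along the curve of deformed flags for almost all s,
    hence at s = 0. *)
Lemma flag_in_schubert C (b : 'I_2 -> 'cV[K]_n) y :
  strict_lower C -> b 0 0 0 != 0 \/ b 1 0 0 != 0 ->
  y != 0 -> phi y = omega D C b -> schubert M <[y]>%VS.
Proof.
move=> Clow b0 y0 yE; split=> [|d p _ pvan u /vlineP[k ->]]; first by rewrite dim_vline y0.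
have phiK := lker0_lfunK (fp_injective z_inj aD M).
have C0 : C = deform C 0 by rewrite /deform scale0r addr0.
have -> : y = (phi^-1)%VF (omega D (deform C 0) b) by rewrite -C0 -yE phiK.
apply: (@polyfun_eq0 _ (fun s => poly_eval p (k *: (phi^-1)%VF (omega D (deform C s) b)))
  (bad_values C)).
  apply: polyfun_meval => i.
  have coordL : linear (fun Y : T => coord (vbasis {:M}) i (k *: (phi^-1)%VF Y) : K^o).
    by move=> c Y Z; rewrite linearP scalerDr linearD /= scalerA mulrC -scalerA linearZ.
  pose g : {linear T -> K^o} :=
    HB.pack (fun Y : T => coord (vbasis {:M}) i (k *: (phi^-1)%VF Y) : K^o)
    (GRing.isLinear.Build K T K^o _ _ coordL).
  by apply: (@polyfun_linear _ _ _ g) => r; apply: polyfun_omega.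
move=> s sbad; have [y' [y'E [L LO yL]]] := deform_orbit Clow b0 sbad.
by rewrite -y'E phiK; apply: (pvan L) => //; apply: memvZ.
Qed.

End OrbitClosure.

(** * Equations of the closure *)

Section Forms.
Context {K : fieldType} {M : vectType K}.
Implicit Types (f g : M -> K).

Definition is_form d f := exists p : poly_on M, p \is d.-homog /\ forall u, poly_eval p u = f u.

Lemma is_form_linear (g : {linear M -> K^o}) : is_form 1 g.
Proof.
exists (\sum_(i < \dim {:M}) g (vbasis {:M})`_i *: 'X_i); split.
  by apply: rpred_sum => i _; apply: dhomogZ; rewrite dhomogX /= mdeg1.
move=> u; rewrite /poly_eval [meval _ _](linear_sum (meval _)) /=.
rewrite {2}(coord_vbasis (memvf u)) linear_sum; apply: eq_bigr => i _.
by rewrite mevalZ mevalXU linearZ /= mulrC.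
Qed.

Lemma is_form1 : is_form 0 (fun=> 1).
Proof. by exists 1; split=> [|u]; rewrite ?dhomog1 // /poly_eval meval1. Qed.

Lemma is_formD d f g : is_form d f -> is_form d g -> is_form d (fun u => f u + g u).
Proof.
move=> [p [ph pE]] [q [qh qE]]; exists (p + q); split=> [|u]; first exact: rpredD.
by rewrite -pE -qE /poly_eval mevalD.
Qed.

Lemma is_formZ d c f : is_form d f -> is_form d (fun u => c * f u).
Proof.
move=> [p [ph pE]]; exists (c *: p); split=> [|u]; first exact: dhomogZ.
by rewrite -pE /poly_eval mevalZ.
Qed.

Lemma is_formM d e f g : is_form d f -> is_form e g -> is_form (d + e) (fun u => f u * g u).
Proof.
move=> [p [ph pE]] [q [qh qE]]; exists (p * q); split=> [|u]; first exact: dhomogM.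
by rewrite -pE -qE /poly_eval mevalM.
Qed.

Lemma is_formX d f k : is_form d f -> is_form (d * k) (fun u => f u ^+ k).
Proof.
move=> [p [ph pE]]; exists (p ^+ k); split=> [|u]; first exact: dhomogMn.
by rewrite -pE /poly_eval rmorphXn.
Qed.

Lemma is_form_sum d (I : Type) (l : seq I) (P : pred I) (f : I -> M -> K) :
  (forall i, is_form d (f i)) -> is_form d (fun u => \sum_(i <- l | P i) f i u).
Proof.
move=> /choice[p pP]; exists (\sum_(i <- l | P i) p i); split=> [|u].
  by apply: rpred_sum => i _; have [] := pP i.
rewrite /poly_eval [meval _ _](linear_sum (meval _)) /=; apply: eq_bigr => i _.
by have [_ <-] := pP i.
Qed.

Lemma is_form_prod (I : Type) (l : seq I) (P : pred I) (d : I -> nat) (f : I -> M -> K) :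
  (forall i, is_form (d i) (f i)) ->
  is_form (\sum_(i <- l | P i) d i) (fun u => \prod_(i <- l | P i) f i u).
Proof.
move=> fP; elim: l => [|i l [p [ph pE]]].
  have [p [ph pE]] := is_form1; rewrite big_nil; exists p; split=> // u.
  by rewrite pE big_nil.
have [q [qh qE]] := fP i; rewrite big_cons; case Pi: (P i); last first.
  by exists p; split=> // u; rewrite pE big_cons Pi.
exists (q * p); split=> [|u]; first exact: dhomogM.
by rewrite big_cons Pi -qE -pE /poly_eval mevalM.
Qed.

Lemma is_form_det m (A : M -> 'M[K]_m) :
  (forall i j, is_form 1 (fun u => A u i j)) -> is_form m (fun u => \det (A u)).
Proof.
move=> Af; apply: is_form_sum => s; apply: is_formZ.
have := is_form_prod (index_enum 'I_m) xpredT (fun i => Af i (s i)).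
by rewrite sum1_card card_ord.
Qed.

Lemma is_form_closure d f (S : proj_set M) : is_form d f ->
  (forall L u, S L -> u \in L -> f u = 0) ->
  forall L u, zariski_closure S L -> u \in L -> f u = 0.
Proof.
move=> [p [ph pE]] f0 L u [_ /(_ d p ph) clS] uL; rewrite -pE; apply: clS => //.
by move=> L' SL' v vL'; rewrite pE; apply: f0 vL'.
Qed.

End Forms.

Section PluckerEquations.
Context {K : numFieldType} {n' : nat}.
Local Notation n := n'.+1.
Local Notation basis := ('I_2 * 'I_n)%type.
Local Notation slot := ('I_n * 'I_n)%type.
Local Notation place := (@place slot basis).
Local Notation T := (@tensors K slot basis).
Implicit Types (D : {set 'I_n}) (u : 'I_n -> basis -> K) (r : place) (Y : T).

(** By Cramer's rule, the neighbours of a nonzero coordinate contain the basis of U_d normalised to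
    be the identity on the columns chosen by [r]. *)
Lemma plucker_upd D u c r (d : 'I_n) (i : 'I_d.+1) b : d \in D ->
    (c *: plucker D (fun=> u)) r != 0 ->
  (c *: plucker D (fun=> u)) (upd r (d, inord i) b) =
  (c *: plucker D (fun=> u)) r *
    (invmx (level_mx (fun=> u) r d) *m \col_k u (inord k) b) i 0.
Proof.
move=> dD; rewrite !ffunE /GRing.scale /= => nz.
have dnz : \det (level_mx (fun=> u) r d) != 0.
  by move: nz; rewrite mulf_eq0 negb_or => /andP[_ /prodf_neq0]; apply.
rewrite -mulrA; congr (_ * _); rewrite (bigD1 d) //= [in RHS](bigD1 d) //=.
rewrite [in RHS]mulrAC; congr (_ * _); last first.
  apply: eq_bigr => d' /andP[_ dd]; congr (\det _).
  by rewrite level_mx_upd // (negPf dd).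
have -> : level_mx (fun=> u) (upd r (d, inord i) b) d =
    set_col (level_mx (fun=> u) r d) i (fun k => u (inord k) b).
  apply/matrixP=> p q; rewrite !mxE; case: eqP => [->|ne]; first by rewrite upd_same.
  rewrite upd_other //; apply/eqP => -[] /(congr1 val) /=; rewrite !inord_level => E.
  by apply: ne; apply: val_inj.
rewrite det_set_col_adj /invmx unitmxE unitfE dnz -scalemxAl [in RHS]mxE [RHS]mulrA.
by rewrite divff // mul1r.
Qed.

(* Cramer's rule: the coordinates near r determine all the others. *)
Lemma plucker_cramer D u c r r' : (0 < #|D|)%N ->
  let Y := c *: plucker D (fun=> u) in
  Y r ^+ (\sum_(d in D) d.+1) * Y r' =
  Y r * \prod_(d in D) \det (\matrix_(i < d.+1, k < d.+1)
    Y (upd r (d, inord i) (r' (d, inord k)))).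
Proof.
move=> D0 Y; have [Y0|nz] := eqVneq (Y r) 0.
  (* Both sides vanish when [Y r] does: [D] is nonempty, so the exponent is positive. *)
  rewrite Y0 mul0r; have [d dD] := card_gt0P D0.
  by rewrite (bigD1 d) //= addSn expr0n mul0r.
have dnz d : d \in D -> \det (level_mx (fun=> u) r d) != 0.
  move=> dD; move: nz; rewrite /Y ffunE mulf_eq0 negb_or ffunE => /andP[_ /prodf_neq0].
  exact.
transitivity (Y r * \prod_(d in D) (Y r ^+ d.+1 *
    ((\det (level_mx (fun=> u) r d))^-1 * \det (level_mx (fun=> u) r' d)))); last first.
  congr (_ * _); apply: eq_bigr => d dD.
  have -> : \matrix_(i < d.+1, k < d.+1) Y (upd r (d, inord i) (r' (d, inord k))) =
      Y r *: (invmx (level_mx (fun=> u) r d) *m level_mx (fun=> u) r' d).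
    apply/matrixP=> i k; rewrite !mxE plucker_upd // mxE; congr (_ * _).
    by apply: eq_bigr => l _; rewrite !mxE.
  by rewrite detZ det_mulmx det_inv.
rewrite big_split -expr_sum /= mulrCA; congr (_ * _); rewrite big_split prodfV /=.
rewrite /Y !ffunE /GRing.scale /= -[RHS]mulrA; congr (_ * _).
by rewrite mulrA mulfV ?mul1r //; apply/prodf_neq0 => d /dnz.
Qed.

Definition lower_op (P : 'M[K]_n) Y r (d i : 'I_n) (b : basis) : K :=
  \sum_l P b.2 l * Y (upd r (d, i) (b.1, l)).

(* P maps the d-th space into the d'-th one: nestedness for P = 1,
   stability under t for P = shift_mx. *)
Lemma plucker_incidence D u c r (d d' : 'I_n) (P G : 'M[K]_n) (i : 'I_d.+1) b :
    d \in D -> d' \in D -> (d <= d')%N ->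
    (forall (k : 'I_n) b, \sum_l P b.2 l * u k (b.1, l) = \sum_j G k j * u j b) ->
    (forall k j : 'I_n, (k < j)%N -> G k j = 0) ->
  let Y := c *: plucker D (fun=> u) in
  Y r * (Y r * lower_op P Y r d (inord i) b -
    \sum_(k < d'.+1) lower_op P Y r d (inord i) (r (d', inord k)) *
      Y (upd r (d', inord k) b)) = 0.
Proof.
move=> dD d'D dd' PG Glow Y; have [->|nz] := eqVneq (Y r) 0; first by rewrite mul0r.
apply/eqP; rewrite mulf_eq0 (negPf nz) /= subr_eq0; apply/eqP.
pose Th : 'M[K]_(d.+1, d'.+1) := invmx (level_mx (fun=> u) r d) *m
  \matrix_(k, j) G (inord k) (inord j).
have lowE b' : lower_op P Y r d (inord i) b' = Y r * (Th *m \col_j u (inord j) b') i 0.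
  rewrite /lower_op; under eq_bigr => l _ do rewrite plucker_upd // mulrCA.
  rewrite -mulr_sumr -/Y; congr (_ * _); rewrite -mulmxA [in RHS]mxE.
  under eq_bigr => l _ do rewrite mxE mulr_sumr.
  rewrite exchange_big; apply: eq_bigr => k _.
  transitivity (invmx (level_mx (fun=> u) r d) i k * \sum_l P b'.2 l * u (inord k) (b'.1, l)).
    by rewrite mulr_sumr; apply: eq_bigr => l _; rewrite mxE mulrCA.
  congr (_ * _); rewrite PG mxE.
  under [RHS]eq_bigr do rewrite !mxE.
  rewrite (sum_inord d' (fun j => G (inord k) j * u j b')) [RHS]big_mkcond.
  apply: eq_bigr => j _; case: leqP => // ltj.
  rewrite Glow ?mul0r // inord_level; apply: leq_ltn_trans ltj.
  by apply: leq_trans dd'; rewrite -ltnS.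
rewrite lowE.
transitivity (Y r * (Y r * \sum_k (Th *m level_mx (fun=> u) r d') i k *
    (invmx (level_mx (fun=> u) r d') *m \col_j u (inord j) b) k 0)).
  congr (_ * (_ * _)); transitivity ((Th *m level_mx (fun=> u) r d' *m
      (invmx (level_mx (fun=> u) r d') *m \col_j u (inord j) b)) i 0); last by rewrite mxE.
  rewrite -mulmxA mulKVmx // unitmxE unitfE.
  move: nz; rewrite /Y ffunE mulf_eq0 negb_or ffunE => /andP[_ /prodf_neq0]; exact.
rewrite !mulr_sumr; apply: eq_bigr => k _; rewrite lowE plucker_upd // -/Y.
have -> : (Th *m level_mx (fun=> u) r d') i k =
    (Th *m \col_j u (inord j) (r (d', inord k))) i 0.
  by rewrite !mxE; apply: eq_bigr => l _; rewrite !mxE.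
by rewrite mulrACA -mulrA.
Qed.

End PluckerEquations.

(** * From the equations back to a complete flag *)

Section AdaptedBasis.
Context {K : fieldType} {W : vectType K} (N : 'End(W)).
Hypothesis N_nil : forall x, exists k, iter k N x = 0.

(** Starting from a vector of U outside V, apply [N] until the last iterate before entering V. *)
Lemma nilpotent_step (U V : {vspace W}) : (N @: U <= U)%VS -> ~~ (U <= V)%VS ->
  exists x, [/\ x \in U, x \notin V & N x \in V].
Proof.
move=> NU /subvPn[x xU xV]; have [k xk] := N_nil x.
have exV : exists k, iter k N x \in V by exists k; rewrite xk mem0v.
case: (ex_minnP exV) => -[|m] mV mmin; first by rewrite mV in xV.
exists (iter m N x); split=> //; last by apply/negP => /mmin; rewrite ltnn.
elim: m {mV mmin} => //= m IH; exact/(subvP NU)/memv_img.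
Qed.

Lemma adapted_basis n' (U : 'I_n'.+1 -> {vspace W}) (D : {set 'I_n'.+1}) :
    ord_max \in D -> (forall d, d \in D -> \dim (U d) = d.+1) ->
    (forall d d' : 'I_n'.+1, d \in D -> d' \in D -> (d <= d')%N -> (U d <= U d')%VS) ->
    (forall d, d \in D -> (N @: U d <= U d)%VS) ->
  exists X : seq W, [/\ size X = n'.+1, free X,
    forall j, (j < n'.+1)%N -> N X`_j \in <<take j X>>%VS
    & forall d, d \in D -> U d = <<take d.+1 X>>%VS].
Proof.
move=> topD dimU Unest Ustab.
suff: forall k, (k <= n'.+1)%N -> exists X : seq W, [/\ size X = k, free X,
    forall j, (j < k)%N -> N X`_j \in <<take j X>>%VS,
    forall d : 'I_n'.+1, d \in D -> (d < k)%N -> U d = <<take d.+1 X>>%VS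
    & forall d : 'I_n'.+1, d \in D -> (k <= d)%N -> (<<X>> <= U d)%VS].
  by case/(_ n'.+1 (leqnn _)) => X [sX fX NX UX _]; exists X; split=> // d dD; apply: UX.
elim=> [_|k IH lt].
  exists [::]; split=> //; first exact: nil_free.
  by move=> d _ _; rewrite span_nil sub0v.
have [X [sX fX NX UX XU]] := IH (ltnW lt).
(* The next vector is taken in the smallest prescribed space not yet filled; by nestedness it lies
   in all the larger ones. *)
have [d0 /andP[d0D kd0] d0min] := @arg_minnP _ ord_max
  (fun d : 'I_n'.+1 => (d \in D) && (k <= d)%N) (@nat_of_ord _) (introT andP (conj topD lt)).
have [x [xU xX Nx]] : exists x, [/\ x \in U d0, x \notin <<X>>%VS & N x \in <<X>>%VS].
  apply: nilpotent_step; first exact: Ustab.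
  apply/negP => /dimvS; rewrite dimU //.
  by move/leq_trans/(_ (dim_span X)); rewrite sX ltnNge kd0.
have free' : free (rcons X x).
  by rewrite (perm_free (permEl (perm_rcons x X))) free_cons xX.
have sub d : d \in D -> (k <= d)%N -> (<<rcons X x>> <= U d)%VS.
  move=> dD kd; apply/span_subvP => y; rewrite mem_rcons inE => /predU1P[->|yX].
    by apply: (subvP _ _ xU); apply: Unest => //; apply: d0min; rewrite dD.
  by apply: (subvP (XU d dD kd)); apply: memv_span.
exists (rcons X x); split=> //; first by rewrite size_rcons sX.
- move=> j; rewrite ltnS leq_eqVlt => /predU1P[->|jk]; rewrite nth_rcons sX.
    by rewrite ltnn eqxx -cats1 -sX take_size_cat.
  by rewrite jk -cats1 takel_cat ?sX 1?ltnW // NX.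
- move=> d dD; rewrite ltnS leq_eqVlt => /predU1P[dk|dk]; last first.
    by rewrite -cats1 takel_cat ?sX // UX.
  rewrite take_oversize ?size_rcons ?sX ?dk //; apply/esym/eqP; rewrite eqEdim.
  by rewrite sub ?dk //= dimU // (eqP free') size_rcons sX dk.
- by move=> d dD kd; apply: sub => //; apply: ltnW.
Qed.

End AdaptedBasis.

Lemma minor_of_free {K : fieldType} {I : finType} (X : seq {ffun I -> K^o}) m :
  size X = m -> free X ->
  exists r : 'I_m -> I, \det (\matrix_(i, k) X`_i (r k)) != 0.
Proof.
move=> sX fX; pose A : 'M[K]_(#|I|, m) := \matrix_(p, k) X`_k (enum_val p).
have rkA : row_full A.
  rewrite /row_full -mxrank_tr; apply: inj_row_free => v vA.
  have /eqP sX' := sX; have /freeP fX' : free (Tuple sX') by [].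
  apply/rowP => k; rewrite mxE; apply: (fX' (v 0)).
  apply/ffunP => i; rewrite sum_ffunE ffunE.
  have /matrixP/(_ 0 (enum_rank i)) := vA; rewrite [LHS]mxE [RHS]mxE => E; rewrite -[RHS]E.
  by apply: eq_bigr => j _; rewrite ffunE [A^T _ _]mxE [A _ _]mxE enum_rankK.
exists (fun k => enum_val (fullrankfun rkA k)).
have := fullrowsub_unit rkA; rewrite unitmxE unitfE -det_tr; congr (\det _ != 0).
by apply/matrixP=> i k; rewrite !mxE.
Qed.

Section SchubertFlags.
Context {K : numFieldType} {n' : nat}.
Local Notation n := n'.+1.
Local Notation basis := ('I_2 * 'I_n)%type.
Local Notation slot := ('I_n * 'I_n)%type.
Local Notation place := (@place slot basis).
Local Notation T := (@tensors K slot basis).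
Local Notation W := {ffun basis -> K^o}.
Local Notation J := (@shift_mx K n')^T.

Definition shift_vec (x : W) : W := [ffun b : basis => \sum_l shift_mx b.2 l * x (b.1, l)].

Lemma shift_vec_linear : linear shift_vec.
Proof.
move=> c x y; apply/ffunP=> b; rewrite !ffunE scaler_sumr -big_split.
by apply: eq_bigr => l _; rewrite !ffunE mulrDr; congr (_ + _); rewrite mulrCA.
Qed.
HB.instance Definition _ := GRing.isLinear.Build K W W _ shift_vec shift_vec_linear.

Lemma shift_vec_next x e (l : 'I_n) (lt : (l.+1 < n)%N) :
  shift_vec x (e, l) = x (e, Ordinal lt).
Proof.
rewrite ffunE (bigD1 (Ordinal lt)) //= mxE eqxx mul1r big1 ?addr0 // => k.
by rewrite -val_eqE /= mxE => /negPf->; rewrite mul0r.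
Qed.

Lemma shift_vec_nil x : iter n (linfun shift_vec) x = 0.
Proof.
have E k : iter k (linfun shift_vec) x =
    [ffun b : basis => \sum_l (shift_mx ^+ k) b.2 l * x (b.1, l)].
  elim: k => [|k IH].
    apply/ffunP => -[e l]; rewrite ffunE (bigD1 l) //= expr0 mxE eqxx mul1r big1 ?addr0 // => j.
    by rewrite mxE eq_sym => /negPf ->; rewrite mul0r.
  rewrite iterS IH lfunE; apply/ffunP => b; rewrite !ffunE exprS.
  under eq_bigr do rewrite ffunE mulr_sumr; rewrite exchange_big.
  apply: eq_bigr => j _; rewrite mxE mulr_suml; apply: eq_bigr => l _.
  by rewrite mulrA.
rewrite E shift_mx_nil; apply/ffunP => b; rewrite !ffunE big1 // => l _.
by rewrite mxE mul0r.
Qed.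

Lemma memv_span_take (X : seq W) (k : nat) y : (k <= size X)%N -> y \in <<take k X>>%VS ->
  exists c : 'I_n -> K, (k <= n)%N -> y = \sum_(j : 'I_n | (j < k)%N) c j *: X`_j.
Proof.
move=> le; have sT : size (take k X) == k by rewrite size_takel.
move=> /(@coord_span _ _ _ (Tuple sT)) /= yE.
exists (fun j => if insub (j : nat) is Some i then coord (Tuple sT) i y else 0) => kn.
rewrite {1}yE (big_ord_narrow kn) /=; apply: eq_bigr => j _.
by rewrite /= valK nth_take.
Qed.

(** The coordinate at l is the coordinate at 0 after l applications of t, so the matrix [C] of t and
    the coordinates at 0 recover the basis. *)
Lemma flag_of_basis (X : seq W) : size X = n -> free X ->
    (forall j, (j < n)%N -> linfun shift_vec X`_j \in <<take j X>>%VS) ->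
  exists (C : 'M[K]_n) (b : 'I_2 -> 'cV[K]_n), [/\ strict_lower C, full_flag C b
    & forall i (c : basis), flag C b i c = X`_i c].
Proof.
move=> sX fX NX.
have /choice[G GE] (i : 'I_n) : exists c : 'I_n -> K,
    linfun shift_vec X`_i = \sum_(j : 'I_n | (j < i)%N) c j *: X`_j.
  have [||c cE] := @memv_span_take X i (linfun shift_vec X`_i).
  - by rewrite sX ltnW.
  - exact: NX.
  by exists c; apply: cE; apply: ltnW.
pose C : 'M[K]_n := \matrix_(i, j) if (j < i)%N then G i j else 0.
pose b (e : 'I_2) : 'cV[K]_n := \col_i (X`_i : W) (e, 0).
have flagE i (c : basis) : flag C b i c = (X`_i : W) c.
  case: c => e [l lt]; rewrite /flag /=; elim: l lt i => [|l IH] lt i.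
    by rewrite expr0 mul1mx mxE; congr (X`_i _); congr pair; apply: val_inj.
  have -> : C ^+ l.+1 *m b e = C *m (C ^+ l *m b e) by rewrite mulmxA exprS.
  rewrite mxE.
  rewrite -(shift_vec_next _ _ (l := Ordinal (ltnW lt)) lt) -[shift_vec _]lfunE GE.
  rewrite sum_ffunE [RHS]big_mkcond; apply: eq_bigr => j _; rewrite mxE (IH (ltnW lt)).
  case: ifP => _; first by rewrite [RHS]ffunE.
  exact: mul0r.
exists C, b; split=> //.
  by move=> i j ij; rewrite mxE ltnNge ij.
have /choice[R Rnz] (d : 'I_n) : exists r : 'I_n -> basis,
    \det (\matrix_(i < d.+1, k < d.+1) (X`_i : W) (r (inord k))) != 0.
  have [||r rnz] := @minor_of_free K _ (take d.+1 X) d.+1.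
  - by rewrite size_takel // sX.
  - by move: fX; rewrite -{1}(cat_take_drop d.+1 X) => /catl_free.
  exists (fun k => r (inord k)); apply: contraNneq rnz => <-; apply/eqP; congr (\det _).
  apply/matrixP=> i k; rewrite !mxE nth_take //; congr (_ (r _)).
  by apply: val_inj; rewrite /= inord_level inordK.
apply/eqP => /ffunP/(_ [ffun s : slot => R s.1 s.2]); rewrite !ffunE => /eqP; apply/negP.
apply/prodf_neq0 => d _; apply: contraNneq (Rnz d) => <-; apply/eqP; congr (\det _).
by apply/matrixP=> i k; rewrite !mxE flagE ffunE /= inord_level.
Qed.

Variables (a : 'I_n -> nat) (z : 'I_n -> K) (D : {set 'I_n}).
Hypothesis z_inj : injective z.
Hypothesis aD : forall i, a i = (\sum_(d in D) ((rev_ord i : 'I_n) <= d)%N).+1.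
Hypothesis topD : ord_max \in D.
Variable M : fusion_product a z.
Local Notation phi := (fp_lfun D M).

Lemma orbit_omega L y : SL2_orbit M L -> y \in L ->
  exists c (b : 'I_2 -> 'cV[K]_n), phi y = c *: omega D J b.
Proof.
move=> [g [S [dg gS ->]]] /memv_imgP[v /vlineP[c ->] ->].
exists c, (group_act J g base_vec).
have vE : phi (fp_vec M) = 1 *: omega D J base_vec.
  by rewrite scale1r (fp_lfun_vec z_inj aD).
by rewrite !linearZ /= (fp_lfun_SL2_acts z_inj aD gS shift_tr_nil vE) scale1r.
Qed.

Definition coordinate (r : place) (y : M) : K := (phi y : T) r.

Lemma coordinate_linear r : linear (coordinate r : M -> K^o).
Proof. by move=> c x y; rewrite /coordinate linearP !ffunE. Qed.

Lemma is_form_coordinate r : is_form 1 (coordinate r).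
Proof.
pose g : {linear M -> K^o} := HB.pack (coordinate r : M -> K^o)
  (GRing.isLinear.Build K M K^o _ _ (coordinate_linear r)).
exact: (is_form_linear g).
Qed.

Lemma schubert_cramer L y r r' : schubert M L -> y \in L ->
  (phi y : T) r ^+ (\sum_(d in D) d.+1) * (phi y : T) r' =
  (phi y : T) r * \prod_(d in D) \det (\matrix_(i < d.+1, k < d.+1)
    (phi y : T) (upd r (d, inord i) (r' (d, inord k)))).
Proof.
move=> SL yL; apply/eqP; rewrite -subr_eq0; apply/eqP.
set s := (\sum_(d in D) _)%N.
pose f u := coordinate r u ^+ s * coordinate r' u + -1 * (coordinate r u *
  \prod_(d in D) \det (\matrix_(i < d.+1, k < d.+1)
    coordinate (upd r (d, inord i) (r' (d, inord k))) u)).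
have ff : is_form (s + 1) f.
  have h1 := is_formX s (is_form_coordinate r); rewrite mul1n in h1.
  have h2 : is_form s (fun u => \prod_(d in D) \det (\matrix_(i < d.+1, k < d.+1)
      coordinate (upd r (d, inord i) (r' (d, inord k))) u)).
    apply: is_form_prod => d; apply: is_form_det => i k.
    have [p [ph pE]] := is_form_coordinate (upd r (d, inord i) (r' (d, inord k))).
    by exists p; split=> // u; rewrite mxE pE.
  have h3 := is_formM (is_form_coordinate r) h2; rewrite addnC in h3.
  exact: is_formD (is_formM h1 (is_form_coordinate r')) (is_formZ (-1) h3).
have := is_form_closure ff _ SL yL; rewrite /f mulN1r; apply=> L' u LO uL.
have [c [b uE]] := orbit_omega LO uL; rewrite mulN1r; apply/eqP; rewrite subr_eq0; apply/eqP.
rewrite /coordinate uE plucker_cramer //.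
by apply/card_gt0P; exists ord_max.
Qed.

Lemma schubert_incidence L y r (d d' : 'I_n) (P : 'M[K]_n) (i : 'I_d.+1) b :
    d \in D -> d' \in D -> (d <= d')%N -> P = 1%:M \/ P = shift_mx ->
    schubert M L -> y \in L -> (phi y : T) r != 0 ->
  (phi y : T) r * lower_op P (phi y) r d (inord i) b =
  \sum_(k < d'.+1) lower_op P (phi y) r d (inord i) (r (d', inord k)) *
    (phi y : T) (upd r (d', inord k) b).
Proof.
move=> dD d'D dd' PE SL yL nz; apply/eqP; rewrite -subr_eq0; apply/eqP; apply: (mulfI nz).
rewrite mulr0.
pose low c u := \sum_l P c.2 l * coordinate (upd r (d, inord i) (c.1, l)) u.
pose f u := coordinate r u * (coordinate r u * low b u + -1 *
  \sum_(k < d'.+1) low (r (d', inord k)) u * coordinate (upd r (d', inord k) b) u).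
have lowf c : is_form 1 (low c).
  apply: (is_form_sum (index_enum 'I_n) xpredT) => l.
  exact: (is_formZ _ (is_form_coordinate (upd r (d, inord i) (c.1, l)))).
have ff : is_form (1 + (1 + 1)) f.
  have h1 := is_formM (is_form_coordinate r) (lowf b).
  have h2 : is_form (1 + 1) (fun u =>
      \sum_(k < d'.+1) low (r (d', inord k)) u * coordinate (upd r (d', inord k) b) u).
    apply: (is_form_sum (index_enum 'I_d'.+1) xpredT) => k.
    exact: is_formM (lowf _) (is_form_coordinate _).
  exact: is_formM (is_form_coordinate r) (is_formD h1 (is_formZ (-1) h2)).
have := is_form_closure ff _ SL yL; rewrite /f mulN1r; apply=> L' u LO uL.
have [c [b0 uE]] := orbit_omega LO uL; rewrite mulN1r /low /coordinate uE.
pose G : 'M[K]_n := if P == 1%:M then 1%:M else J.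
apply: (@plucker_incidence _ _ D (flag J b0) c r d d' P G) => // [k [e l]|k j kj] /=.
  rewrite /G; case: eqP => [->|P1].
    rewrite (bigD1 l) //= mxE eqxx mul1r big1 ?addr0 => [|j]; last first.
      by rewrite mxE eq_sym => /negPf->; rewrite mul0r.
    rewrite (bigD1 k) //= mxE eqxx mul1r big1 ?addr0 // => j.
    by rewrite mxE eq_sym => /negPf->; rewrite mul0r.
  case: PE => // ->.
  transitivity ((J *m (J ^+ l *m b0 e)) k 0); last first.
    by rewrite mxE; apply: eq_bigr.
  rewrite mulmxA -[J *m _]exprS; have [lt|ge] := ltnP l.+1 n; last first.
    rewrite strict_lower_nil ?mul0mx ?mxE //; last exact: strict_lower_shift.
    rewrite big1 // => j _; rewrite mxE; case: eqP => [E|]; last by rewrite mul0r.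
    by have := ltn_ord j; lia.
  rewrite (bigD1 (Ordinal lt)) //= mxE eqxx mul1r big1 ?addr0 // => j.
  by rewrite -val_eqE /= mxE => /negPf->; rewrite mul0r.
rewrite /G; case: ifP => _; first by rewrite mxE -val_eqE /= ltn_eqF.
by rewrite strict_lower_shift // ltnW.
Qed.

(** Near a nonzero coordinate the normalised bases [w d] are read off from [Y]. The Cramer equations
    make [Y] a multiple of the product of their minors, and the incidence equations make their spans
    nested and stable under t. *)
Lemma schubert_flag L y : schubert M L -> y \in L -> y != 0 ->
  exists (C : 'M[K]_n) (b : 'I_2 -> 'cV[K]_n) c,
    [/\ strict_lower C, full_flag C b & phi y = c *: omega D C b].
Proof.
move=> SL yL y0; pose Y : T := phi y.
have /existsP[r nz] : [exists r, Y r != 0].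
  apply: contraR y0 => /existsPn Y0; apply/eqP/(phi_inj z_inj aD); rewrite linear0.
  by apply/ffunP => r; rewrite ffunE; apply/eqP; have := Y0 r; rewrite negbK.
pose w (d : 'I_n) (i : nat) : W := [ffun b => Y (upd r (d, inord i) b) / Y r].
pose Wd (d : 'I_n) := [seq w d i | i <- iota 0 d.+1].
pose U (d : 'I_n) := <<Wd d>>%VS.
have sWd d : size (Wd d) = d.+1 by rewrite size_map size_iota.
have nthW (d : 'I_n) (i : 'I_d.+1) : (Wd d)`_i = w d i.
  by rewrite (nth_map 0%N) ?size_iota // nth_iota.
have memW (d : 'I_n) (i : 'I_d.+1) : w d i \in U d.
  by apply: memv_span; apply: map_f; rewrite mem_iota /=.
have inW (d : 'I_n) x : x \in Wd d -> exists i : 'I_d.+1, x = w d i.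
  move=> xW; have lt : (index x (Wd d) < d.+1)%N by rewrite -(sWd d) index_mem.
  by exists (Ordinal lt); rewrite -nthW nth_index.
have cramer r' : Y r' = Y r * \prod_(d in D) \det (\matrix_(i < d.+1, k < d.+1)
    w d i (r' (d, inord k))).
  apply: (mulfI (expf_neq0 (\sum_(d in D) d.+1) nz)).
  rewrite (schubert_cramer r r' SL yL) -/Y [RHS]mulrCA; congr (_ * _).
  rewrite expr_sum -big_split; apply: eq_bigr => d _; rewrite /= -detZ; congr (\det _).
  by apply/matrixP=> i k; rewrite !mxE ffunE mulrC divfK.
have incidence (d d' : 'I_n) P (i : 'I_d.+1) : d \in D -> d' \in D -> (d <= d')%N ->
    P = 1%:M \/ P = shift_mx ->
    [ffun b : basis => \sum_l P b.2 l * w d i (b.1, l)] \in U d'.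
  move=> dD d'D dd' PE.
  pose lw (b : basis) : K := \sum_l P b.2 l * w d i (b.1, l).
  have lowE b : lower_op P Y r d (inord i) b = Y r * lw b.
    rewrite /lower_op /lw mulr_sumr; apply: eq_bigr => l _.
    by rewrite ffunE mulrCA [Y r * _]mulrC divfK.
  have -> : [ffun b : basis => \sum_l P b.2 l * w d i (b.1, l)] =
      \sum_(k < d'.+1) lw (r (d', inord k)) *: w d' k.
    apply/ffunP => b; rewrite sum_ffunE ffunE -/(lw b).
    apply: (mulfI nz); apply: (mulfI nz); rewrite -[Y r * lw b]lowE.
    rewrite (schubert_incidence i b dD d'D dd' PE SL yL nz) -/Y !mulr_sumr.
    apply: eq_bigr => k _; rewrite lowE !ffunE /GRing.scale /=.
    by rewrite -!mulrA; congr (_ * _); rewrite mulrCA; congr (_ * _); rewrite mulrC divfK.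
  by apply: memv_suml => k _; apply: memvZ.
have freeW d : d \in D -> free (Wd d).
  move=> dD; have : \prod_(d in D) \det (\matrix_(i < d.+1, k < d.+1) w d i (r (d, inord k))) != 0.
    by apply: contraNneq nz => E; rewrite cramer E mulr0.
  move/prodf_neq0/(_ d dD) => dnz.
  have /eqP sW := sWd d; apply/(@freeP _ _ _ (Tuple sW)) => k k0 i.
  set A := (\matrix_(_, _) _) in dnz.
  have /rowP/(_ i) : \row_i k i = 0 :> 'rV[K]_d.+1.
    have Au : A \in unitmx by rewrite unitmxE unitfE.
    apply: (can_inj (mulmxK Au)); rewrite mul0mx; apply/rowP => j; rewrite !mxE.
    move/ffunP/(_ (r (d, inord j))): k0; rewrite sum_ffunE ffunE => k0; rewrite -[RHS]k0.
    by apply: eq_bigr => l _; rewrite mxE [A _ _]mxE [RHS]ffunE /= nthW.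
  by rewrite !mxE.
have [|||X [sX fX NX UX]] := @adapted_basis K W (linfun shift_vec)
  (fun x => ex_intro _ n (shift_vec_nil x)) n' U D topD.
- by move=> d dD; rewrite (eqP (freeW d dD)) sWd.
- move=> d d' dD d'D dd'; apply/span_subvP => _ /inW[i ->].
  have := incidence d d' 1%:M i dD d'D dd' (or_introl erefl).
  set v := (X in X \in _ -> _); suff -> : v = w d i by [].
  apply/ffunP => -[e l]; rewrite ffunE (bigD1 l) //= mxE eqxx mul1r.
  by rewrite big1 ?addr0 // => j; rewrite mxE eq_sym => /negPf ->; rewrite mul0r.
- move=> d dD; rewrite limg_span; apply/span_subvP => _ /mapP[_ /inW[i ->] ->].
  rewrite lfunE; exact: (incidence d d shift_mx i dD dD (leqnn d) (or_intror erefl)).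
have [C [b [Clow Cfull flagE]]] := flag_of_basis sX fX NX.
(* Each [w d] lies in the span of the first d + 1 vectors of the adapted basis, so its minors are a
   common determinant times theirs, whatever the place. *)
have /choice[th thE] (d : 'I_n) : exists th : K, d \in D -> forall r' : place,
    \det (\matrix_(i < d.+1, k < d.+1) w d i (r' (d, inord k))) =
    th * \det (level_mx (fun=> flag C b) r' d).
  have [dD|dD] := boolP (d \in D); last by exists 0.
  have /choice[c cE] (i : 'I_d.+1) : exists c : 'I_n -> K,
      w d i = \sum_(j : 'I_n | (j <= d)%N) c j *: X`_j.
    have [||c cE] := @memv_span_take X d.+1 (w d i).
    - by rewrite sX.
    - by rewrite -UX.
    by exists c; apply: cE.
  exists (\det (\matrix_(i < d.+1, j < d.+1) c i (inord j))) => _ r'.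
  rewrite -det_mulmx; congr (\det _); apply/matrixP=> i k; rewrite mxE cE sum_ffunE mxE.
  under [RHS]eq_bigr do rewrite !mxE flagE.
  rewrite (sum_inord d (fun j => c i j * (X`_j : W) (r' (d, inord k)))).
  by apply: eq_bigr => j _; rewrite ffunE.
exists C, b, (Y r * \prod_(d in D) th d); split=> //; apply/ffunP => r'.
rewrite [LHS](cramer r') [RHS]ffunE [in RHS]ffunE /GRing.scale /= -[RHS]mulrA -big_split.
by congr (_ * _); apply: eq_bigr => d dD; rewrite thE.
Qed.

End SchubertFlags.

(** * Forgetting levels *)

Section Truncation.
Context {K : numFieldType} {n' : nat}.
Local Notation n := n'.+1.
Local Notation basis := ('I_2 * 'I_n)%type.
Local Notation slot := ('I_n * 'I_n)%type.
Local Notation place := (@place slot basis).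
Local Notation T := (@tensors K slot basis).
Implicit Types (C : 'M[K]_n) (b : 'I_2 -> 'cV[K]_n) (r : place).

Lemma group_act_id C b : group_act C 1%:M b = b.
Proof.
apply/funext => e; rewrite /group_act (bigD1 e) //= mxE eqxx big1 ?addr0 => [|e' ne].
  by rewrite rmorph1 mul1mx.
by rewrite mxE eq_sym (negPf ne) rmorph0 mul0mx.
Qed.

Variables (DA DB : {set 'I_n}).
Hypothesis DBA : DB \subset DA.

(* Fixing the coordinates in the levels outside DB forgets the corresponding
   spaces of a flag, up to a scalar. *)
Definition freeze r (Y : T) : T :=
  [ffun r' : place => Y [ffun s : slot => if s.1 \in DB then r' s else r s]].

Lemma freeze_linear r : linear (freeze r).
Proof. by move=> c Y Z; apply/ffunP=> r'; rewrite !ffunE. Qed.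
HB.instance Definition _ r := GRing.isLinear.Build K T T _ (freeze r) (freeze_linear r).

Lemma freeze_omega r C b : freeze r (omega DA C b) =
  (\prod_(d in DA :\: DB) \det (level_mx (fun=> flag C b) r d)) *: omega DB C b.
Proof.
apply/ffunP=> r'; rewrite !ffunE /GRing.scale /= (bigID (mem DB)) /= mulrC.
congr (_ * _); apply: eq_big => [d|d].
- by rewrite inE andbC.
- move=> /andP[_ /negPf dB]; congr (\det _); apply/matrixP=> i k.
  by rewrite !mxE ffunE /= dB.
- by rewrite andb_idl // => /(subsetP DBA).
- move=> /andP[_ dB]; congr (\det _); apply/matrixP=> i k.
  by rewrite !mxE ffunE /= dB.
Qed.

Lemma freeze_coef_neq0 r C b : omega DA C b r != 0 ->
  \prod_(d in DA :\: DB) \det (level_mx (fun=> flag C b) r d) != 0.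
Proof.
rewrite ffunE => /prodf_neq0 nz; apply/prodf_neq0 => d; rewrite inE => /andP[_ dA].
exact: nz.
Qed.

Lemma omega_sub_neq0 C b : omega DA C b != 0 -> omega DB C b != 0.
Proof.
apply: contraNneq => B0; apply/eqP/ffunP => r; rewrite [RHS]ffunE; apply/eqP.
apply/negPn/negP => nz; have := freeze_omega r C b; rewrite B0 scaler0.
move/ffunP/(_ r); rewrite [RHS]ffunE [LHS]ffunE => E; case/negP: nz; apply/eqP.
by rewrite -[RHS]E; congr (fun_of_fin _ _); apply/ffunP => s; rewrite ffunE if_same.
Qed.

(** Freezing both tensors at a place where neither vanishes keeps them proportional. Hence the image
    of a line does not depend on the flag chosen to describe it. *)
Lemma omega_sub_prop C b C1 b1 k : omega DA C b != 0 ->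
  omega DA C b = k *: omega DA C1 b1 ->
  exists2 k', k' != 0 & omega DB C b = k' *: omega DB C1 b1.
Proof.
move=> nz E; have /existsP[r rnz] : [exists r, omega DA C b r != 0].
  apply: contraR nz => /existsPn Y0; apply/eqP/ffunP => r; rewrite [RHS]ffunE.
  by apply/eqP; have := Y0 r; rewrite negbK.
have rnz1 : k != 0 /\ omega DA C1 b1 r != 0.
  by move: rnz; rewrite E ffunE mulf_eq0 negb_or => /andP[].
have c0 := freeze_coef_neq0 rnz; have c1 := freeze_coef_neq0 rnz1.2.
have := freeze_omega r C b; rewrite E linearZ /= freeze_omega.
set x := \prod_(d in _) _ in c0 *; set y := \prod_(d in _) _ in c1 *; move=> Exy.
exists (x^-1 * (k * y)); first by rewrite !mulf_neq0 ?invr_neq0 //; case: rnz1.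
by rewrite -[RHS]scalerA -[(k * y) *: _]scalerA Exy scalerA mulVf // scale1r.
Qed.

End Truncation.

(** * The morphism between Schubert varieties *)

Section SchubertMap.
Context {K : numFieldType} {n' : nat}.
Local Notation n := n'.+1.
Local Notation basis := ('I_2 * 'I_n)%type.
Local Notation slot := ('I_n * 'I_n)%type.
Local Notation place := (@place slot basis).
Local Notation T := (@tensors K slot basis).
Variables (a a' : 'I_n -> nat) (z z' : 'I_n -> K) (DA DB : {set 'I_n}).
Hypotheses (z_inj : injective z) (z'_inj : injective z').
Hypothesis aD : forall i, a i = (\sum_(d in DA) ((rev_ord i : 'I_n) <= d)%N).+1.
Hypothesis a'D : forall i, a' i = (\sum_(d in DB) ((rev_ord i : 'I_n) <= d)%N).+1.
Hypotheses (DBA : DB \subset DA) (topB : ord_max \in DB).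
Variables (M : fusion_product a z) (M' : fusion_product a' z').
Local Notation phi := (fp_lfun DA M).
Local Notation phi' := (fp_lfun DB M').

Let topA : ord_max \in DA := subsetP DBA _ topB.
Let DB_gt0 : (0 < #|DB|)%N.
Proof. by apply/card_gt0P; exists ord_max. Qed.

Definition flag_of (L : {vspace M}) (p : 'M[K]_n * ('I_2 -> 'cV[K]_n)) :=
  strict_lower p.1 /\ exists y c, [/\ y != 0, y \in L & phi y = c *: omega DA p.1 p.2].

Definition flag_point (p : 'M[K]_n * ('I_2 -> 'cV[K]_n)) : M' :=
  (phi'^-1)%VF (omega DB p.1 p.2).

(** The default 0 is for spaces without a flag; every point of the Schubert variety has one. *)
Definition schubert_map (L : {vspace M}) : {vspace M'} :=
  if pselect (exists p, flag_of L p) is left ex then <[flag_point (projT1 (cid ex))]>%VS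
  else 0%VS.

Lemma phi_neq0 y : y != 0 -> phi y != 0.
Proof. by apply: contraNneq => y0; apply/eqP/(phi_inj z_inj aD); rewrite y0 linear0. Qed.

Lemma flag_of_neq0 L p : flag_of L p -> omega DA p.1 p.2 != 0.
Proof.
move=> [_ [y [c [y0 _ yE]]]]; apply: contraNneq (phi_neq0 y0) => E.
by rewrite yE E scaler0.
Qed.

Lemma flag_point_phi L p : flag_of L p -> phi' (flag_point p) = omega DB p.1 p.2.
Proof.
move=> Lp; have nz := omega_sub_neq0 DBA (flag_of_neq0 Lp).
have [Clow _] := Lp.
exact: (omega_in_limg z'_inj a'D M' Clow (omega_bottom DB_gt0 Clow nz)).
Qed.

Lemma flag_point_neq0 L p : flag_of L p -> flag_point p != 0.
Proof.
move=> Lp; apply: contraNneq (omega_sub_neq0 DBA (flag_of_neq0 Lp)) => E.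
by rewrite -(flag_point_phi Lp) E linear0.
Qed.

Lemma line_dim1 (V : vectType K) (L : {vspace V}) y :
  \dim L = 1%N -> y != 0 -> y \in L -> L = <[y]>%VS.
Proof.
move=> L1 y0 yL; apply/esym/eqP; rewrite eqEdim -memvE yL L1.
by rewrite dim_vline y0.
Qed.

Lemma eq_vline (V : vectType K) (x : V) k : k != 0 -> <[k *: x]>%VS = <[x]>%VS.
Proof.
move=> k0; apply/eqP; rewrite eqEsubv -!memvE memvZ ?memv_line //=.
by apply/vlineP; exists k^-1; rewrite scalerA mulVf // scale1r.
Qed.

Lemma schubert_mapE L p : \dim L = 1%N -> flag_of L p ->
  schubert_map L = <[flag_point p]>%VS.
Proof.
move=> L1 Lp; rewrite /schubert_map; case: pselect => [ex|[]]; last by exists p.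
case: cid => q /= Lq.
have [_ [y [c [y0 yL yE]]]] := Lp; have [_ [x [e [x0 xL xE]]]] := Lq.
have /vlineP[k xk] : x \in <[y]>%VS by rewrite -(line_dim1 L1 y0 yL).
have e0 : e != 0.
  by apply: contraNneq (phi_neq0 x0) => E; rewrite xE E scale0r.
have E : omega DA q.1 q.2 = (e^-1 * (k * c)) *: omega DA p.1 p.2.
  have xE' : phi x = k *: phi y by rewrite xk linearZ.
  by rewrite -[RHS]scalerA -[(k * c) *: _]scalerA -yE -xE' xE scalerA mulVf // scale1r.
have [k' k'0 E'] := omega_sub_prop DBA (flag_of_neq0 Lq) E.
by rewrite /flag_point E' linearZ eq_vline.
Qed.

Lemma schubert_flag_of L : schubert M L -> exists p, flag_of L p.
Proof.
move=> SL; have L0 : L != 0%VS by rewrite -dimv_eq0; case: SL => ->.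
have y0 : vpick L != 0 by rewrite vpick0.
have [C [b [c [Clow _ yE]]]] := schubert_flag z_inj aD topA SL (memv_pick L) y0.
by exists (C, b); split=> //; exists (vpick L), c; split=> //; apply: memv_pick.
Qed.

Lemma schubert_map_mem L : schubert M L -> schubert M' (schubert_map L).
Proof.
move=> SL; have [p Lp] := schubert_flag_of SL; rewrite (schubert_mapE _ Lp); last by case: SL.
have [Clow _] := Lp; have nz := omega_sub_neq0 DBA (flag_of_neq0 Lp).
apply: (flag_in_schubert z'_inj a'D Clow (omega_bottom DB_gt0 Clow nz)).
  exact: flag_point_neq0 Lp.
exact: flag_point_phi Lp.
Qed.

Lemma schubert_map_regular : regular_on (schubert M) schubert_map.
Proof.
move=> L SL; have L0 : L != 0%VS by rewrite -dimv_eq0; case: SL => ->.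
have y0 : vpick L != 0 by rewrite vpick0.
have /existsP[r rnz] : [exists r, (phi (vpick L) : T) r != 0].
  apply: contraR (phi_neq0 y0) => /existsPn Y0; apply/eqP/ffunP => r; rewrite [RHS]ffunE.
  by apply/eqP; have := Y0 r; rewrite negbK.
(* On the open set where the coordinate [r] is nonzero the map is induced by this linear map; the
   form [g] is that coordinate. *)
pose G : M -> M' := fun y => (phi'^-1)%VF (freeze DB r (phi y)).
have Glin : linear G by move=> c x y; rewrite /G !linearP.
have /choice[F FP] (j : 'I_(\dim {:M'})) :
    exists p : poly_on M, p \is 1.-homog /\ forall u, poly_eval p u = coord (vbasis {:M'}) j (G u).
  have lin : linear (fun u => coord (vbasis {:M'}) j (G u) : K^o).
    by move=> c x y; rewrite Glin linearP.
  pose g : {linear M -> K^o} := HB.pack (fun u => coord (vbasis {:M'}) j (G u) : K^o)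
    (GRing.isLinear.Build K M K^o _ _ lin).
  exact: (is_form_linear g).
have [g [gh gE]] := is_form_coordinate DA M r.
have FE u : poly_map F u = G u.
  rewrite [RHS](coord_vbasis (memvf (G u))) /poly_map; apply: eq_bigr => j _.
  by have [_ ->] := FP j.
exists 1%N, 1%N, F, g; split=> //.
- by move=> j; have [] := FP j.
- by move/(_ _ (memv_pick L)); rewrite gE => /eqP; apply/negP.
move=> L' u SL' uL' u0; rewrite gE /coordinate FE => ur.
have [C [b [c [Clow _ uE]]]] := schubert_flag z_inj aD topA SL' uL' u0.
have L'p : flag_of L' (C, b) by split=> //; exists u, c.
have : c * omega DA C b r != 0 by move: ur; rewrite uE ffunE.
rewrite mulf_eq0 negb_or => /andP[c0 /(freeze_coef_neq0 DB) k0].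
have -> : G u = (c * \prod_(d in DA :\: DB) \det (level_mx (fun=> flag C b) r d)) *:
    flag_point (C, b).
  by rewrite /G uE linearZ /= freeze_omega // scalerA linearZ.
split; first by rewrite scaler_eq0 negb_or mulf_neq0 // (flag_point_neq0 L'p).
by rewrite eq_vline ?mulf_neq0 // (schubert_mapE _ L'p) //; case: SL'.
Qed.

(** The flag that describes a target point is already complete, so the same pair [(C, b)] defines a
    preimage. *)
Lemma schubert_map_surjective : is_surjective (schubert M) (schubert M') schubert_map.
Proof.
move=> L' SL'; have L'0 : L' != 0%VS by rewrite -dimv_eq0; case: SL' => ->.
have y'0 : vpick L' != 0 by rewrite vpick0.
have [C [b [c [Clow Cfull y'E]]]] := schubert_flag z'_inj a'D topB SL' (memv_pick L') y'0.
have Anz := full_flag_omega DA Cfull; have bottom := full_flag_bottom Clow Cfull.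
pose y := (phi^-1)%VF (omega DA C b).
have yE : phi y = omega DA C b := omega_in_limg z_inj aD M Clow bottom.
have y0 : y != 0 by apply: contraNneq Anz => E; rewrite -yE E linear0.
have Lp : flag_of <[y]>%VS (C, b).
  by split=> //; exists y, 1; split=> //; rewrite ?memv_line // scale1r.
exists <[y]>%VS; first exact: (flag_in_schubert z_inj aD Clow bottom).
rewrite (schubert_mapE _ Lp) ?dim_vline ?y0 //.
have c0 : c != 0.
  apply: contraNneq y'0 => c0; apply/eqP/(phi_inj z'_inj a'D).
  by rewrite y'E c0 scale0r linear0.
rewrite (line_dim1 _ y'0 (memv_pick L')); last by case: SL'.
rewrite -(eq_vline _ c0); congr (<[_]>)%VS; apply: (phi_inj z'_inj a'D).
by rewrite linearZ /= (flag_point_phi Lp) y'E.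
Qed.

Lemma schubert_map_equivariant :
  equivariant (schubert M) (schubert_map : {vspace M} -> {vspace M'}).
Proof.
move=> g S S' L dg gS gS' SL; have [[C b] Lp] := schubert_flag_of SL.
have L1 : \dim L = 1%N by case: SL.
have [/= Clow [y [c [y0 yL yE]]]] := Lp; have Cn := strict_lower_nil Clow (leqnn n).
have SyE := fp_lfun_SL2_acts z_inj aD gS Cn yE.
(* [SL2_acts] is a relation, so invertibility of [S] has to be seen through [phi]: an operator
   attached to the inverse of g brings [S y] back to [y]. *)
have Sy0 : S y != 0.
  have gu : g \in unitmx by rewrite unitmxE dg unitr1.
  have [|R gR] := @SL2_acts_total _ _ _ _ M (invmx g); first by rewrite det_inv dg invr1.
  have RSy : R (S y) = y.
    apply: (phi_inj z_inj aD); rewrite (fp_lfun_SL2_acts z_inj aD gR Cn SyE).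
    by rewrite -group_actM // mulVmx // group_act_id yE.
  by apply: contraNneq y0 => E; rewrite -RSy E linear0.
have SL1 : (S @: L)%VS = <[S y]>%VS by rewrite (line_dim1 L1 y0 yL) limg_line.
have SLp : flag_of (S @: L)%VS (C, group_act C g b).
  by split=> //; exists (S y), c; split=> //; apply: memv_img.
rewrite (schubert_mapE _ SLp) ?SL1 ?dim_vline ?Sy0 // (schubert_mapE L1 Lp) limg_line.
congr (<[_]>)%VS; apply: (phi_inj z'_inj a'D).
rewrite (flag_point_phi SLp); have E : phi' (flag_point (C, b)) = 1 *: omega DB C b.
  by rewrite scale1r (flag_point_phi Lp).
by rewrite (fp_lfun_SL2_acts z'_inj a'D gS' Cn E) scale1r.
Qed.

End SchubertMap.

(** * Types as sets of levels *)

Lemma blocks_staircase (I : seq nat) m : all (leq 1) I ->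
  let A := blocks I (iota m (size I)) in
  [/\ size A = sumn I, ((0 < size A)%N -> nth 0%N A 0 = m) &
    forall l, (l.+1 < size A)%N ->
      nth 0%N A l.+1 = nth 0%N A l \/ nth 0%N A l.+1 = (nth 0%N A l).+1].
Proof.
elim: I m => [|i I IH] m /=; first by split.
case/andP=> i0 /(IH m.+1); rewrite /blocks /=.
set B := flatten _; move=> /= [sB B0 Bstep].
have nthE l : nth 0%N (nseq i m ++ B) l = if (l < i)%N then m else nth 0%N B (l - i).
  by rewrite nth_cat size_nseq nth_nseq; case: ltnP.
split=> [|_|l]; first by rewrite size_cat size_nseq sB.
  by rewrite nthE i0.
rewrite size_cat size_nseq !nthE => lt.
have [li|il] := ltnP l.+1 i; first by rewrite (ltnW li); left.
have [li'|il'] := ltnP l i.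
  have -> : (l.+1 - i)%N = 0%N by lia.
  by right; apply: B0; lia.
have -> : (l.+1 - i)%N = (l - i).+1 by lia.
by apply: Bstep; lia.
Qed.

(* Position p starts a block when p = 0 or the entry at p - 1 differs; it
   contributes the level n - 1 - p. *)
Definition type_levels n' (I : seq nat) : {set 'I_n'.+1} :=
  [set d | let p := (rev_ord d : nat) in
     (p == 0%N) || (nth 0%N (blocks I (iota 2 (size I))) p
                      != nth 0%N (blocks I (iota 2 (size I))) p.-1)].

(** Entries begin at 2 and rise by one at each later block start; position 0 counts as a start too,
    which leaves the offset one. *)
Lemma type_dims_levels n' (I : seq nat) (i : 'I_n'.+1) : is_type n'.+1 I ->
  type_dims I i = (\sum_(d in type_levels n' I) ((rev_ord i : 'I_n'.+1) <= d)%N).+1.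
Proof.
move=> [I1 sI]; have [sA A0 Astep] := blocks_staircase 2 I1.
rewrite /type_dims; set A := blocks _ _ in sA A0 Astep *.
pose st p := (p == 0%N) || (nth 0%N A p != nth 0%N A p.-1).
have -> : (\sum_(d in type_levels n' I) ((rev_ord i : 'I_n'.+1) <= d)%N)%N =
    (\sum_(p < n'.+1 | (p < i.+1)%N) st p)%N.
  rewrite (reindex_inj rev_ord_inj) [LHS]big_mkcond [RHS]big_mkcond /=.
  apply: eq_bigr => p _; rewrite inE rev_ordK -/(st p).
  have -> : (n'.+1 - i.+1 <= n'.+1 - p.+1)%N = (p < i.+1)%N.
    by have := ltn_ord i; have := ltn_ord p; lia.
  rewrite -[let p0 := _ in _]/(st p); case: (st p); case: (p < i.+1)%N => //.
rewrite (big_ord_narrow (ltn_ord i)) /=.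
rewrite sI in sA; have lt_i : (i < size A)%N by rewrite sA ltn_ord.
elim: (i : nat) lt_i => [|k IH] lt.
  by rewrite big_ord_recl big_ord0 A0 ?sA.
rewrite big_ord_recr /= -addSn -IH ?(ltnW lt) // /st /=.
by case: (Astep k lt) => ->; case: eqP => //=; lia.
Qed.

Lemma blocks_has_type I : all (leq 1) I -> has_type (blocks I (iota 2 (size I))) I.
Proof.
move=> I1; split; last first.
  exists (iota 2 (size I)); split=> //; first by rewrite size_iota.
  by apply: sub_sorted (iota_ltn_sorted 2 (size I)) => x y /=; rewrite ltn_neqAle => /andP[].
rewrite /blocks; elim: (I) 2%N (isT : (0 < 2)%N) => //= i l IH m m0.
by rewrite all_cat IH // andbT all_nseq m0 orbT.
Qed.

(** Applied to the two staircase tuples, the order says that a jump for J is a jump for I. *)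
Lemma type_levels_sub n' (I J : seq nat) : all (leq 1) I -> all (leq 1) J ->
  type_ge n'.+1 I J -> type_levels n' J \subset type_levels n' I.
Proof.
move=> I1 J1 ge; apply/subsetP => d; rewrite !inE /=.
case E: (n'.+1 - d.+1)%N => [|p] //=; apply: contraNN => /eqP AE; apply/eqP/esym.
by apply: (ge _ _ (blocks_has_type I1) (blocks_has_type J1)); [lia|rewrite AE].
Qed.

Lemma equivariant_surjection_of_type_ge (K : numFieldType) n' (I J : seq nat) :
  is_type n'.+1 I -> is_type n'.+1 J -> type_ge n'.+1 I J ->
  equivariant_surjection K n'.+1 I J.
Proof.
move=> tI tJ ge z w z_inj w_inj M M'.
have aI i := type_dims_levels i tI; have aJ i := type_dims_levels i tJ.
have sub := type_levels_sub tI.1 tJ.1 ge.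
have top : ord_max \in type_levels n' J by rewrite inE /= subnn.
exists (@schubert_map _ _ _ _ _ _ (type_levels n' I) (type_levels n' J) M M'); split.
- split; first exact: (schubert_map_mem z_inj w_inj aI aJ sub top).
  exact: (schubert_map_regular z_inj w_inj aI aJ sub top).
- exact: (schubert_map_surjective z_inj w_inj aI aJ sub top).
- exact: (schubert_map_equivariant z_inj w_inj aI aJ sub top).
Qed.

Lemma blocks_nseq1 (c : seq nat) : blocks (nseq (size c) 1%N) c = c.
Proof. by rewrite /blocks; elim: c => //= x c ->. Qed.

(** Neighbouring entries of a tuple of type (1, ..., 1) always differ, so the condition is
    vacuous. *)
Lemma type_ge_nseq1 n I : type_ge n (nseq n 1%N) I.
Proof.
move=> A B [_ [c [sc srt ->]]] _ l lt; rewrite size_nseq in sc.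
rewrite -{1 2}sc blocks_nseq1 => E; have := sortedP 0%N srt.
by move=> /(_ l); rewrite sc lt E eqxx => /(_ isT).
Qed.

Theorem corollary3p1 (R : realType) (n : nat) (n_gt0 : (0 < n)%N) :
  (forall I J : seq nat, is_type n I -> is_type n J -> type_ge n I J ->
     equivariant_surjection R[i] n I J) /\
  (forall I : seq nat, is_type n I ->
     equivariant_surjection R[i] n (nseq n 1%N) I).
Proof.
case: n n_gt0 => // n' _.
have main I J : is_type n'.+1 I -> is_type n'.+1 J -> type_ge n'.+1 I J ->
    equivariant_surjection R[i] n'.+1 I J by exact: equivariant_surjection_of_type_ge.
split=> // I tI; apply: main => //; last exact: type_ge_nseq1.
by split; rewrite ?all_nseq ?sumn_nseq ?mul1n.
Qed.
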